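(* Let $X$ be a separable real Banach space, $G\subset X$ an open set, $Y$ a real Banach space, $\mathcal{L}$ a norm-separable subspace of the space $\mathrm{Lin}(X,Y)$ of bounded linear operators from $X$ to $Y$, and $f:G\to Y$ a Lipschitz function. Then $f$ is Fréchet differentiable at $\Gamma$-almost every point $x$ at which $f$ is regular, Gâteaux differentiable and $D_f(x)\in\mathcal{L}$; that is, the set of those $x\in G$ such that $x$ is a regular point of $f$, $f$ is Gâteaux differentiable at $x$ with $D_f(x)\in\mathcal{L}$, but $f$ is not Fréchet differentiable at $x$, is $\Gamma$-null.
   Context: Derivatives. For $f$ defined on an open subset of $X$ with values in $Y$, $f'(x,v)=\lim_{t\to0}(f(x+tv)-f(x))/t$ is the directional derivative when it exists. $f$ is Gâteaux differentiable at $x$, with derivative $D_f(x)$, if all $f'(x,v)$, $v\in X$, exist and $v\mapsto f'(x,v)=D_f(x)v$ is a bounded linear operator. It is Fréchet differentiable at $x$ if there is a bounded linear operator $T$ with $f(x+u)=f(x)+Tu+o(\|u\|)$ as $\|u\|\to0$. Regular point. A point $x$ is a regular point of $f$ (one also says $f$ is regular at $x$) if for every $v\in X$ for which $f'(x,v)$ exists, $\lim_{t\to0}\frac{f(x+tu+tv)-f(x+tu)}{t}=f'(x,v)$ uniformly for $u\in X$ with $\|u\|\le1$. $\Gamma$-null sets. $T=[0,1]^{\mathbb{N}}$ carries the product topology and the product Lebesgue (probability) measure $\mu$. $\Gamma(X)$ is the space of continuous maps $\gamma:T\to X$ having continuous partial derivatives $D_j\gamma:T\to X$ for all $j\in\mathbb{N}$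 (one-sided where the $j$-th coordinate is $0$ or $1$), with the topology generated by the seminorms $\|\gamma\|_0=\sup_{t\in T}\|\gamma(t)\|$ and $\|\gamma\|_k=\sup_{t\in T}\|D_k\gamma(t)\|$, $k\ge1$. A Borel set $N\subset X$ is $\Gamma$-null if $\mu\{t\in T:\gamma(t)\in N\}=0$ for all $\gamma$ in a residual (comeager) subset of $\Gamma(X)$. An arbitrary set is $\Gamma$-null if it is contained in a Borel $\Gamma$-null set. *)

(* Defs.v *)
From HB Require Import structures.
From mathcomp Require Import all_boot all_order all_algebra.
From mathcomp Require Import all_classical all_reals all_analysis.
From mathcomp Require Import measurable_realfun.

Set Implicit Arguments.
Unset Strict Implicit.
Unset Printing Implicit Defensive.
Import Order.TTheory GRing.Theory Num.Theory.
Import numFieldNormedType.Exports.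

Local Open Scope classical_set_scope.
Local Open Scope ring_scope.

Definition unit_itv (R : realType) : set R := `[0, 1]%classic.
Arguments unit_itv R : clear implicits.

Definition cube (R : realType) :=
  prod_topology (fun _ : nat => set_type (unit_itv R)).

HB.instance Definition _ (R : realType) := Topological.on (cube R).

Section product_lebesgue_measure.
Context (R : realType).
Local Notation I := (set_type (unit_itv R)).
Local Notation T := (cube R).

Lemma unit_itv0 : (0 : R) \in unit_itv R.
Proof. by rewrite inE /unit_itv /= in_itv /= lexx ler01. Qed.

Definition cube0 : T := fun _ => exist _ 0 unit_itv0 : I.

HB.instance Definition _ := isPointed.Build T cube0.

(* A finite sequence B of subsets of R encodes the cylinder of those t such
   that t i is in B`_i for i < size B; the other coordinates are free. *)
Definition side (B : seq (set R)) (i : nat) : set R := nth setT B i.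

Definition cylinder (B : seq (set R)) : set T :=
  [set t | forall i, side B i (\val (t i))].

Definition msides (B : seq (set R)) := forall i, measurable (side B i).

Definition side_length (S : set R) : R :=
  fine (lebesgue_measure (S `&` unit_itv R)).

Definition cylinder_vol (B : seq (set R)) : R :=
  \prod_(S <- B) side_length S.

Definition cylinders : set (set T) := [set cylinder B | B in msides].

HB.instance Definition _ := @isMeasurable.Build (sigma_display cylinders)
  T <<s cylinders >> (@sigma_algebra0 _ setT cylinders)
  (@sigma_algebraC _ cylinders) (@sigma_algebra_bigcup _ setT cylinders).

Definition cylinder_cover (A : set T) : set (nat -> seq (set R)) :=
  [set B | (forall k, msides (B k)) /\ A `<=` \bigcup_k cylinder (B k)].

Local Open Scope ereal_scope.

(* The outer measure generated by the cylinder volumes; by the instances and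
   cube_measure_cylinder below it is the product Lebesgue probability on the
   product sigma-algebra. *)
Definition cube_measure (A : set T) : \bar R :=
  ereal_inf [set \sum_(k <oo) (cylinder_vol (B k))%:E | B in cylinder_cover A].


Local Notation lambda := (@lebesgue_measure R).

Lemma measurable_unit_itv : measurable (unit_itv R).
Proof. exact: measurable_itv. Qed.

Lemma side_length_EFin S : measurable S ->
  (side_length S)%:E = lambda (S `&` unit_itv R).
Proof.
move=> mS; rewrite /side_length fineK// ge0_fin_numE//.
apply: (@le_lt_trans _ _ (lambda (unit_itv R))).
  apply: le_measure; rewrite ?inE//; [|exact: measurable_unit_itv].
  by apply: measurableI => //; exact: measurable_unit_itv.
by rewrite lebesgue_measure_itv/= lte01 oppr0 adde0 ltry.
Qed.

Lemma side_length_ge0 S : (0 <= side_length S)%R.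
Proof. exact: fine_ge0. Qed.

Lemma side_lengthT : side_length setT = 1%R.
Proof.
by rewrite /side_length setTI lebesgue_measure_itv/= lte01 oppr0 adde0.
Qed.

Lemma side_length_split S U : measurable S -> measurable U ->
  side_length S = (side_length (S `&` U) + side_length (S `&` ~` U))%R.
Proof.
move=> mS mU; have mI := measurable_unit_itv.
have mSU := measurableI _ _ mS mU.
have mSU' := measurableI _ _ mS (measurableC mU).
apply: EFin_inj; rewrite EFinD !side_length_EFin// -measureU.
- by rewrite -setIUl -setIUr setUv setIT.
- exact: measurableI.
- exact: measurableI.
- by apply/seteqP; split => // x [[[_ Ux] _] [[_ /(_ Ux)]]].
Qed.

Lemma cylinder_vol_ge0 B : (0 <= cylinder_vol B)%R.
Proof. by apply: prodr_ge0 => *; exact: side_length_ge0. Qed.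

Lemma cylinder_volE B n : (size B <= n)%N ->
  cylinder_vol B = (\prod_(0 <= i < n) side_length (side B i))%R.
Proof.
move=> Bn; rewrite /cylinder_vol (big_nth setT).
rewrite [RHS](big_cat_nat (n := size B))//= -[LHS]mulr1; congr (_ * _)%R.
rewrite big_nat_cond big1// => i /andP[/andP[Bi _] _].
by rewrite /side nth_default// side_lengthT.
Qed.

Lemma cube_measure_ge0 A : 0 <= cube_measure A.
Proof.
apply: le_ereal_inf_tmp => _ [B _ <-].
by apply: nneseries_ge0 => n _ _; rewrite lee_fin cylinder_vol_ge0.
Qed.

Lemma le_cube_measure : {homo cube_measure : A B / A `<=` B >-> A <= B}.
Proof.
move=> A B AB; apply/ereal_inf_le_tmp => _ [C [mC BC] <-].
by exists C => //; split => //; exact: subset_trans AB BC.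
Qed.

Lemma msides1 S : measurable S -> msides [:: S].
Proof. by move=> mS [|[|i]] //=; exact: measurableT. Qed.

Lemma cube_measure0 : cube_measure set0 = 0.
Proof.
apply/eqP; rewrite eq_le cube_measure_ge0 andbT; apply: ereal_inf_lbound.
exists (fun=> [:: set0]); first by split => // k; apply: msides1.
rewrite eseries0// => k _ _.
by rewrite /cylinder_vol big_seq1 /side_length set0I measure0.
Qed.

Lemma cube_measure_sigma_subadditive : sigma_subadditive cube_measure.
Proof.
move=> A; have [[i ioo]|] := pselect (exists i, cube_measure (A i) = +oo).
  rewrite (eseries_pinfty _ _ ioo) ?leey// => n _.
  by rewrite -ltNye (lt_le_trans _ (cube_measure_ge0 _)).
rewrite -forallNE => Aoo; apply/lee_addgt0Pr => e e0.
rewrite (le_trans _ (epsilon_trick _ _ (ltW e0)))//; last first.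
  by move=> n; exact: cube_measure_ge0.
pose P n (B : nat -> seq (set R)) := cylinder_cover (A n) B /\
  \sum_(k <oo) (cylinder_vol (B k))%:E <=
    cube_measure (A n) + (e / (2 ^ n.+1)%:R)%:E.
have [G PG] : {G : nat -> nat -> seq (set R) & forall n, P n (G n)}.
  apply: (@choice _ _ P) => n; rewrite /P.
  have en1 : (0 < e / (2 ^ n.+1)%:R)%R by rewrite divr_gt0// ltr0n expn_gt0.
  have fA : cube_measure (A n) \is a fin_num.
    by rewrite ge0_fin_numE ?cube_measure_ge0// ltey; apply/eqP/Aoo.
  have [_ [B cB <-] /ltW ?] := lb_ereal_inf_adherent en1 fA.
  by exists B.
pose vG (p : nat * nat) := (cylinder_vol (G p.1 p.2))%:E.
have vG_ge0 p : 0 <= vG p by rewrite lee_fin cylinder_vol_ge0.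
apply: (@le_trans _ _ (\esum_(p in setT) vG p)).
  apply: ereal_inf_lbound.
  have /card_esym/ppcard_eqP[f] := card_nat2.
  exists (fun k => G (f k).1 (f k).2).
    split=> [k|t [n _ Ant]]; first exact: (PG _).1.1.
    have [k _ Gk] := (PG n).1.2 _ Ant.
    by exists (f^-1%FUN (n, k)) => //=; rewrite invK ?inE.
  rewrite -(esum_pred_image vG _ xpredT) ?[fun=> _]set_true//.
  by rewrite image_eq.
have -> : \esum_(p in setT) vG p =
    \sum_(i <oo) \sum_(j <oo) (cylinder_vol (G i j))%:E.
  rewrite nneseries_esumT; last by move=> n; apply: nneseries_ge0 => k _ _;
    exact: (vG_ge0 (n, k)).
  rewrite (eq_esum (b := fun i => \esum_(j in setT) vG (i, j))); last first.
    by move=> i _; rewrite nneseries_esumT// => j; exact: (vG_ge0 (i, j)).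
  rewrite esum_esum; last by move=> i j _ _; exact: (vG_ge0 (i, j)).
  by congr esum; apply/seteqP; split => // -[].
apply: lee_nneseries => n *; last exact: (PG n).2.
by apply: nneseries_ge0 => m *; exact: (vG_ge0 (n, m)).
Qed.

HB.instance Definition _ := isOuterMeasure.Build R T cube_measure
  cube_measure0 cube_measure_ge0 le_cube_measure cube_measure_sigma_subadditive.

Definition refine (i : nat) (U : set R) (B : seq (set R)) : seq (set R) :=
  mkseq (fun j => if j == i then side B j `&` U else side B j)
    (maxn (size B) i.+1).

Lemma side_refine i U B j :
  side (refine i U B) j = if j == i then side B j `&` U else side B j.
Proof.
rewrite {1}/side; have [jN|] := ltnP j (maxn (size B) i.+1).
  by rewrite nth_mkseq.
rewrite geq_max => /andP[Bj ij]; rewrite nth_default; last first.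
  by rewrite size_mkseq geq_max Bj.
by rewrite gtn_eqF// /side nth_default.
Qed.

Lemma msides_refine i U B : measurable U -> msides B -> msides (refine i U B).
Proof.
move=> mU mB j; rewrite side_refine; case: ifPn => // _.
exact: measurableI.
Qed.

Lemma cylinder_refine i U B :
  cylinder (refine i U B) = cylinder B `&` [set t : T | U (\val (t i))].
Proof.
apply/seteqP; split => [t tB|t [tB Ut] j]; last first.
  by rewrite side_refine; case: eqP => [->|_]; [split|]; rewrite ?Ut//; exact: tB.
split=> [j|/=]; last by have := tB i; rewrite side_refine eqxx => -[].
by have := tB j; rewrite side_refine; case: ifPn => // _ [].
Qed.

Lemma cylinder_vol_refine i U B : measurable U -> msides B ->
  (cylinder_vol B =
    cylinder_vol (refine i U B) + cylinder_vol (refine i (~` U) B))%R.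
Proof.
move=> mU mB; pose N := maxn (size B) i.+1.
have iN : (i < N)%N by rewrite leq_max leqnn orbT.
have volD C : (size C <= N)%N -> cylinder_vol C =
    (side_length (side C i) *
     \prod_(j < N | j != Ordinal iN) side_length (side C j))%R.
  by move=> /cylinder_volE ->; rewrite big_mkord (bigD1 (Ordinal iN)).
rewrite !volD ?size_mkseq ?leq_maxl//.
rewrite !side_refine eqxx (side_length_split (mB i) mU) mulrDl.
congr (_ * _ + _ * _)%R; apply: eq_bigr => j ji;
  by rewrite side_refine -[X in _ == X]/(val (Ordinal iN)) (inj_eq val_inj) (negbTE ji).
Qed.

Lemma caratheodory_slab i U : measurable U ->
  caratheodory_measurable cube_measure [set t : T | U (\val (t i))].
Proof.
move=> mU; apply: le_caratheodory_measurable => A.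
apply: le_ereal_inf_tmp => _ [B [mB AB] <-].
under eq_eseriesr => k _ do rewrite (cylinder_vol_refine i mU (mB k)) EFinD.
rewrite nneseriesD; [|by move=> k _ _; rewrite lee_fin cylinder_vol_ge0..].
have mUC := measurableC mU.
apply: leeD; apply: ereal_inf_lbound.
- exists (fun k => refine i U (B k)) => //; split=> [k|t [At Ut]].
    exact: msides_refine.
  by have [k _ Bk] := AB _ At; exists k => //; rewrite cylinder_refine.
- exists (fun k => refine i (~` U) (B k)) => //; split=> [k|t [At Ut]].
    exact: msides_refine.
  by have [k _ Bk] := AB _ At; exists k => //; rewrite cylinder_refine.
Qed.

Lemma measurable_caratheodory (A : set T) :
  measurable A -> caratheodory_measurable cube_measure A.
Proof.
move: A; apply: smallest_sub.
  split=> [|A mA|F mF]; first exact: caratheodory_measurable_set0.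
    by rewrite setTD; exact: caratheodory_measurable_setC.
  exact: caratheodory_measurable_bigcup.
move=> _ [B mB <-]; rewrite -[cylinder B]setCK.
apply: caratheodory_measurable_setC.
have -> : ~` cylinder B = \bigcup_i ~` [set t : T | side B i (\val (t i))].
  apply/seteqP; split => [t|t [i _ tB] /(_ i)//].
  by move=> /existsNP[i ti]; exists i.
apply: caratheodory_measurable_bigcup => i.
by apply: caratheodory_measurable_setC; exact: caratheodory_slab.
Qed.

Lemma cube_measure_semi_sigma_additive : semi_sigma_additive cube_measure.
Proof.
move=> F mF tF _.
apply: (@caratheodory_measure_sigma_additive _ _ cube_measure) => //.
- by move=> i; exact: measurable_caratheodory.
- by apply: caratheodory_measurable_bigcup => i; exact: measurable_caratheodory.
Qed.

HB.instance Definition _ := isMeasure.Build _ T R cube_measure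
  cube_measure0 cube_measure_ge0 cube_measure_semi_sigma_additive.

(* Given a cover of a cylinder of larger volume, coordinates are chosen one
   at a time so that the conditional volumes stay in strict inequality. *)
Let cond_vol (B : seq (set R)) (m : nat) (t : T) : R :=
  ((\prod_(0 <= i < m) \1_(side B i) (\val (t i))) *
   \prod_(m <= i < size B) side_length (side B i))%R.

Let cond_vol_ge0 B m t : (0 <= cond_vol B m t)%R.
Proof.
by apply: mulr_ge0; apply: prodr_ge0 => *//; exact: side_length_ge0.
Qed.

Let cond_vol0 B t : cond_vol B 0 t = cylinder_vol B.
Proof. by rewrite /cond_vol big_geq// mul1r (@cylinder_volE _ (size B)). Qed.

Let cond_volS B m t s :
  cond_vol B m.+1 (dfwith t m s) =
  (\1_(side B m) (\val s) * ((\prod_(0 <= i < m) \1_(side B i) (\val (t i))) *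
   \prod_(m.+1 <= i < size B) side_length (side B i)))%R.
Proof.
rewrite /cond_vol big_nat_recr//= dfwithin mulrAC mulrC; congr (_ * _)%R.
congr (_ * _)%R; rewrite !big_nat; apply: eq_bigr => i /= im.
by rewrite dfwithout// gtn_eqF.
Qed.

Let cond_volE B m t : cond_vol B m t =
  (side_length (side B m) * ((\prod_(0 <= i < m) \1_(side B i) (\val (t i))) *
   \prod_(m.+1 <= i < size B) side_length (side B i)))%R.
Proof.
rewrite /cond_vol mulrCA; congr (_ * _)%R.
have [mB|Bm] := ltnP m (size B); first by rewrite big_ltn.
by rewrite !big_geq ?(leq_trans Bm)// /side nth_default// side_lengthT mulr1.
Qed.

Let cond_vol_late B m t : (size B <= m)%N -> cylinder B t -> cond_vol B m t = 1%R.
Proof.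
move=> Bm Bt; rewrite /cond_vol [X in (_ * X)%R]big_geq// mulr1.
by rewrite big1// => i _; rewrite indicE mem_set//; exact: Bt.
Qed.

Let cond_vol_late_cyl B m t : (size B <= m)%N -> (0 < cond_vol B m t)%R ->
  cylinder B t.
Proof.
move=> Bm + i; rewrite /cond_vol [X in (_ * X)%R]big_geq// mulr1 => Pt.
have [im|mi] := ltnP i m; last by rewrite /side nth_default// (leq_trans Bm).
apply: contrapT => nB; move: Pt; rewrite big_mkord (bigD1 (Ordinal im))//=.
by rewrite indicE memNset// mul0r ltxx.
Qed.

Let cond_vol_eq B m t u : (forall i, (i < m)%N -> t i = u i) ->
  cond_vol B m t = cond_vol B m u.
Proof.
move=> tu; congr (_ * _)%R; rewrite !big_nat; apply: eq_bigr => i /= im.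
by rewrite tu.
Qed.

Let clamp (x : R) : I := insubd (cube0 0%N) x.

Let clampK x : unit_itv R x -> \val (clamp x) = x.
Proof. by move=> xI; rewrite insubdK// mem_set. Qed.

Let integral_cond_vol B m t : msides B ->
  \int[lambda]_(x in unit_itv R) (cond_vol B m.+1 (dfwith t m (clamp x)))%:E =
  (cond_vol B m t)%:E.
Proof.
move=> mB; under eq_integral => x /set_mem xI do rewrite cond_volS clampK// mulrC.
rewrite cond_volE; set c := (_ * \prod_(_ <= i < _) _)%R.
have c0 : (0 <= c)%R.
  by apply: mulr_ge0; apply: prodr_ge0 => *//; exact: side_length_ge0.
move: c c0 => c c0; under eq_integral do rewrite EFinM.
rewrite ge0_integralZl//.
- rewrite integral_indic; [|exact: measurable_unit_itv|exact: mB].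
  by rewrite mulrC EFinM side_length_EFin.
- exact: measurable_unit_itv.
- apply/measurable_EFinP; apply: measurable_indic; exact: mB.
Qed.

Let measurable_cond_vol B m t : msides B -> measurable_fun (unit_itv R)
  (fun x => (cond_vol B m.+1 (dfwith t m (clamp x)))%:E).
Proof.
move=> mB; set c := (\prod_(0 <= i < m) \1_(side B i) (\val (t i)) *
   \prod_(m.+1 <= i < size B) side_length (side B i))%R.
apply: (@eq_measurable_fun _ _ _ _ _ (fun x => (\1_(side B m) x * c)%:E)).
  by move=> x /set_mem xI; rewrite cond_volS clampK.
apply/measurable_EFinP; apply: measurable_funM => //; apply: measurable_indic; exact: mB.
Qed.

Lemma cylinder_vol_le (B0 : seq (set R)) (B : nat -> seq (set R)) :
  msides B0 -> (forall k, msides (B k)) ->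
  cylinder B0 `<=` \bigcup_k cylinder (B k) ->
  (cylinder_vol B0)%:E <= \sum_(k <oo) (cylinder_vol (B k))%:E.
Proof.
move=> mB0 mB B0B; rewrite leNgt; apply/negP => ltB.
pose P m (t : T) :=
  \sum_(k <oo) (cond_vol (B k) m t)%:E < (cond_vol B0 m t)%:E.
have step m t : exists s : I, P m t -> P m.+1 (dfwith t m s).
  apply: contrapT => /forallNP nP.
  have Pmt : P m t by apply: contrapT => nPmt; apply: (nP (cube0 0%N)) => /nPmt.
  move: (Pmt); apply/negP; rewrite -leNgt -integral_cond_vol//.
  under eq_eseriesr => k _ do rewrite -(integral_cond_vol _ _ (mB k)).
  rewrite -integral_nneseries; [|exact: measurable_unit_itv| |]; last 2 first.
  - by move=> k; exact: measurable_cond_vol.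
  - by move=> k x _; rewrite lee_fin.
  apply: ge0_le_integral.
  - exact: measurable_unit_itv.
  - by move=> x _; rewrite lee_fin.
  - exact: (measurable_cond_vol _ _ mB0).
  - apply: ge0_emeasurable_sum => k *; first by rewrite lee_fin.
    exact: measurable_cond_vol.
  - move=> x _; rewrite leNgt; apply/negP => Px.
    by apply: (nP (clamp x)) => _.
have [g gP] : {g : nat * T -> I & forall p, P p.1 p.2 -> P p.1.+1 (dfwith p.2 p.1 (g p))}.
  by apply: (@choice _ _ (fun p s => P p.1 p.2 -> P p.1.+1 (dfwith p.2 p.1 s))) => -[].
pose u := nat_rect (fun=> T) cube0 (fun m t => dfwith t m (g (m, t))).
have Pu m : P m (u m).
  elim: m => [|m IH]; last exact: (gP (m, u m)).
  by rewrite /P; under eq_eseriesr do rewrite cond_vol0; rewrite cond_vol0.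
pose t : T := fun i => u i.+1 i.
have ut m i : (i < m)%N -> u m i = t i.
  elim: m => // m IH; rewrite ltnS leq_eqVlt => /predU1P[->//|im].
  by rewrite /= dfwithout ?IH// gtn_eqF.
have Pt m : P m t.
  have := Pu m; rewrite /P (@cond_vol_eq _ _ _ t) => [|i]; last exact: ut.
  by under eq_eseriesr => k _ do rewrite (@cond_vol_eq _ _ _ t (ut m)).
have sum0 m : 0 <= \sum_(k <oo) (cond_vol (B k) m t)%:E.
  by apply: nneseries_ge0 => k _ _; rewrite lee_fin.
have B0t : cylinder B0 t.
  apply: (@cond_vol_late_cyl _ (size B0)) => //.
  by rewrite -lte_fin (le_lt_trans (sum0 _) (Pt _)).
have [k _ Bkt] := B0B _ B0t.
have := Pt (maxn (size B0) (size (B k))).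
rewrite /P (cond_vol_late (leq_maxl _ _) B0t); apply/negP; rewrite -leNgt.
set m := maxn _ _; rewrite -(cond_vol_late (leq_maxr _ _ : (_ <= m)%N) Bkt).
have := @nneseries_lim_ge R (fun k => (cond_vol (B k) m t)%:E) xpredT 0 k.+1.
move=> /(_ (fun j _ _ => ltac:(by rewrite lee_fin))); apply: le_trans.
rewrite big_nat_recr//= leeDr// sume_ge0// => j _; by rewrite lee_fin.
Qed.

Lemma cube_measure_cylinder B : msides B ->
  cube_measure (cylinder B) = (cylinder_vol B)%:E.
Proof.
move=> mB; apply/eqP; rewrite eq_le; apply/andP; split; last first.
  by apply: le_ereal_inf_tmp => _ [C [mC BC] <-]; exact: cylinder_vol_le.
apply: ereal_inf_lbound; exists (fun k => if k is 0%N then B else [:: set0]).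
  split=> [[|k]//|t Bt]; [exact: msides1|by exists 0%N].
rewrite nneseries_recl//; last by move=> k _; rewrite lee_fin cylinder_vol_ge0.
rewrite eseries_cond eseries0 ?adde0// => -[|k]// _ _.
by rewrite /cylinder_vol big_seq1 /side_length set0I measure0.
Qed.

Lemma cube_measure_setT : cube_measure setT = 1.
Proof.
have -> : setT = cylinder [::].
  by apply/seteqP; split => // t _ i; rewrite /side nth_nil.
rewrite cube_measure_cylinder ?/cylinder_vol ?big_nil// => i.
by rewrite /side nth_nil; exact: measurableT.
Qed.

HB.instance Definition _ :=
  Measure_isProbability.Build _ T R cube_measure cube_measure_setT.
End product_lebesgue_measure.

Section gamma_space.
Context (R : realType) (X : normedModType R).

Definition partial_quotient (g : cube R -> X) (j : nat) (t : cube R) :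
    set_type (unit_itv R) -> X :=
  fun s => (\val s - \val (t j))^-1 *: (g (dfwith t j s) - g t).

(* The filter lives on [0, 1], so the limit is one-sided at t j = 0, 1. *)
Definition partial (j : nat) (g : cube R -> X) (t : cube R) : X :=
  lim (partial_quotient g j t @ (t j)^').

Record Gamma := MkGamma {
  gamma_fun :> cube R -> X ;
  gamma_continuous : continuous gamma_fun ;
  gamma_derivable : forall j t, cvg (partial_quotient gamma_fun j t @ (t j)^') ;
  gamma_partial_continuous : forall j, continuous (partial j gamma_fun) }.

Definition sup_norm (g : cube R -> X) : R := sup [set `|g t| | t in setT].

(* Coordinates are numbered from 0: seminorm k.+1 is the one of partial k. *)
Definition seminorm (k : nat) (g : cube R -> X) : R :=
  if k is j.+1 then sup_norm (partial j g) else sup_norm g.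

Definition gamma_ball (g : Gamma) (n : nat) (e : R) : set Gamma :=
  [set h : Gamma | forall k, (k < n)%N ->
     seminorm k ((h : cube R -> X) - (g : cube R -> X)) < e].

Definition gamma_open : set_system Gamma :=
  [set U | forall g, U g -> exists n, exists2 e : R, 0 < e & gamma_ball g n e `<=` U].

HB.instance Definition _ := gen_eqMixin Gamma.
HB.instance Definition _ := gen_choiceMixin Gamma.

Lemma gamma_openT : gamma_open setT.
Proof. by move=> g _; exists 0%N, 1. Qed.

Lemma gamma_openI : setI_closed gamma_open.
Proof.
move=> U V oU oV g [/oU[n [e e0 gU]] /oV[m [d d0 gV]]].
exists (maxn n m), (Num.min e d); first by rewrite lt_min e0.
move=> h gh; split; [apply: gU|apply: gV] => k kn.
  have /gh : (k < maxn n m)%N by rewrite leq_max kn.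
  by rewrite lt_min => /andP[].
have /gh : (k < maxn n m)%N by rewrite leq_max kn orbT.
by rewrite lt_min => /andP[].
Qed.

Lemma gamma_open_bigU (I : Type) (f : I -> set Gamma) :
  (forall i, gamma_open (f i)) -> gamma_open (\bigcup_i f i).
Proof.
move=> of_ g [i _ /of_[n [e e0 gf]]]; exists n, e => // h /gf fh.
by exists i.
Qed.

HB.instance Definition _ := isOpenTopological.Build Gamma
  gamma_openT gamma_openI gamma_open_bigU.

End gamma_space.

Section null_sets.

Definition meager (T : topologicalType) (A : set T) :=
  exists F : nat -> set T,
    (forall n, interior (closure (F n)) = set0) /\ A `<=` \bigcup_n F n.

Definition residual (T : topologicalType) (A : set T) := meager (~` A).

Context (R : realType) (X : normedModType R).

Definition borel (N : set X) := <<s [set U : set X | open U] >> N.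

Definition borel_Gamma_null (N : set X) := borel N /\
  exists2 S : set (Gamma X), residual S &
    forall g, S g -> cube_measure [set t | N (g t)] = 0%E.

Definition Gamma_null (E : set X) :=
  exists2 N : set X, borel_Gamma_null N & E `<=` N.

End null_sets.

Section differentiability.
Context (R : realType) (X Y : normedModType R).

Definition separable := exists2 D : set X, countable D & dense D.

Definition bounded_linear (T : X -> Y) :=
  linear T /\ exists M : R, forall x, `|T x| <= M * `|x|.

Definition op_norm (T : X -> Y) : R :=
  sup [set `|T x| | x in [set x | `|x| <= 1]].

Definition operator_subspace (L : set (X -> Y)) :=
  [/\ forall T, L T -> bounded_linear T,
      L 0 & forall (a : R) S T, L S -> L T -> L (a *: S + T)].

Definition norm_separable (L : set (X -> Y)) :=
  exists2 D : set (X -> Y), countable D &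
    D `<=` L /\
    forall T (e : R), L T -> 0 < e -> exists2 S, D S & op_norm (T - S) < e.

(* A map from an open set G to Y is represented by a total function: at points
   of G, all the notions below depend only on its values near the point. *)
Definition gateaux_derivative (f : X -> Y) (x : X) : X -> Y :=
  fun v => 'D_v f x.

Definition gateaux_differentiable (f : X -> Y) (x : X) :=
  (forall v, derivable f x v) /\ bounded_linear (gateaux_derivative f x).

Definition regular_point (f : X -> Y) (x : X) :=
  forall v, derivable f x v -> forall e : R, 0 < e ->
    \forall t \near (0 : R)^', forall u : X, `|u| <= 1 ->
      `|t^-1 *: (f (x + t *: u + t *: v) - f (x + t *: u)) - 'D_v f x| < e.

End differentiability.
Arguments separable {R} X.

(* Main.v *)
(* Subtracting from f an element of a countable dense subset of the operator
   space makes D_f(x) as small as we like, so it suffices to treat, for each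
   eps > 0, the Borel set N of the points x where f is regular, where all
   directional derivatives satisfy |f'(x,v)| <= eps |v|, but where
   |f(x+u) - f(x)| > 4 eps |u| for arbitrarily small u.  For gamma in a residual
   set S, the set gamma^-1(N) depends continuously, in measure, on gamma in S.
   Suppose that gamma in S and gamma^-1(N) has positive measure.  Freezing all
   but the first m coordinates one may take gamma to depend on t_0, ..., t_(m-1)
   only.  Near a point t with gamma(t) in N, regularity shows that
   |f(gamma(s)+u) - f(gamma(s))| >= 3 eps |u| for all s in a dyadic box around
   t whose size is a large multiple of |u|.  Adding to gamma, on disjoint boxes
   that nearly fill gamma^-1(N), a bump times t_m u changes the first m partial
   derivatives very little, the coordinate t_m being unconstrained by the
   topology of Gamma(X) near gamma.  Along the coordinate t_m the increment of
   f is now too large for |f'| <= eps to hold except on a set of small measure: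
   a fixed proportion of each box has left the preimage of N, which contradicts
   the continuity. *)
Require Import Defs.
From HB Require Import structures.
From mathcomp Require Import all_boot all_order all_algebra.
From mathcomp Require Import all_classical all_reals all_analysis.
From mathcomp Require Import measurable_realfun ring lra.
Import Order.TTheory GRing.Theory Num.Theory.
Import numFieldNormedType.Exports.
Local Open Scope classical_set_scope.
Local Open Scope ring_scope.

Set Implicit Arguments.
Unset Strict Implicit.
Unset Printing Implicit Defensive.

(** * A mean value inequality *)

(** What regularity bounds is the second difference f(x+u+w) - f(x+u) - f(x+w) + f(x), which is
    symmetric in u and w. Read with w = gamma(s) - x, it carries the steepness in the direction u
    from x to gamma(s). This needs uniformity for w near the span of the partial derivatives of
    gamma, hence a compactness argument, and a box of size between K|u| and 2K|u|, so that an error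
    o(size) stays below eps |u|. A large K also makes the bump flat: its slopes are of order |u| /
    size. The increment is 4 eps |u| at x, 3 eps |u| at gamma(s) and 5/2 eps |u| between the ends of
    a perturbed line, whereas a line of speed at most 2|u| inside N would allow only 2 eps |u|. The
    missing eps |u| / 2 is paid at the rate 2C|u| by times outside N, whence the proportion eps /
    (4C). Since N has to be Borel, its conditions are inequalities between values of f, with the
    directions of regularity and flatness taken from a dense sequence. If the empty set is residual
    in Gamma(X), every Borel set is Gamma-null; otherwise every residual set is dense, which allows
    the perturbed surface to be moved into S. *)

Section line_bound.
Context {R : realType} {Y : normedModType R}.
Local Notation lambda := (@lebesgue_measure R).

Lemma measure_itv_step (U : set R) (a r s : R) : open U -> a <= r -> r <= s ->
  (fine (lambda (U `&` `[a, r])) <= fine (lambda (U `&` `[a, s])) :> R) /\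
  (`[r, s] `<=` U ->
   fine (lambda (U `&` `[a, s])) = fine (lambda (U `&` `[a, r])) + (s - r)).
Proof.
move=> oU ar rs.
have mU : measurable U by exact: open_measurable.
have mi (u v : R) : measurable (U `&` `[u, v]) by apply: measurableI.
have fin_ (u v : R) : lambda (U `&` `[u, v]) \is a fin_num.
  rewrite ge0_fin_numE//; apply: (@le_lt_trans _ _ (lambda `[u, v])).
    by apply: le_measure; rewrite ?inE//; exact: mi.
  by rewrite lebesgue_measure_itv/=; case: ifP; rewrite ?ltry.
split.
  rewrite fine_le//; apply: le_measure; rewrite ?inE; [exact: mi|exact: mi|].
  move=> x [Ux]; rewrite /= !in_itv/= => /andP[ax xr]; split => //.
  by rewrite ax (le_trans xr).
move=> rsU.
have -> : U `&` `[a, s] = (U `&` `[a, r]) `|` `]r, s].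
  apply/seteqP; split => x /=.
    move=> [Ux]; rewrite !in_itv/= => /andP[ax xs].
    by have [xr|rx] := leP x r; [left; rewrite ax|right; rewrite xs].
  rewrite !in_itv/= => -[[Ux /andP[ax xr]]|/andP[rx xs]].
    by rewrite ax (le_trans xr).
  split; last by rewrite xs (le_trans ar (ltW rx)).
  by apply: rsU; rewrite /= in_itv/= (ltW rx).
have -> : lambda ((U `&` `[a, r]) `|` `]r, s]) = (lambda (U `&` `[a, r]) + lambda `]r, s])%E.
  apply: measureU => //; first exact: mi.
  apply/seteqP; split => // x /= [[_]]; rewrite !in_itv/=.
  by move=> /andP[_ xr] /andP[rx _]; move: (le_lt_trans xr rx); rewrite ltxx.
have -> : lambda `]r, s] = (s - r)%:E.
  rewrite lebesgue_measure_itv/= lte_fin; case: ltP => // sr.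
  by have -> : s = r by [apply/eqP; rewrite eq_le sr rs]; rewrite subrr.
by rewrite fineD.
Qed.

(* The supremum of the points up to which the increment of F is controlled by
   the measure of an open set U around A is b: to its right, either U
   contains a neighbourhood or the better bound theta is available. *)
Lemma line_bound (F : R -> Y) (A : set R) (a b theta C : R) :
  a <= b -> 0 <= theta -> 0 <= C -> measurable A ->
  (forall r z, a <= r <= b -> 0 < z -> exists2 d, 0 < d &
    forall s, a <= s <= b -> `|s - r| < d -> `|F s - F r| <= (C + z) * `|s - r|) ->
  (forall r z, a <= r <= b -> ~ A r -> 0 < z -> exists2 d, 0 < d &
    forall s, a <= s <= b -> `|s - r| < d -> `|F s - F r| <= (theta + z) * `|s - r|) ->
  `|F b - F a| <= theta * (b - a) + C * fine (lambda (A `&` `[a, b])).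
Proof.
move=> ab th0 C0 mA bC bth.
have mAab : measurable (A `&` `[a, b]) by apply: measurableI.
have lAab : (lambda (A `&` `[a, b]) < +oo)%E.
  apply: (@le_lt_trans _ _ (lambda `[a, b])).
    by apply: le_measure; rewrite ?inE.
  by rewrite lebesgue_measure_itv/=; case: ifP; rewrite ?ltry.
apply/ler_addgt0Pr => e e0.
(* The slack is spent twice: [z * (b - a)] on the local bounds and [C * z] on the excess of [U] over
   [A], in total less than [e]. *)
pose z := e / (C + (b - a) + 1).
have den0 : 0 < C + (b - a) + 1 by lra.
have z0 : 0 < z by rewrite divr_gt0.
have [U [oU AU lU]] := lebesgue_regularity_outer mAab lAab z0.
have mU : measurable U by exact: open_measurable.
pose g r := fine (lambda (U `&` `[a, r])).
have g0 r : 0 <= g r by rewrite fine_ge0.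
have gb : g b <= fine (lambda (A `&` `[a, b])) + z.
  have lUab : (lambda (U `&` `[a, b]) < +oo)%E.
    apply: (@le_lt_trans _ _ (lambda `[a, b])).
      by apply: le_measure; rewrite ?inE//; exact: measurableI.
    by rewrite lebesgue_measure_itv/=; case: ifP; rewrite ?ltry.
  rewrite -lee_fin EFinD /g !fineK ?ge0_fin_numE//.
  apply: (@le_trans _ _ (lambda U)).
    by apply: le_measure; rewrite ?inE//; exact: measurableI.
  have -> : U = (A `&` `[a, b]) `|` (U `\` (A `&` `[a, b])).
    by rewrite setDUK.
  apply: le_trans (measureU2 _ _ _) _ => //; first exact: measurableD. 
  by rewrite leeD2l// ltW.
pose H r := (theta + z) * (r - a) + C * g r.
pose S := [set r | a <= r <= b /\ `|F r - F a| <= H r].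
have stepH r s : a <= r -> r <= s -> H r + (theta + z) * (s - r) <= H s.
  move=> ar rs; have [gm _] := measure_itv_step oU ar rs.
  have : C * g r <= C * g s by rewrite ler_wpM2l.
  by rewrite /H /g; lra.
(* On an interval inside [U] the term [C * g] grows at the rate [C], which absorbs the weak
   bound. *)
have stepHU r s : a <= r -> r <= s -> `[r, s] `<=` U ->
    H r + (C + z) * (s - r) <= H s.
  move=> ar rs rsU; have [_ /(_ rsU) gm] := measure_itv_step oU ar rs.
  rewrite /H /g gm.
  have : 0 <= theta * (s - r) by rewrite mulr_ge0// subr_ge0.
  by lra.
(* Both sides of [r] are needed: the left one puts the supremum [c] into [S], the right one goes
   beyond it. *)
have local r : a <= r <= b -> exists2 d, 0 < d & forall s1 s2, a <= s1 -> s2 <= b ->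
    r - d < s1 -> s2 < r + d -> s1 <= r <= s2 ->
    `|F r - F s1| <= H r - H s1 /\ `|F s2 - F r| <= H s2 - H r.
  move=> rab; have /andP[ar rb] := rab; have [Ar|nAr] := pselect (A r).
    have : nbhs r U by apply: open_nbhs_nbhs; split => //; exact: AU.
    move=> /nbhs_ballP[d' /= d'0 bU].
    have [d d0 bd] := bC _ _ rab z0.
    exists (Num.min d d'); first by rewrite lt_min d0 d'0.
    have md : Num.min d d' <= d by rewrite ge_min lexx.
    have md' : Num.min d d' <= d' by rewrite ge_min lexx orbT.
    move: (Num.min d d') md md' => dm md md' s1 s2 as1 s2b ds1 ds2 /andP[s1r rs2].
    have B1 : `[s1, r] `<=` U.
      move=> x /=; rewrite in_itv/= => /andP[? ?]; apply: bU.
      by rewrite /ball/= ger0_norm; lra.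
    have B2 : `[r, s2] `<=` U.
      move=> x /=; rewrite in_itv/= => /andP[? ?]; apply: bU.
      by rewrite /ball/= ler0_norm; lra.
    have h1 := stepHU _ _ as1 s1r B1.
    have h2 := stepHU _ _ ar rs2 B2.
    have := bd s1; rewrite as1 (le_trans s1r rb) distrC ger0_norm ?subr_ge0// => /(_ isT ltac:(lra)).
    have := bd s2; rewrite s2b (le_trans ar rs2) ger0_norm ?subr_ge0// => /(_ isT ltac:(lra)).
    by rewrite [in X in _ -> X -> _]distrC; split; lra.
  have [d d0 bd] := bth _ _ rab nAr z0.
  exists d => // s1 s2 as1 s2b ds1 ds2 /andP[s1r rs2].
  have h1 := stepH _ _ as1 s1r.
  have h2 := stepH _ _ ar rs2.
  have := bd s1; rewrite as1 (le_trans s1r rb) distrC ger0_norm ?subr_ge0// => /(_ isT ltac:(lra)).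
  have := bd s2; rewrite s2b (le_trans ar rs2) ger0_norm ?subr_ge0// => /(_ isT ltac:(lra)).
  by rewrite [in X in _ -> X -> _]distrC; split; lra.
have Sa : S a.
  by split; [rewrite lexx|rewrite subrr normr0 /H subrr mulr0 add0r mulr_ge0].
have Sub : ubound S b by move=> r [/andP[]].
have supS : has_sup S by split; [exists a|exists b].
set c := sup S.
have ac : a <= c by exact: sup_upper_bound.
have cb : c <= b by apply: ge_sup => //; exists a.
have cab : a <= c <= b by rewrite ac.
have [d d0 locc] := local _ cab.
have tri (x y : R) : `|F x - F y| <= H x - H y -> `|F y - F a| <= H y -> `|F x - F a| <= H x.
  move=> h1 h2; have := ler_normD (F x - F y) (F y - F a); rewrite addrA subrK.
  by move=> /le_trans; apply; lra.
have Sc : `|F c - F a| <= H c.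
  have [r [/andP[ar rb] Hr] cdr] := @sup_adherent _ S d d0 supS.
  have rc : r <= c by apply: sup_upper_bound => //; split; rewrite ?ar.
  have [h _] := locc r c ar cb cdr ltac:(lra) ltac:(by rewrite rc lexx).
  exact: tri h Hr.
have cb' : c = b.
  apply/eqP; rewrite eq_le cb/= leNgt; apply/negP => clb.
  pose s := Num.min b (c + d / 2).
  have sb : s <= b by rewrite ge_min lexx.
  have cs : c < s by rewrite lt_min clb ltrDl divr_gt0.
  have sd : s < c + d by rewrite gt_min ltrD2l ltr_pdivrMr// ltr_pMr// ltr1n orbT.
  have cd : c - d < c by rewrite ltrBlDr ltrDl.
  have [_ h] := locc c s ac sb cd sd ltac:(by rewrite lexx ltW).
  have : s <= c.
    apply: sup_upper_bound => //; split; last exact: tri h Sc.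
    by rewrite sb (le_trans ac (ltW cs)).
  by rewrite leNgt cs.
move: Sc; rewrite cb' => /le_trans; apply; rewrite /H.
have h1 : C * g b <= C * (fine (lambda (A `&` `[a, b])) + z) by rewrite ler_wpM2l.
have h2 : z * (C + (b - a) + 1) = e by rewrite /z divfK// gt_eqF.
by clear -h1 h2 z0; move: (g b) h1 => gb h1; lra.
Qed.

End line_bound.

(** * The cube *)

Section cube_topology.
Context {R : realType}.
Local Notation I := (set_type (unit_itv R)).
Local Notation T := (cube R).

Lemma nbhs_unitP (x : I) (U : set I) : nbhs x U <->
  exists2 e : R, 0 < e & forall y : I, `|\val y - \val x| < e -> U y.
Proof.
split=> [/nbhs_ballP[e /= e0 eU]|[e e0 eU]].
  by exists e => // y yx; apply: eU; rewrite -initial_ballE /= /ball/= distrC.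
apply/nbhs_ballP; exists e => //= y; rewrite -initial_ballE /= /ball/= distrC.
exact: eU.
Qed.

Lemma unit_itvP (x : I) : 0 <= \val x <= 1.
Proof. by have := set_valP x; rewrite /unit_itv /= in_itv. Qed.

Definition cube_close (m : nat) (e : R) (t s : T) :=
  forall i, (i < m)%N -> `|\val (s i) - \val (t i)| < e.

Lemma nbhs_cubeP (t : T) (U : set T) : nbhs t U <->
  exists m, exists2 e : R, 0 < e & cube_close m e t `<=` U.
Proof.
split; last first.
  move=> [m [e e0 mU]]; apply: filterS mU _; rewrite /cube_close.
  elim: m => [|m IH]; first by apply: filterE => s i; rewrite ltn0.
  have : nbhs t [set s : T | `|\val (s m) - \val (t m)| < e].
    have pc := @proj_continuous nat (fun=> I) m t. pose P := [set x : I | `|\val x - \val (t m)| < e]; have := pc P; apply.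
    by apply/nbhs_unitP; exists e.
  move/(filterI IH); apply: filterS => s [h1 h2] i; rewrite ltnS leq_eqVlt.
  by move=> /predU1P[->//|]; exact: h1.
(* Convergence of this filter to [t] in a supremum of topologies can be checked one coordinate at a
   time. *)
pose F : set_system T :=
  [set V | exists m, exists2 e : R, 0 < e & cube_close m e t `<=` V].
have FF : Filter F.
  split.
  - by exists 0%N, 1.
  - move=> P Q [m [e e0 mP]] [n [d d0 nQ]]; exists (maxn m n), (Num.min e d).
      by rewrite lt_min e0.
    move=> s st; split; [apply: mP|apply: nQ] => i im.
      have : (i < maxn m n)%N by rewrite leq_max im.
      by move/st; rewrite lt_min => /andP[].
    have : (i < maxn m n)%N by rewrite leq_max im orbT.
    by move/st; rewrite lt_min => /andP[].
  - by move=> P Q PQ [m [e e0 mP]]; exists m, e => //; exact: subset_trans PQ.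
have : F --> t.
  apply/cvg_sup => i; apply/cvg_image.
    apply/seteqP; split => // x _; by exists (dfwith t i x); rewrite //= ?dfwithin.
  move=> B /nbhs_unitP[e e0 eB].
  exists ((fun s : T => s i) @^-1` B).
    by exists i.+1, e => // s st; apply: eB; exact: st.
  by apply: image_preimage; apply/seteqP; split => // x _; exists (dfwith t i x);
    rewrite /= ?dfwithin.
by apply.
Qed.

Lemma clip_subproof (x : R) : Num.max 0 (Num.min 1 x) \in unit_itv R.
Proof.
rewrite inE /unit_itv /= in_itv /= le_max lexx /= ge_max ler01 /=.
by rewrite ge_min lexx.
Qed.

(** The retraction of the line onto [0, 1]. It turns real parameters into points of the subtype, so
    that coordinate lines of the cube become curves over [R]. *)
Definition clip (x : R) : I := exist (fun y : R => y \in unit_itv R) _ (clip_subproof x).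

Lemma clipK (x : R) : 0 <= x <= 1 -> \val (clip x) = x.
Proof. by move=> /andP[x0 x1] /=; rewrite min_r// max_r. Qed.

Lemma clip_val (x : I) : clip (\val x) = x.
Proof. by apply: val_inj; rewrite clipK// unit_itvP. Qed.

Lemma clip_lip (x y : R) : `|\val (clip x) - \val (clip y)| <= `|x - y|.
Proof.
have h1 := ler_norm (x - y); have := ler_norm (y - x); rewrite distrC => h2.
rewrite /= ler_norml.
case: (leP 1 x) => ?; case: (leP 1 y) => ?; rewrite ?(max_r ler01);
  try case: (leP 0 x) => ?; try case: (leP 0 y) => ?; apply/andP; split; lra.
Qed.

Lemma clip_continuous : continuous clip.
Proof.
move=> x U /nbhs_unitP[e e0 eU]; apply/nbhs_ballP; exists e => //= y xy.
apply: eU; apply: le_lt_trans (clip_lip _ _) _.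
by rewrite distrC.
Qed.

Lemma compact_unit : compact [set: I].
Proof.
have -> : [set: I] = clip @` `[0, 1].
  apply/seteqP; split => // x _; exists (\val x); last exact: clip_val.
  by rewrite /= in_itv/= unit_itvP.
apply: continuous_compact; last exact: segment_compact.
by apply: continuous_subspaceT; exact: clip_continuous.
Qed.

Lemma compact_cube : compact [set: T].
Proof.
have -> : [set: T] = [set f | forall i, [set: I] (f i)] by apply/seteqP; split.
by apply: (@tychonoff nat (fun=> I) (fun=> setT)) => i; exact: compact_unit.
Qed.

End cube_topology.

(** * Volume and Fubini on the cube *)

Section volume.
Context {R : realType}.
Local Notation I := (set_type (unit_itv R)).
Local Notation T := (cube R).
Implicit Type A : set T.

(** The real-valued form makes linear arithmetic available; on non-measurable sets it is still an
    outer measure. *)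
Definition vol A : R := fine (cube_measure A).

Lemma cube_measure_fin A : cube_measure A \is a fin_num.
Proof.
rewrite ge0_fin_numE ?cube_measure_ge0// (@le_lt_trans _ _ (cube_measure setT))//.
  exact: le_cube_measure.
by rewrite cube_measure_setT ltry.
Qed.

Lemma volE A : cube_measure A = (vol A)%:E.
Proof. by rewrite /vol fineK// cube_measure_fin. Qed.

Lemma vol_ge0 A : 0 <= vol A.
Proof. by rewrite fine_ge0 ?cube_measure_ge0. Qed.

Lemma le_vol A B : A `<=` B -> vol A <= vol B.
Proof. by move=> AB; rewrite -lee_fin -!volE; exact: le_cube_measure. Qed.

Lemma vol0 : vol set0 = 0.
Proof. by rewrite /vol cube_measure0. Qed.

Lemma volU_le A B : vol (A `|` B) <= vol A + vol B.
Proof.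
by rewrite -lee_fin EFinD -!volE; exact: (outer_measureU2 (@cube_measure R)).
Qed.

Lemma volU A B : measurable A -> measurable B -> A `&` B = set0 ->
  vol (A `|` B) = vol A + vol B.
Proof.
move=> mA mB AB; apply: EFin_inj; rewrite EFinD -!volE.
exact: (@measureU _ _ _ (@cube_measure R)).
Qed.

Lemma vol_split A B : measurable A -> measurable B ->
  vol A = vol (A `&` B) + vol (A `\` B).
Proof.
move=> mA mB; have {1}-> : A = (A `&` B) `|` (A `\` B).
  apply/seteqP; split=> [x Ax|x [[]|[]]//].
  by have [?|?] := pselect (B x); [left|right].
rewrite volU//; [exact: measurableI|exact: measurableD|].
by apply/seteqP; split => // x [[_ ?] []].
Qed.

(** Continuity from above: the remainders decrease to the empty set and the measure is finite. *)
Lemma vol_tail (F : nat -> set T) (e : R) : (forall k, measurable (F k)) -> 0 < e ->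
  exists K, vol (\bigcup_k F k `\` \bigcup_(k < K) F k) < e.
Proof.
move=> mF e0; pose D n := \bigcup_k F k `\` \bigcup_(k < n) F k.
have mD n : measurable (D n).
  by apply: measurableD; apply: bigcup_measurable.
have D0 : \bigcap_n D n = set0.
  apply/seteqP; split => // x Dx; have [[k _ Fk] _] := Dx 0%N Logic.I.
  by have [_] := Dx k.+1 Logic.I; apply; exists k => //=.
have := @nonincreasing_cvg_mu _ _ _ (@cube_measure R) D.
rewrite D0 measure0 => /(_ _ mD measurable0) h.
have {}h : (@cube_measure R \o D) x @[x --> \oo] --> (0%:E : \bar R).
  apply: h.
    by rewrite -ge0_fin_numE ?cube_measure_ge0//; exact: cube_measure_fin.
  move=> n m nm; apply/subsetPset; apply: setDS => x [k /= kn Fk].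
  by exists k => //=; exact: leq_trans nm.
have /fine_cvgP[_ /cvgrPdist_lt /(_ _ e0) [K _ /(_ K (leqnn K))]] := h.
by rewrite /= sub0r normrN ger0_norm ?vol_ge0// => ?; exists K.
Qed.

Lemma vol_cylinder (B : seq (set R)) n : (size B <= n)%N -> msides B ->
  vol (cylinder B) = \prod_(0 <= i < n) side_length (side B i).
Proof.
by move=> Bn mB; rewrite /vol cube_measure_cylinder// (cylinder_volE Bn).
Qed.

Lemma msides_mkseq (F : nat -> set R) m : (forall i, measurable (F i)) -> msides (mkseq F m).
Proof.
move=> mF i; rewrite /side; have [im|mi] := ltnP i m; first by rewrite nth_mkseq.
by rewrite nth_default ?size_mkseq.
Qed.

Definition slab (i : nat) (S : set R) : set T := [set t | S (\val (t i))].

Lemma msides0 : msides ([::] : seq (set R)).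
Proof. by move=> i; rewrite /side nth_nil. Qed.

Lemma slabE i S : slab i S = cylinder (refine i S [::]).
Proof.
rewrite cylinder_refine; apply/seteqP; split => t //=; last by case.
by split => // j; rewrite /side nth_nil.
Qed.

Lemma measurable_cylinder (B : seq (set R)) : msides B -> measurable (cylinder B).
Proof. by move=> mB; apply: sub_sigma_algebra; exists B. Qed.

Lemma vol_slab i S : measurable S -> vol (slab i S) = side_length S.
Proof.
move=> mS; rewrite slabE (@vol_cylinder _ i.+1) ?size_mkseq//; last first.
  by apply: msides_refine => //; exact: msides0.
rewrite big_nat_recr//= side_refine eqxx big_nat big1 ?mul1r => [|j /= ji].
  by rewrite /side nth_nil setTI.
by rewrite side_refine ltn_eqF// /side nth_nil side_lengthT.
Qed.

(** Splicing serves for Fubini, for freezing a tail of coordinates and for moving a single one. *)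
Definition mix (J : pred nat) (t u : T) : T := fun i => if J i then t i else u i.

Definition mix_sides (J : pred nat) (B : seq (set R)) : seq (set R) :=
  mkseq (fun i => if J i then side B i else setT) (size B).

Lemma side_mix J B i :
  side (mix_sides J B) i = if J i then side B i else setT.
Proof.
rewrite {1}/side; have [iB|Bi] := ltnP i (size B); first by rewrite nth_mkseq.
rewrite nth_default ?size_mkseq//; case: ifP => // _.
by rewrite /side nth_default.
Qed.

Lemma msides_mix J B : msides B -> msides (mix_sides J B).
Proof. by move=> mB i; rewrite side_mix; case: ifP. Qed.

Lemma preimage_mix J B : (fun p : T * T => mix J p.1 p.2) @^-1` cylinder B =
  cylinder (mix_sides J B) `*` cylinder (mix_sides (predC J) B).
Proof.
apply/seteqP; split=> [[t u] /= h|[t u] /= [h1 h2] i].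
  by split=> i; have := h i; rewrite side_mix /mix /=; case: (J i).
have := h1 i; have := h2 i; rewrite !side_mix /mix /=; by case: (J i).
Qed.

Lemma measurable_mix J : measurable_fun setT (fun p : T * T => mix J p.1 p.2).
Proof.
apply: (measurability (cylinders (R := R))) => //.
move=> _ [_ [B mB <-] <-]; rewrite setTI preimage_mix.
by apply: measurableX; apply: measurable_cylinder; exact: msides_mix.
Qed.

Lemma setI_closed_cylinders : setI_closed (cylinders (R := R)).
Proof.
move=> _ _ [B mB <-] [C mC <-].
exists (mkseq (fun i => side B i `&` side C i) (maxn (size B) (size C))).
  move=> i; rewrite /side; have [im|mi] := ltnP i (maxn (size B) (size C)).
    by rewrite nth_mkseq//; apply: measurableI; [exact: mB|exact: mC].
  by rewrite nth_default ?size_mkseq.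
have sd i : side (mkseq (fun i => side B i `&` side C i) (maxn (size B) (size C))) i
    = side B i `&` side C i.
  rewrite {1}/side; have [im|mi] := ltnP i (maxn (size B) (size C)).
    by rewrite nth_mkseq.
  move: (mi); rewrite geq_max => /andP[Bi Ci].
  by rewrite nth_default ?size_mkseq// /side !nth_default// setTI.
apply/seteqP; split=> [t h|t [h1 h2] i]; last by rewrite sd.
by split=> i; have := h i; rewrite sd => -[].
Qed.

(** Fubini: splicing maps the product of two copies of the measure to the measure itself. The two
    agree on cylinders, where each side is charged to exactly one of the copies. *)
Lemma cube_measure_mix J A : measurable A ->
  cube_measure A = (\int[@cube_measure R]_t (vol (mix J t @^-1` A))%:E)%E.
Proof.
move=> mA; pose f := (fun p : T * T => mix J p.1 p.2).
have mf : measurable_fun setT f by exact: measurable_mix.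
have -> : (\int[@cube_measure R]_t (vol (mix J t @^-1` A))%:E)%E =
    (@cube_measure R \x @cube_measure R)%E (f @^-1` A).
  apply: eq_integral => t _ /=; rewrite -volE; congr cube_measure.
  by apply/seteqP; split => u; rewrite /xsection /= inE.
pose pmu : {measure set T -> \bar R} :=
  measure_function_pushforward__canonical__measure_function_Measure
    (@cube_measure R \x @cube_measure R)%E mf.
rewrite -[RHS]/(pmu A).
apply: (@measure_unique _ R _ (cylinders (R := R)) (fun=> setT)) => //.
- exact: setI_closed_cylinders.
- move=> _; exists [::]; first exact: msides0.
  by apply/seteqP; split => // t _ i; rewrite /side nth_nil.
- by apply/seteqP; split => // t _; exists 0%N.
- move=> _ [B mB <-]; rewrite /pmu/= /pushforward preimage_mix.
  have mJ K := measurable_cylinder (@msides_mix K _ mB).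
  rewrite product_measure1E; [|exact: mJ..].
  transitivity ((vol (cylinder (mix_sides J B)) *
    vol (cylinder (mix_sides (predC J) B)))%:E); last by rewrite EFinM -!volE.
  rewrite volE; congr EFin.
  rewrite !(@vol_cylinder _ (size B)) ?size_mkseq//; [|exact: msides_mix..].
  rewrite -big_split/=; apply: eq_bigr => i _; rewrite !side_mix /=.
  by case: (J i); rewrite /= side_lengthT ?mulr1 ?mul1r.
- by move=> k; rewrite -ge0_fin_numE ?cube_measure_ge0// cube_measure_fin.
Qed.

(** When [J] omits one coordinate, this turns a bound on each line through [P] into a bound on
    volumes. *)
Lemma vol_section_ge J A P (c : R) : 0 <= c -> measurable A -> measurable P ->
  (forall t, P t -> c <= vol (mix J t @^-1` A)) -> c * vol P <= vol A.
Proof.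
move=> c0 mA mP cA; rewrite -lee_fin EFinM -!volE (cube_measure_mix J mA).
rewrite -integral_cst//.
have mv : measurable_fun setT (fun t => (vol (mix J t @^-1` A))%:E).
  have := measurable_mix J measurableT mA; rewrite setTI.
  move=> /(measurable_fun_xsection (@cube_measure R)).
  congr measurable_fun; apply/funext => t /=; rewrite -volE; congr cube_measure.
  by apply/seteqP; split => u; rewrite /xsection /= inE.
apply: (@le_trans _ _ (\int[@cube_measure R]_(t in P) (vol (mix J t @^-1` A))%:E)%E).
  apply: ge0_le_integral => //; exact: measurable_funS mv.
apply: ge0_subset_integral => //.
by move=> t _; rewrite lee_fin vol_ge0.
Qed.

Lemma vol_section_gt J A (c : R) : measurable A -> c < vol A ->
  exists t, c < vol (mix J t @^-1` A).
Proof.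
move=> mA; apply: contraPP => /forallNP h; apply/negP; rewrite -leNgt.
rewrite -lee_fin -volE (cube_measure_mix J mA).
apply: (@le_trans _ _ (\int[@cube_measure R]_t c%:E)%E); last first.
  by rewrite integral_cst// [X in (_ * X)%E](@cube_measure_setT R) mule1.
apply: ge0_le_integral => //.
- by move=> t _; rewrite lee_fin vol_ge0.
- have := measurable_mix J measurableT mA; rewrite setTI.
  move=> /(measurable_fun_xsection (@cube_measure R)).
  congr measurable_fun; apply/funext => t /=; rewrite -volE; congr cube_measure.
  by apply/seteqP; split => u; rewrite /xsection /= inE.
- by move=> t _; rewrite lee_fin leNgt; apply/negP.
Qed.

End volume.

(** * Dyadic boxes *)

Lemma bigcup_ltnS (U : Type) (F : nat -> set U) K :
  \bigcup_(k < K.+1) F k = (\bigcup_(k < K) F k) `|` F K.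
Proof.
apply/seteqP; split=> [t [k /=]|t [[k /= kK Bk]|BK]].
- by rewrite ltnS leq_eqVlt => /predU1P[->|? ?]; [right|left; exists k].
- by exists k => //=; exact: ltnW.
- by exists K => /=.
Qed.

Section dyadic_boxes.
Context {R : realType}.
Local Notation I := (set_type (unit_itv R)).
Local Notation T := (cube R).

Definition mcyl (m : nat) (A : set T) :=
  forall s t : T, (forall i, (i < m)%N -> s i = t i) -> A s -> A t.

Definition cell (j c : nat) : set R := `[c%:R / (2 ^ j)%:R, c.+1%:R / (2 ^ j)%:R[.

(* The box of index (j, c) has sides [c_i / 2^j, (c_i + 1) / 2^j[; those with
   c_i = 2^j meet the cube in a null set. *)
Definition dbox (m : nat) (b : nat * seq nat) : set T :=
  [set t | forall i, (i < m)%N -> cell b.1 (nth 0%N b.2 i) (\val (t i))].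

Definition dbox_at (m j : nat) (t : T) : nat * seq nat :=
  (j, mkseq (fun i => Num.trunc ((2 ^ j)%:R * \val (t i))) m).

Lemma pow2_gt0 j : 0 < (2 ^ j)%:R :> R.
Proof. by rewrite ltr0n expn_gt0. Qed.

Lemma cellP j c (x : R) :
  cell j c x <-> c%:R <= (2 ^ j)%:R * x < c.+1%:R.
Proof.
have p0 := pow2_gt0 j; rewrite mulrC -ler_pdivrMr// -ltr_pdivlMr//.
Qed.

Lemma dbox_atP m j t : dbox m (dbox_at m j t) t.
Proof.
move=> i im; apply/cellP; rewrite nth_mkseq//; apply: truncn_itv.
by apply: mulr_ge0; [exact: ltW (pow2_gt0 j)|have /andP[] := unit_itvP (t i)].
Qed.

Lemma dbox_close m b s t : dbox m b s -> dbox m b t ->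
  forall i, (i < m)%N -> `|\val (s i) - \val (t i)| < (2 ^ b.1)%:R^-1.
Proof.
move=> bs bt i im.
have /cellP/andP[h1 h2] := bs i im; have /cellP/andP[h3 h4] := bt i im.
have p0 := pow2_gt0 b.1; rewrite -(ltr_pM2l p0) mulfV ?gt_eqF//.
rewrite -[X in X * _](ger0_norm (ltW p0)) -normrM mulrBr ltr_norml.
by move: h2 h4; rewrite -natr1 => h2 h4; apply/andP; split; lra.
Qed.

(** In units of the finer grid all endpoints are integers, so the strict inequalities at the common
    point [x] sharpen to inclusion of the finer cell. *)
Lemma cell_nested j d c c' (x y : R) : cell j c x -> cell (j + d) c' x ->
  cell (j + d) c' y -> cell j c y.
Proof.
move=> /cellP/andP[h1 h2] /cellP/andP[h3 h4] /cellP/andP[h5 h6].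
have e : (2 ^ (j + d))%:R = (2 ^ d)%:R * (2 ^ j)%:R :> R.
  by rewrite expnD natrM mulrC.
rewrite e -mulrA in h3 h4; rewrite e -mulrA in h5 h6.
have d0 := pow2_gt0 d.
have a1 : (c * 2 ^ d < c'.+1)%N.
  rewrite -(ltr_nat R) natrM mulrC; apply: le_lt_trans h4.
  by rewrite ler_pM2l.
have a2 : (c' < c.+1 * 2 ^ d)%N.
  rewrite -(ltr_nat R) natrM mulrC; apply: le_lt_trans h3 _.
  by rewrite ltr_pM2l.
apply/cellP/andP; split.
  rewrite -(ler_pM2l d0) [leLHS]mulrC -natrM; apply: le_trans h5.
  by rewrite ler_nat -ltnS.
rewrite -(ltr_pM2l d0) [ltRHS]mulrC -natrM; apply: lt_le_trans h6 _.
by rewrite ler_nat.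
Qed.

Lemma dbox_nested m b b' t : (b.1 <= b'.1)%N -> dbox m b t -> dbox m b' t ->
  dbox m b' `<=` dbox m b.
Proof.
move=> bb' bt b't s b's i im.
have := b't i im; have := b's i im; rewrite -(subnKC bb') => h1 h2.
exact: cell_nested (bt i im) h2 h1.
Qed.

Lemma dboxE m b : dbox m b = cylinder (mkseq (fun i => cell b.1 (nth 0%N b.2 i)) m).
Proof.
apply/seteqP; split=> [t h i|t h i im].
  rewrite /side; have [im|mi] := ltnP i m; first by rewrite nth_mkseq//; exact: h.
  by rewrite nth_default// size_mkseq.
by have := h i; rewrite /side nth_mkseq.
Qed.

Lemma measurable_cell j c : measurable (cell j c).
Proof. exact: measurable_itv. Qed.

Lemma measurable_dbox m b : measurable (dbox m b).
Proof.
rewrite dboxE; apply: measurable_cylinder; apply: msides_mkseq => i.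
exact: measurable_cell.
Qed.

Lemma pow2_small (e : R) : 0 < e -> exists J, forall j, (J <= j)%N -> (2 ^ j)%:R^-1 < e.
Proof.
move=> e0; exists (Num.trunc e^-1) => j Jj.
rewrite -(invrK e) ltf_pV2 ?posrE ?pow2_gt0 ?invr_gt0//.
apply: lt_le_trans (truncnS_gt e^-1) _; rewrite ler_nat.
by rewrite (leq_trans _ (ltn_expl j (leqnn 2))) // ltnS.
Qed.

Lemma open_dbox (U : set T) m t : open U -> mcyl m U -> U t ->
  exists J, forall j, (J <= j)%N -> dbox m (dbox_at m j t) `<=` U.
Proof.
move=> oU cU Ut; have /nbhs_cubeP[n [e e0 nU]] : nbhs t U by exact: open_nbhs_nbhs.
have [J Je] := pow2_small e0; exists J => j /Je je s bs.
(* The box says nothing about coordinates from [m] on; there [s] is replaced by [t], which [U] does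
   not notice. *)
apply: (cU (mix (fun i => i < m)%N s t)) => [i im|]; first by rewrite /mix im.
apply: nU => i _; rewrite /mix; case: ifPn => [im|_]; last by rewrite subrr normr0.
exact: lt_trans (dbox_close bs (@dbox_atP m j t) im) je.
Qed.

(** The sigma-algebra is generated by cylinders, but an open set is the union of the dyadic boxes
    that it contains, and there are countably many boxes. *)
Lemma open_measurable_cube (U : set T) : open U -> measurable U.
Proof.
move=> oU.
have -> : U = \bigcup_(p : nat * (nat * seq nat))
    (if `[< dbox p.1 p.2 `<=` U >] then dbox p.1 p.2 else set0).
  apply/seteqP; split=> [t Ut|t [p _]]; last first.
    by case: ifPn => // /asboolP; exact.
  have /nbhs_cubeP[m [e e0 mU]] : nbhs t U by exact: open_nbhs_nbhs.
  have [J Je] := pow2_small e0.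
  exists (m, dbox_at m J t) => //=; rewrite ifT; first exact: dbox_atP.
  apply/asboolP => s bs; apply: mU => i im.
  exact: lt_trans (dbox_close bs (@dbox_atP m J t) im) (Je _ (leqnn _)).
apply: countable_bigcupT_measurable => // p.
by case: ifP => // _; exact: measurable_dbox.
Qed.

Lemma measurable_preimage_borel (X : normedModType R) (g : T -> X) (N : set X) :
  continuous g -> borel N -> measurable (g @^-1` N).
Proof.
move=> cg; move: N; apply: smallest_sub.
  split=> [|A mA|F mF].
  - by rewrite preimage_set0.
  - by rewrite setTD preimage_setC; exact: measurableC.
  - by rewrite preimage_bigcup; exact: bigcupT_measurable.
move=> U oU; apply: open_measurable_cube.
by move/continuousP : cg; exact.
Qed.

(** Outer regularity by open sets that depend on finitely many coordinates. It passes to finite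
    unions and intersections, and for slabs it is the outer regularity of Lebesgue measure. *)
Let reg (A : set T) := forall e, 0 < e -> exists m V,
  [/\ open V, mcyl m V, A `<=` V & vol (V `\` A) <= e].

Let mcylS m n (A : set T) : (m <= n)%N -> mcyl m A -> mcyl n A.
Proof. by move=> mn cA s t st; apply: cA => i im; apply: st; exact: leq_trans mn. Qed.

Let regI A B : reg A -> reg B -> reg (A `&` B).
Proof.
move=> rA rB e e0; have e2 : 0 < e / 2 by rewrite divr_gt0.
have [m [V [oV cV AV vV]]] := rA _ e2.
have [n [P [oP cP BP vP]]] := rB _ e2.
exists (maxn m n), (V `&` P); split.
- exact: openI.
- move=> s t st [Vs Ps]; split.
    by apply: (mcylS (leq_maxl m n) cV) Vs.
  by apply: (mcylS (leq_maxr m n) cP) Ps.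
- exact: setISS.
- apply: (@le_trans _ _ (vol ((V `\` A) `|` (P `\` B)))).
    apply: le_vol => t [[Vt Pt] /not_andP[nA|nB]]; first by left.
    by right.
  by apply: le_trans (volU_le _ _) _; lra.
Qed.

Let regU A B : reg A -> reg B -> reg (A `|` B).
Proof.
move=> rA rB e e0; have e2 : 0 < e / 2 by rewrite divr_gt0.
have [m [V [oV cV AV vV]]] := rA _ e2.
have [n [P [oP cP BP vP]]] := rB _ e2.
exists (maxn m n), (V `|` P); split.
- exact: openU.
- move=> s t st [Vs|Ps]; [left|right].
    by apply: (mcylS (leq_maxl m n) cV) Vs.
  by apply: (mcylS (leq_maxr m n) cP) Ps.
- exact: setUSS.
- apply: (@le_trans _ _ (vol ((V `\` A) `|` (P `\` B)))).
    by apply: le_vol => t [[Vt|Pt] /not_orP[nA nB]]; [left|right].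
  by apply: le_trans (volU_le _ _) _; lra.
Qed.

Lemma open_slab i (S : set R) : open S -> open (slab i S).
Proof.
move=> oS; rewrite openE => t St; apply/nbhs_cubeP.
have /nbhs_ballP[e /= e0 eS] : nbhs (\val (t i)) S by exact: open_nbhs_nbhs.
exists i.+1, e => // s st; apply: eS; rewrite /ball /= distrC.
exact: st.
Qed.

Let reg_slab i (S : set R) : measurable S -> reg (slab i S).
Proof.
move=> mS e e0; have mSI : measurable (S `&` unit_itv R).
  by apply: measurableI => //; exact: measurable_unit_itv.
have lS : (lebesgue_measure (S `&` unit_itv R) < +oo)%E.
  by rewrite -side_length_EFin// ltry.
have [U [oU SU lU]] := lebesgue_regularity_outer mSI lS e0.
have mU : measurable U by exact: open_measurable.
have inI (t : T) : unit_itv R (\val (t i)) by rewrite /unit_itv/= in_itv/= unit_itvP.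
exists i.+1, (slab i U); split.
- exact: open_slab.
- by move=> s t st; rewrite /slab /= st.
- by move=> t St; apply: SU; split => //; exact: inI.
- apply: (@le_trans _ _ (vol (slab i (U `\` (S `&` unit_itv R))))).
    by apply: le_vol => t [Ut nS]; split => // -[].
  rewrite vol_slab; last exact: measurableD.
  rewrite -lee_fin side_length_EFin; last exact: measurableD.
  apply: le_trans (ltW lU); apply: le_measure; rewrite ?inE.
  - apply: measurableI; [exact: measurableD|exact: measurable_unit_itv].
  - exact: measurableD.
  - exact: subIsetl.
Qed.

Let reg0 : reg set0.
Proof.
move=> e e0; exists 0%N, set0; split => //; first exact: open0.
by rewrite set0D vol0 ltW.
Qed.

Let reg_cylinder (B : seq (set R)) : msides B -> reg (cylinder B).
Proof.
move=> mB.
have -> : cylinder B = [set t | forall i, (i < size B)%N -> slab i (side B i) t].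
  apply/seteqP; split=> [t h i _|t h i]; first exact: h.
  have [iB|Bi] := ltnP i (size B); first exact: h.
  by rewrite /side nth_default.
elim: (size B) => [|n IH].
  move=> e e0; exists 0%N, setT; split => //; first exact: openT.
  rewrite (_ : _ `\` _ = set0) ?vol0 ?ltW//.
  by apply/seteqP; split => // t [_ []] i; rewrite ltn0.
have -> : [set t | forall i, (i < n.+1)%N -> slab i (side B i) t] =
    [set t | forall i, (i < n)%N -> slab i (side B i) t] `&` slab n (side B n).
  apply/seteqP; split=> [t h|t [h1 h2] i].
    by split=> [i im|]; apply: h => //; exact: ltnW.
  by rewrite ltnS leq_eqVlt => /predU1P[->//|]; exact: h1.
by apply: regI => //; exact: reg_slab.
Qed.

Let reg_bigU (B : nat -> seq (set R)) K : (forall k, msides (B k)) ->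
  reg (\bigcup_(k < K) cylinder (B k)).
Proof.
move=> mB; elim: K => [|K IH]; first by rewrite II0 bigcup_set0.
by rewrite bigcup_ltnS; apply: regU => //; exact: reg_cylinder.
Qed.

(** The cylinders of a nearly optimal cover overshoot [M] by at most [e / 2]. Finitely many of them
    miss little of [M], and these are enlarged to an open [Q]. *)
Lemma cube_approx (M : set T) (e : R) : measurable M -> 0 < e ->
  exists m Q, [/\ open Q, mcyl m Q, vol (Q `\` M) <= e & vol (M `\` Q) <= e].
Proof.
move=> mM e0; have e2 : 0 < e / 2 by rewrite divr_gt0.
have [_ [B [mB MB] <-]] := lb_ereal_inf_adherent e2 (cube_measure_fin M).
move=> /ltW vB.
have mC k : measurable (cylinder (B k)) by exact: measurable_cylinder.
have mU : measurable (\bigcup_k cylinder (B k)) by exact: bigcupT_measurable.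
have vU : vol (\bigcup_k cylinder (B k)) <= vol M + e / 2.
  rewrite -lee_fin EFinD -!volE; apply: le_trans vB.
  apply: le_trans (outer_measure_sigma_subadditive (@cube_measure R) _) _.
  apply: lee_nneseries => n *; [exact: cube_measure_ge0|by rewrite -cube_measure_cylinder].
have [K vK] := vol_tail mC e2.
have [m [Q [oQ cQ BQ vQ]]] := reg_bigU K mB e2.
exists m, Q; split => //.
  apply: (@le_trans _ _ (vol ((Q `\` \bigcup_(k < K) cylinder (B k)) `|`
      (\bigcup_k cylinder (B k) `\` M)))).
    apply: le_vol => t [Qt nM].
    have [[k kK Bk]|?] := pselect ((\bigcup_(k < K) cylinder (B k)) t).
      by right; split => //; exists k.
    by left.
  apply: le_trans (volU_le _ _) _.
  have := vol_split mU mM; rewrite setIC (setIidl MB).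
  by move=> h; lra.
apply: (@le_trans _ _ (vol (\bigcup_k cylinder (B k) `\`
    \bigcup_(k < K) cylinder (B k)))); last by lra.
by apply: le_vol => t [Mt nQ]; split; [exact: MB|move=> /BQ].
Qed.

(** Two boxes over the same coordinates are nested or disjoint, so maximal ones suffice. A new box
    is dropped if a kept one contains it; otherwise it replaces the kept boxes that it meets. *)
Lemma dbox_disjoint_sub m (l : seq (nat * seq nat)) :
  exists l', [/\ {subset l' <= l},
    (forall t, (exists2 b, b \in l & dbox m b t) -> exists2 b, b \in l' & dbox m b t) &
    pairwise (fun b b' => `[< dbox m b `&` dbox m b' = set0 >]) l'].
Proof.
elim: l => [|b l [l' [sl cl dl]]]; first by exists [::]; split.
have [[b' b'l bb']|nb] := pselect (exists2 b', b' \in l' & dbox m b `<=` dbox m b').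
  exists l'; split => //; first by move=> x /sl xl; rewrite inE xl orbT.
  move=> t [x]; rewrite inE => /predU1P[->/bb' ?|xl xt]; first by exists b'.
  by apply: cl; exists x.
pose r := [seq x <- l' | `[< dbox m b `&` dbox m x = set0 >]].
exists (b :: r); split.
- move=> x; rewrite !inE => /predU1P[->|]; first by rewrite eqxx.
  by rewrite mem_filter => /andP[_ /sl ->]; rewrite orbT.
- move=> t; have [bt|nbt] := pselect (dbox m b t).
    by move=> _; exists b; rewrite ?inE ?eqxx.
  move=> [x]; rewrite inE => /predU1P[->//|xl xt].
  have [|y yl yt] := cl t; first by exists x.
  exists y => //; rewrite inE mem_filter yl andbT; apply/orP; right.
  apply/asboolP/seteqP; split => // s [bs ys].
  case: (leqP b.1 y.1) => [le|/ltnW le].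
    by apply: nbt; exact: (dbox_nested le bs ys).
  by apply: nb; exists y => //; exact: (dbox_nested le ys bs).
- rewrite /= pairwise_filter// andbT.
  by apply/allP => x; rewrite mem_filter => /andP[].
Qed.

Lemma vol_bigU (A : choiceType) (F : A -> set T) (l : seq A) :
  (forall a, measurable (F a)) ->
  pairwise (fun a b => `[< F a `&` F b = set0 >]) l ->
  vol [set t | exists2 a, a \in l & F a t] = \sum_(a <- l) vol (F a).
Proof.
move=> mF; elim: l => [_|a l IH /= /andP[/allP dl pl]].
  by rewrite big_nil (_ : [set _ | _] = set0) ?vol0//; apply/seteqP; split => // t [].
rewrite big_cons -IH// -volU//.
- congr vol; apply/seteqP; split=> [t [b]|t [at_|[b bl bt]]].
  + by rewrite inE => /predU1P[->|]; [left|right; exists b].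
  + by exists a; rewrite ?inE ?eqxx.
  + by exists b; rewrite ?inE ?bl ?orbT.
- clear -mF; elim: l => [|b l IH].
    by rewrite (_ : [set _ | _] = set0)//; apply/seteqP; split => // t [].
  rewrite (_ : [set _ | _] = F b `|` [set t | exists2 a, a \in l & F a t]).
    exact: measurableU.
  apply/seteqP; split=> [t [c]|t [at_|[c bl bt]]].
  + by rewrite inE => /predU1P[->|]; [left|right; exists c].
  + by exists b; rewrite ?inE ?eqxx.
  + by exists c; rewrite ?inE ?bl ?orbT.
- apply/seteqP; split => // t [at_ [b bl bt]].
  by have /asboolP <- := dl _ bl; split.
Qed.

End dyadic_boxes.

(** * Surfaces *)

Section gamma_basics.
Context {R : realType} {X : normedModType R}.
Local Notation I := (set_type (unit_itv R)).
Local Notation T := (cube R).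

(** Differentiability without quotients, in which the increment 0 needs no exception. One-sidedness
    at the ends is automatic, since [s] ranges over the subtype. *)
Definition has_partial (j : nat) (g : T -> X) (t : T) (l : X) :=
  forall e, 0 < e -> exists2 d, 0 < d & forall s : I,
    `|\val s - \val (t j)| < d ->
    `|g (dfwith t j s) - g t - (\val s - \val (t j)) *: l|
      <= e * `|\val s - \val (t j)|.

(** No point of [0, 1] is isolated, which makes the limits in [partial] unique: a step of length at
    most 1/2 towards the farther end stays inside. *)
Global Instance unit_dnbhs_filter (x : I) : ProperFilter x^'.
Proof.
split; last exact: dnbhs_filter.
move=> /nbhs_unitP[e e0 eU]; have /andP[x0 x1] := unit_itvP x.
pose h := Num.min (e / 2) (1 / 2).
have h0 : 0 < h by rewrite lt_min !divr_gt0.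
have he : h < e by rewrite gt_min; apply/orP; left; lra.
have h1 : h <= 1 / 2 by rewrite ge_min lexx orbT.
have [y yx yh] : exists2 y : I, \val y != \val x & `|\val y - \val x| < e.
  have [xh|xh] := leP (\val x) (1 / 2).
    exists (clip (\val x + h)); rewrite clipK; try by (apply/andP; split; lra).
      by rewrite gt_eqF// ltrDl.
    by rewrite addrAC subrr add0r gtr0_norm.
  exists (clip (\val x - h)); rewrite clipK; try by (apply/andP; split; lra).
    by rewrite lt_eqF// ltrBlDr ltrDl.
  by rewrite addrAC subrr add0r normrN gtr0_norm.
by apply: (eU y yh); apply: contraNneq yx => ->.
Qed.

Lemma has_partialP j g t l :
  has_partial j g t l <-> partial_quotient g j t @ (t j)^' --> l.
Proof.
split=> [gl|/cvgrPdist_le gl].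
  apply/cvgrPdist_le => e e0; have [d d0 dg] := gl _ e0.
  apply/nbhs_unitP; exists d => // s sd st.
  have ne0 : \val s - \val (t j) != 0.
    by rewrite subr_eq0; apply: contra_neq st => /val_inj.
  rewrite /partial_quotient.
  have -> : l = (\val s - \val (t j))^-1 *: ((\val s - \val (t j)) *: l).
    by rewrite scalerA mulVf// scale1r.
  rewrite -scalerBr normrZ normfV -(ler_pM2l (x := `|\val s - \val (t j)|)) ?normr_gt0//.
  by rewrite mulrA mulfV ?normr_eq0// mul1r [leRHS]mulrC distrC; exact: dg.
move=> e e0; have /nbhs_unitP[d d0 dg] := gl _ e0.
exists d => // s sd.
have [->|st] := eqVneq s (t j).
  rewrite subrr scale0r subr0 normr0 mulr0.
  have -> : dfwith t j (t j) = t.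
    apply: functional_extensionality_dep => i; have [->|ij] := eqVneq i j; first by rewrite dfwithin.
    by rewrite dfwithout// eq_sym.
  by rewrite subrr normr0.
have ne0 : \val s - \val (t j) != 0.
  by rewrite subr_eq0; apply: contra_neq st => /val_inj.
have := dg s sd st; rewrite /partial_quotient.
have {1}-> : l = (\val s - \val (t j))^-1 *: ((\val s - \val (t j)) *: l).
  by rewrite scalerA mulVf// scale1r.
rewrite -scalerBr normrZ normfV -(ler_pM2l (x := `|\val s - \val (t j)|)) ?normr_gt0//.
by rewrite mulrA mulfV ?normr_eq0// mul1r [leRHS]mulrC distrC.
Qed.

Lemma partial_eq j g t l : has_partial j g t l -> partial j g t = l.
Proof. by move=> /has_partialP gl; apply: (cvg_lim _ gl) => //; exact: norm_hausdorff. Qed.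

Lemma Gamma_has_partial (g : Gamma X) j t : has_partial j g t (partial j g t).
Proof. by apply/has_partialP; exact: (@gamma_derivable _ _ g). Qed.

(** Indexed like [seminorm]. A bound on the jets [k < n] leaves [partial j] free as soon as
    [n <= j.+1]. *)
Definition jet (k : nat) (g : T -> X) : T -> X :=
  if k is j.+1 then partial j g else g.

Lemma mkGamma (g : T -> X) (dg : nat -> T -> X) : continuous g ->
  (forall j, continuous (dg j)) -> (forall j t, has_partial j g t (dg j t)) ->
  exists h : Gamma X, forall k t, jet k h t = if k is j.+1 then dg j t else g t.
Proof.
move=> cg cdg pg.
have pE j : partial j g = dg j by apply/funext => t; exact/partial_eq/pg.
have dv j t : cvg (partial_quotient g j t @ (t j)^').
  by apply/cvg_ex; exists (dg j t); apply/has_partialP/pg.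
have cp j : continuous (partial j g) by rewrite pE.
by exists (MkGamma cg dv cp) => -[|j] t //=; rewrite pE.
Qed.

Lemma jet_continuous k (g : Gamma X) : continuous (jet k g).
Proof. by case: k => [|j]; [exact: gamma_continuous|exact: gamma_partial_continuous]. Qed.

Lemma cube_bounded (g : T -> X) : continuous g -> exists M, forall t, `|g t| <= M.
Proof.
move=> cg; have cN : continuous (fun t => `|g t|).
  by move=> t; apply: (@continuous_comp _ _ _ g); [exact: cg|exact: norm_continuous].
have := continuous_compact (continuous_subspaceT cN) compact_cube.
move=> /compact_bounded[M [_ /(_ (M + 1))]]; rewrite ltrDl ltr01 => /(_ isT) h.
exists (M + 1) => t; rewrite -[leLHS]normr_id; apply: h.
by exists t.
Qed.

Lemma sup_norm_le (g : T -> X) M : (forall t, `|g t| <= M) -> sup_norm g <= M.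
Proof.
move=> gM; apply: ge_sup; first by exists `|g (cube0 R)|, (cube0 R).
by move=> _ [t _ <-].
Qed.

Lemma le_sup_norm (g : T -> X) t : continuous g -> `|g t| <= sup_norm g.
Proof.
move=> /cube_bounded[M gM]; apply: ub_le_sup; last by exists t.
by exists M => _ [s _ <-].
Qed.

Lemma has_partial_lin c j (g h : T -> X) t l k : has_partial j g t l ->
  has_partial j h t k -> has_partial j (fun t => g t + c *: h t) t (l + c *: k).
Proof.
move=> gl hk e e0.
have c1 : 0 < 1 + `|c| by rewrite ltr_wpDr.
pose e' := e / 2 / (1 + `|c|).
have e1 : 0 < e' by rewrite !divr_gt0.
have ee : e = 2 * ((1 + `|c|) * e').
  by rewrite [_ * e']mulrC divfK ?lt0r_neq0// mulrC divfK ?pnatr_eq0.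
have [d d0 dg] := gl _ e1; have [d' d'0 dh] := hk _ e1.
exists (Num.min d d') => [|s]; first by rewrite lt_min d0.
rewrite lt_min => /andP[/dg hg /dh hh].
have -> : g (dfwith t j s) + c *: h (dfwith t j s) - (g t + c *: h t) -
    (\val s - \val (t j)) *: (l + c *: k) =
    (g (dfwith t j s) - g t - (\val s - \val (t j)) *: l) +
    c *: (h (dfwith t j s) - h t - (\val s - \val (t j)) *: k).
  rewrite !scalerBr scalerDr !scalerA [_ * c]mulrC !opprD.
  by rewrite -[LHS]/(_ + _ + _) [X in X + _]addrACA [LHS]addrACA.
apply: le_trans (ler_normD _ _) _; rewrite normrZ.
apply: le_trans (lerD hg (ler_wpM2l (normr_ge0 c) hh)) _.
have : 0 <= (1 + `|c|) * (e' * `|\val s - \val (t j)|).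
  by apply: mulr_ge0; [exact: ltW|apply: mulr_ge0; [exact: ltW|]].
rewrite ee; clear; move: `|c| `|_ - _| e' => q w z; lra.
Qed.

Lemma gamma_lin c (g h : Gamma X) : exists f : Gamma X, forall k t,
  jet k f t = jet k g t + c *: jet k h t.
Proof.
have [||j t|f fE] := @mkGamma (fun t => g t + c *: h t)
    (fun j t => partial j g t + c *: partial j h t).
- have cg := gamma_continuous (g := g); have ch := gamma_continuous (g := h).
  by move=> t; exact: cvgD (cg t) (cvgZl_tmp (ch t)).
- have cg := gamma_partial_continuous (g := g).
  have ch := gamma_partial_continuous (g := h).
  by move=> j t; exact: cvgD (cg j t) (cvgZl_tmp (ch j t)).
- by apply: has_partial_lin; exact: Gamma_has_partial.
by exists f => k t; rewrite fE; case: k.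
Qed.

Lemma jetB k (g h : Gamma X) t :
  jet k ((h : T -> X) - (g : T -> X)) t = jet k h t - jet k g t.
Proof.
case: k => [//|j]; apply: partial_eq.
have -> : (h : T -> X) - (g : T -> X) = (fun t => h t + (-1) *: g t).
  by apply/funext => s /=; rewrite scaleN1r.
rewrite -[X in _ - X]scale1r -scaleNr.
by apply: has_partial_lin; exact: Gamma_has_partial.
Qed.

Lemma seminormE k g : seminorm k g = sup_norm (jet k g).
Proof. by case: k. Qed.

Lemma seminorm_le k (g h : Gamma X) M :
  (forall t, `|jet k h t - jet k g t| <= M) ->
  seminorm k ((h : T -> X) - (g : T -> X)) <= M.
Proof.
by move=> hM; rewrite seminormE; apply: sup_norm_le => t; rewrite jetB.
Qed.

Lemma le_seminorm k (g h : Gamma X) t :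
  `|jet k h t - jet k g t| <= seminorm k ((h : T -> X) - (g : T -> X)).
Proof.
rewrite -jetB seminormE; apply: le_sup_norm => s.
have -> : jet k ((h : T -> X) - (g : T -> X)) = (fun t => jet k h t - jet k g t).
  by apply/funext => u; rewrite jetB.
exact: cvgB (@jet_continuous k h s) (@jet_continuous k g s).
Qed.

Definition jet_close n e (g h : Gamma X) :=
  forall k, (k < n)%N -> forall t, `|jet k h t - jet k g t| <= e.

(** The triangle inequality, with the smallest of the margins of finitely many seminorms. *)
Lemma gamma_ball_open (g : Gamma X) n e : open (gamma_ball g n e).
Proof.
move=> h hg.
have [d d0 dP] : exists2 d : R, 0 < d & forall k, (k < n)%N ->
    seminorm k ((h : T -> X) - (g : T -> X)) + d <= e.
  elim: n hg => [|n IH] hg; first by exists 1.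
  have [k kn|d d0 dP] := IH; first by apply: hg; exact: ltnW.
  exists (Num.min d (e - seminorm n ((h : T -> X) - (g : T -> X)))).
    by rewrite lt_min d0 subr_gt0; exact: hg.
  move=> k; rewrite ltnS leq_eqVlt => /predU1P[->|/dP hk].
    by rewrite -lerBrDl ge_min lexx orbT.
  by apply: le_trans hk; rewrite lerD2l ge_min lexx.
exists n, d => // f fh k kn.
have := dP _ kn; have := fh _ kn => h1 h2.
apply: le_lt_trans (_ : seminorm k ((h : T -> X) - (g : T -> X)) +
  seminorm k ((f : T -> X) - (h : T -> X)) < _); last by lra.
apply: seminorm_le => t.
have := le_seminorm k g h t; have := le_seminorm k h f t => h3 h4.
have -> : jet k f t - jet k g t = (jet k h t - jet k g t) + (jet k f t - jet k h t).
  by rewrite [RHS]addrC addrA subrK.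
by apply: le_trans (ler_normD _ _) _; exact: lerD.
Qed.

Lemma nbhs_gammaP (g : Gamma X) (U : set (Gamma X)) : nbhs g U <->
  exists n, exists2 e : R, 0 < e & jet_close n e g `<=` U.
Proof.
split.
  rewrite nbhsE => -[V [oV Vg] VU]; have [n [e e0 eV]] := oV g Vg.
  exists n, (e / 2); first by rewrite divr_gt0.
  move=> h hg; apply: VU; apply: eV => k kn.
  apply: (@le_lt_trans _ _ (e / 2)); last by lra.
  by apply: seminorm_le => t; exact: hg.
move=> [n [e e0 eU]]; rewrite nbhsE; exists (gamma_ball g n e).
  split; first exact: gamma_ball_open.
  move=> k _; apply: le_lt_trans e0.
  by apply: seminorm_le => t; rewrite subrr normr0.
move=> h hg; apply: eU => k kn t; apply: le_trans (le_seminorm _ _ _ _) _.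
by apply: ltW; exact: hg.
Qed.

End gamma_basics.

(** * Freezing coordinates, bumps *)

Section freezing.
Context {R : realType} {X : normedModType R}.
Local Notation I := (set_type (unit_itv R)).
Local Notation T := (cube R).

Lemma mix_continuous (J : pred nat) (u : T) : continuous (fun t => mix J t u).
Proof.
move=> t U /nbhs_cubeP[m [e e0 mU]]; apply/nbhs_cubeP; exists m, e => // s st.
apply: mU => i im; rewrite /mix; case: ifP => _; first exact: st.
by rewrite subrr normr0.
Qed.

Lemma mix_dfwith (J : pred nat) (t u : T) j (s : I) :
  mix J (dfwith t j s) u = if J j then dfwith (mix J t u) j s else mix J t u.
Proof.
apply: functional_extensionality_dep => i; rewrite /mix.
have [->|ij] := eqVneq i j.
  by rewrite dfwithin; case: ifP => Jj; rewrite ?dfwithin// Jj.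
have ji : j != i by rewrite eq_sym.
by case: (J j); rewrite !dfwithout.
Qed.

(** Since the partial derivatives along frozen coordinates vanish, adding [t m] times a vector later
    produces lines with exactly that velocity. *)
Lemma gamma_freeze (g : Gamma X) m (u : T) : exists h : Gamma X, forall k t,
  jet k h t = if k is j.+1
    then if (j < m)%N then partial j g (mix (fun i => i < m)%N t u) else 0
    else g (mix (fun i => i < m)%N t u).
Proof.
pose J := fun i => (i < m)%N.
have [||j t|h hE] := @mkGamma _ _ (fun t => g (mix J t u))
  (fun j t => if J j then partial j g (mix J t u) else 0).
- move=> t; apply: (@continuous_comp _ _ _ (fun t => mix J t u) g).
    exact: mix_continuous.
  exact: (gamma_continuous (g := g)).
- move=> j t; rewrite /J; case: (j < m)%N; last exact: cst_continuous.
  apply: (@continuous_comp _ _ _ (fun t => mix J t u) (partial j g)).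
    exact: mix_continuous.
  exact: (gamma_partial_continuous (g := g)).
- move=> e e0; case: ifP => Jj.
    have [d d0 dg] := @Gamma_has_partial _ _ g j (mix J t u) e e0.
    exists d => // s st; rewrite mix_dfwith Jj.
    by have := dg s; rewrite {1 4 6}/mix Jj; exact.
  exists 1 => // s _.
  by rewrite mix_dfwith Jj subrr scaler0 subr0 normr0 mulr_ge0// ltW.
by exists h.
Qed.

(** Continuity at a point involves finitely many coordinates; compactness makes their number
    uniform. *)
Lemma cube_tail (g : T -> X) (e : R) : continuous g -> 0 < e ->
  exists m0, forall m, (m0 <= m)%N -> forall t u,
    `|g (mix (fun i => i < m)%N t u) - g t| <= e.
Proof.
move=> cg e0; have /compact_near_coveringP cc := @compact_cube R.
have := @cc nat \oo
  (fun m t => forall u, `|g (mix (fun i => i < m)%N t u) - g t| <= e) _.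
case.
  move=> t _.
  have : nbhs t [set s | `|g s - g t| < e / 2].
    have /cvgrPdist_lt/(_ (e / 2)) := cg t; rewrite divr_gt0// => /(_ isT).
    by apply: filterS => s; rewrite distrC.
  move=> /nbhs_cubeP[n [d d0 dg]].
  exists ([set s | cube_close n d t s], [set m | (n <= m)%N]) => /=.
    split; first by apply/nbhs_cubeP; exists n, d.
    by exists n.
  move=> [s m] /= [st nm] u.
  have h1 := dg _ st.
  have h2 : `|g (mix (fun i => i < m)%N s u) - g t| < e / 2.
    by apply: dg => i im; rewrite /mix (leq_trans im nm); exact: st.
  rewrite -(subrKA (g t)); apply: le_trans (ler_normD _ _) _.
  by rewrite [X in _ + X]distrC; move: h1 h2; rewrite /=; lra.
move=> m0 _ h; exists m0 => m m0m t; exact: h.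
Qed.

Lemma gamma_tail (g : Gamma X) n (e : R) : 0 < e ->
  exists m0, forall m, (m0 <= m)%N -> forall k, (k < n)%N -> forall t u,
    `|jet k g (mix (fun i => i < m)%N t u) - jet k g t| <= e.
Proof.
move=> e0; elim: n => [|n [m0 IH]]; first by exists 0%N.
have [m1 h] := cube_tail (@jet_continuous _ _ n g) e0.
exists (maxn m0 m1) => m; rewrite geq_max => /andP[mm0 mm1] k.
rewrite ltnS leq_eqVlt => /predU1P[->|kn] t u; first exact: h.
exact: IH.
Qed.

End freezing.

(** * Continuously differentiable bumps of product form *)

Section bumps.
Context {R : realType} {X : normedModType R}.
Local Notation I := (set_type (unit_itv R)).
Local Notation T := (cube R).

(** A quadratic remainder is stable under sums and affine substitutions and can be checked by
    algebra alone. Adding the inequalities at (x, y) and at (y, x) shows that [dphi] is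
    Lipschitz. *)
Definition quadratic_diff (phi dphi : R -> R) := exists2 K : R, 0 <= K &
  forall x y, `|phi y - phi x - (y - x) * dphi x| <= K * (y - x) ^+ 2.

Lemma quadratic_diff_continuous phi dphi :
  quadratic_diff phi dphi -> continuous phi /\ continuous dphi.
Proof.
move=> [K K0 hK]; split => x; apply/cvgrPdist_le => e e0.
  pose c := K + `|dphi x| + 1.
  have c0 : 0 < c by rewrite /c; have := normr_ge0 (dphi x); lra.
  apply/nbhs_ballP; exists (Num.min 1 (e / c)); first by rewrite /= lt_min ltr01 divr_gt0.
  move=> y; rewrite /ball /= lt_min distrC => /andP[y1 ye].
  rewrite distrC; set h := y - x in y1 ye *.
  have := hK x y; rewrite -/h => hh.
  have : `|phi y - phi x| <= K * h ^+ 2 + `|h| * `|dphi x|.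
    have := ler_normD (phi y - phi x - h * dphi x) (h * dphi x).
    by rewrite subrK normrM => /le_trans; apply; rewrite lerD2r.
  have : K * h ^+ 2 <= K * `|h|.
    by rewrite ler_wpM2l// -real_normK ?num_real// expr2 ler_piMr// ltW.
  have : `|h| * c <= e by rewrite -ler_pdivlMr// ltW.
  by rewrite /c; have := normr_ge0 h; lra.
pose c := 2 * K + 1.
have c0 : 0 < c by rewrite /c; lra.
apply/nbhs_ballP; exists (e / c); first by rewrite /= divr_gt0.
move=> y; rewrite /ball /= distrC => ye.
have [->|yx] := eqVneq y x; first by rewrite subrr normr0 ltW.
rewrite distrC; set h := y - x in ye *.
have h0 : 0 < `|h| by rewrite normr_gt0 subr_eq0.
have h1 := hK x y; have h2 := hK y x.
rewrite -/h -[x - y]opprB -/h in h1 h2.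
rewrite -(ler_pM2l h0) -normrM.
have -> : h * (dphi y - dphi x) = (phi y - phi x - h * dphi x) +
    (phi x - phi y - - h * dphi y) by ring.
apply: le_trans (ler_normD _ _) _.
apply: le_trans (lerD h1 h2) _; rewrite sqrrN -[h ^+ 2]real_normK ?num_real//.
have : `|h| * c <= e by rewrite -ler_pdivlMr// ltW.
move: h0; rewrite /c; move: `|h| => z z0 ze.
have : z * (z * (2 * K + 1)) <= z * e by rewrite ler_pM2l.
have : 0 <= z * z by rewrite mulr_ge0// ltW.
by rewrite expr2; lra.
Qed.

Lemma tensor_continuous p (phi : nat -> R -> R) : (forall i, continuous (phi i)) ->
  continuous (fun t : T => \prod_(i < p) phi i (\val (t i))).
Proof.
move=> cphi; elim: p => [|p IH].
  rewrite (_ : (fun t : T => _) = cst 1) => [|]; first exact: cst_continuous.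
  by apply/funext => t; rewrite big_ord0.
rewrite (_ : (fun t : T => _) = (fun t : T =>
   (\prod_(i < p) phi i (\val (t i))) * phi p (\val (t p)))); last first.
  by apply/funext => t; rewrite big_ord_recr.
have cp : continuous (fun t : T => phi p (\val (t p))).
  move=> t; apply: (@continuous_comp _ _ _ (fun t : T => \val (t p)) (phi p)); last exact: cphi.
  move=> U /nbhs_ballP[e /= e0 eU]; apply/nbhs_cubeP; exists p.+1, e => // s st.
  by apply: eU; rewrite /ball/= distrC; exact: st.
by move=> t; exact: cvgM (IH t) (cp t).
Qed.

Lemma gamma_tensor p (phi dphi : nat -> R -> R) (u : X) :
  (forall i, quadratic_diff (phi i) (dphi i)) ->
  exists h : Gamma X, forall k t, jet k h t = if k is j.+1
    then if (j < p)%N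
      then (\prod_(i < p) (if i == j :> nat then dphi i else phi i) (\val (t i))) *: u
      else 0
    else (\prod_(i < p) phi i (\val (t i))) *: u.
Proof.
move=> qphi.
have cphi i := (quadratic_diff_continuous (qphi i)).1.
have cdphi i := (quadratic_diff_continuous (qphi i)).2.
apply: mkGamma.
- by move=> t; exact: cvgZr_tmp (@tensor_continuous p phi cphi t).
- move=> j t; case: (j < p)%N; last exact: cst_continuous.
  have cpj i : continuous (if i == j then dphi i else phi i) by case: ifP.
  exact: cvgZr_tmp (@tensor_continuous p _ cpj t).
move=> j t e e0; case: ltnP => [jp|pj]; last first.
  exists 1 => // s _; rewrite scaler0 subr0.
  rewrite (_ : \prod_(i < p) _ = \prod_(i < p) phi i (\val (t i))); last first.
    by apply: eq_bigr => i _; rewrite dfwithout// gtn_eqF// (leq_trans (ltn_ord i)).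
  by rewrite subrr normr0 mulr_ge0// ltW.
have [K K0 hK] := qphi j.
pose P := \prod_(i < p | i != Ordinal jp) phi i (\val (t i)).
pose c := K * `|P| * `|u| + 1.
have c0 : 0 < c by rewrite /c ltr_wpDl// !mulr_ge0.
exists (e / c) => [|s sc]; first by rewrite divr_gt0.
rewrite -!scalerBl scalerA -scalerBl normrZ.
rewrite !(bigD1 (Ordinal jp) (P := xpredT))//= dfwithin eqxx.
rewrite (_ : \prod_(i < p | _) phi i _ = P); last first.
  by apply: eq_bigr => i ij; rewrite dfwithout// eq_sym; apply: contra_neq ij => ij; exact: val_inj.
rewrite (_ : \prod_(i < p | i != Ordinal jp)
    (if i == j :> nat then dphi i else phi i) (\val (t i)) = P); last first.
  by apply: eq_bigr => i ij; rewrite ifN//; apply: contra_neq ij => ij; exact: val_inj.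
rewrite -/P mulrA -!mulrBl normrM.
set h := \val s - \val (t j) in sc *.
have := hK (\val (t j)) (\val s); rewrite -/h -[h ^+ 2]real_normK ?num_real//.
move=> hh; have h1 : `|h| * c <= e by rewrite -ler_pdivlMr// ltW.
rewrite -mulrA; apply: le_trans (ler_wpM2r _ hh) _; first by rewrite mulr_ge0.
have h0 := normr_ge0 h.
have -> : K * `|h| ^+ 2 * (`|P| * `|u|) = `|h| * (K * `|P| * `|u|) * `|h| by ring.
rewrite ler_wpM2r//; apply: le_trans h1; rewrite ler_wpM2l// /c.
by rewrite lerDl.
Qed.

Definition ramp (x : R) : R := (Num.max 0 x) ^+ 2.
(** A C^1 step that rises from 0 to 1 on [0, 1]: its second derivative is 4 on the first half and -4
    on the second, so that slopes are at most 2. *)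
Definition step (x : R) : R := 2 * ramp x - 4 * ramp (x - 2^-1) + 2 * ramp (x - 1).
Definition dstep (x : R) : R :=
  4 * Num.max 0 x - 8 * Num.max 0 (x - 2^-1) + 4 * Num.max 0 (x - 1).

Lemma quadratic_ramp : quadratic_diff ramp (fun x => 2 * Num.max 0 x).
Proof.
exists 1 => // x y; rewrite mul1r /ramp ler_norml.
have s1 := sqr_ge0 (y - x); have s2 := sqr_ge0 x; have s3 := sqr_ge0 y.
rewrite !expr2 in s1 s2 s3 *.
case: (leP 0 x) => hx; case: (leP 0 y) => hy.
- by apply/andP; split; lra.
- by have := mulr_ge0_le0 hx (ltW hy) => h; apply/andP; split; lra.
- by have := mulr_le0_ge0 (ltW hx) hy => h; apply/andP; split; lra.
- by apply/andP; split; lra.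
Qed.

Lemma quadratic_affine phi dphi c a b : quadratic_diff phi dphi ->
  quadratic_diff (fun x => c * phi (a * x + b)) (fun x => c * (a * dphi (a * x + b))).
Proof.
move=> [K K0 hK]; exists (`|c| * (K * a ^+ 2)).
  by apply: mulr_ge0 => //; apply: mulr_ge0 => //; exact: sqr_ge0.
move=> x y; have := hK (a * x + b) (a * y + b) => h.
have -> : c * phi (a * y + b) - c * phi (a * x + b) -
    (y - x) * (c * (a * dphi (a * x + b))) = c * (phi (a * y + b) - phi (a * x + b) -
    (a * y + b - (a * x + b)) * dphi (a * x + b)) by ring.
rewrite normrM -mulrA ler_wpM2l//; apply: le_trans h _.
by rewrite (_ : a * y + b - (a * x + b) = a * (y - x)) ?exprMn ?mulrA//; ring.
Qed.

Lemma quadraticD phi dphi psi dpsi : quadratic_diff phi dphi ->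
  quadratic_diff psi dpsi ->
  quadratic_diff (fun x => phi x + psi x) (fun x => dphi x + dpsi x).
Proof.
move=> [K K0 hK] [M M0 hM]; exists (K + M); first exact: addr_ge0.
move=> x y; have -> : phi y + psi y - (phi x + psi x) - (y - x) * (dphi x + dpsi x) =
  (phi y - phi x - (y - x) * dphi x) + (psi y - psi x - (y - x) * dpsi x) by ring.
by apply: le_trans (ler_normD _ _) _; rewrite [leRHS]mulrDl lerD.
Qed.

Lemma quadratic_step : quadratic_diff step dstep.
Proof.
have q c b := quadratic_affine c 1 b quadratic_ramp.
have := quadraticD (quadraticD (q 2 0) (q (-4) (- 2^-1))) (q 2 (-1)).
congr quadratic_diff; apply/funext => x; rewrite /step /dstep ?mul1r ?addr0; ring.
Qed.

Lemma step_cases x :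
  [/\ x <= 0 -> step x = 0 /\ dstep x = 0, 1 <= x -> step x = 1 /\ dstep x = 0,
      0 <= step x <= 1 & 0 <= dstep x <= 2].
Proof.
rewrite /step /dstep /ramp.
by case: (leP 0 x) => h1; case: (leP 0 (x - 2^-1)) => h2; case: (leP 0 (x - 1)) => h3;
  split; try (move=> ?; split); try (apply/andP; split); nra.
Qed.

(** Rises on [a, a + w] and falls on [b - w, b]. The arguments are written as [w^-1 * x] plus a
    constant to match [quadratic_affine]. *)
Definition bump (a b w x : R) : R := step (w^-1 * x - a / w) - step (w^-1 * x + (1 - b / w)).
Definition dbump (a b w x : R) : R :=
  w^-1 * (dstep (w^-1 * x - a / w) - dstep (w^-1 * x + (1 - b / w))).

Lemma quadratic_bump a b w : quadratic_diff (bump a b w) (dbump a b w).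
Proof.
have := quadraticD (quadratic_affine 1 w^-1 (- (a / w)) quadratic_step)
  (quadratic_affine (-1) w^-1 (1 - b / w) quadratic_step).
by congr quadratic_diff; apply/funext => x; rewrite /bump /dbump; ring.
Qed.

Lemma bump_cases a b w x : 0 < w -> a + 2 * w <= b ->
  [/\ x <= a \/ b <= x -> bump a b w x = 0 /\ dbump a b w x = 0,
      a + w <= x <= b - w -> bump a b w x = 1,
      `|bump a b w x| <= 1 & `|dbump a b w x| <= 2 / w].
Proof.
move=> w0 ab; rewrite /bump /dbump.
set y := w^-1 * x - a / w; set z := w^-1 * x + (1 - b / w).
have yE : w * y = x - a by rewrite /y; field; exact: lt0r_neq0.
have zE : w * z = x - b + w by rewrite /z; field; exact: lt0r_neq0.
have [y1 y2 /andP[y3 y4] /andP[y5 y6]] := step_cases y.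
have [z1 z2 /andP[z3 z4] /andP[z5 z6]] := step_cases z.
have le0 v : w * v <= 0 -> v <= 0 by rewrite pmulr_rle0.
have ge1 v : w <= w * v -> 1 <= v by rewrite ler_pMr.
split.
- move=> [xa|xb].
    by have [|-> ->] := y1; [apply: le0; lra|];
      have [|-> ->] := z1; [apply: le0; lra|]; rewrite !subrr mulr0.
  by have [|-> ->] := y2; [apply: ge1; lra|];
    have [|-> ->] := z2; [apply: ge1; lra|]; rewrite !subrr mulr0.
- move=> /andP[xa xb].
  have [|-> _] := y2; first by apply: ge1; lra.
  by have [|-> _] := z1; [apply: le0; lra|]; rewrite subr0.
- by rewrite ler_norml; apply/andP; split; lra.
  have wi0 : 0 <= w^-1 by rewrite invr_ge0 ltW.
  rewrite normrM (ger0_norm wi0) [leRHS]mulrC ler_wpM2l//.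
  by rewrite ler_norml; apply/andP; split; lra.
Qed.

End bumps.

Arguments jet : simpl never.

(** * Bumps on dyadic boxes *)

Section box_bumps.
Context {R : realType} {X : normedModType R}.
Local Notation I := (set_type (unit_itv R)).
Local Notation T := (cube R).

(** The plateau of a bump of width [kappa / 2 ^ j] that lives on the cell. *)
Definition core_cell (kappa : R) (j c : nat) : set R :=
  `[(c%:R + kappa) / (2 ^ j)%:R, (c.+1%:R - kappa) / (2 ^ j)%:R].

Definition core (m : nat) (kappa : R) (b : nat * seq nat) : set T :=
  [set t | forall i, (i < m)%N -> core_cell kappa b.1 (nth 0%N b.2 i) (\val (t i))].

Lemma coreE m kappa b : core m kappa b =
  cylinder (mkseq (fun i => core_cell kappa b.1 (nth 0%N b.2 i)) m).
Proof.
apply/seteqP; split=> [t h i|t h i im].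
  rewrite /side; have [im|mi] := ltnP i m; first by rewrite nth_mkseq//; exact: h.
  by rewrite nth_default// size_mkseq.
by have := h i; rewrite /side nth_mkseq.
Qed.

Lemma measurable_core m kappa b : measurable (core m kappa b).
Proof.
rewrite coreE; apply: measurable_cylinder; apply: msides_mkseq => i.
exact: measurable_itv.
Qed.

Lemma core_sub m kappa b : 0 < kappa -> core m kappa b `<=` dbox m b.
Proof.
move=> k0 t h i im; have := h i im; have p0 := pow2_gt0 (R := R) b.1.
rewrite /core_cell /= in_itv/= ler_pdivrMr// ler_pdivlMr// => /andP[h1 h2].
by apply/cellP/andP; rewrite mulrC; split; lra.
Qed.

Lemma side_length_core kappa j c : 0 < kappa -> 2 * kappa <= 1 ->
  (1 - 2 * kappa) * side_length (cell (R := R) j c) <= side_length (core_cell kappa j c).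
Proof.
move=> k0 k1; have p0 := pow2_gt0 (R := R) j.
have [cj|jc] := ltnP c (2 ^ j).
  have c1 : c.+1%:R <= (2 ^ j)%:R :> R by rewrite ler_nat.
  have -> : side_length (cell (R := R) j c) = (2 ^ j)%:R^-1.
    apply: EFin_inj; rewrite side_length_EFin; last exact: measurable_cell.
    rewrite setIidl.
      rewrite /cell lebesgue_measure_itv/= lte_fin ltr_pM2r ?invr_gt0// ltr_nat ltnSn.
      by rewrite -EFinB -mulrBl -natrB// subSnn mul1r.
    move=> x /cellP/andP[h1 h2]; rewrite /unit_itv/= in_itv/=; apply/andP; split.
      by rewrite -(pmulr_rge0 _ p0); apply: le_trans h1.
    by rewrite -(ler_pM2l p0) mulr1; apply: le_trans (ltW h2) _.
  have -> : side_length (core_cell kappa j c) = (1 - 2 * kappa) * (2 ^ j)%:R^-1.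
    apply: EFin_inj; rewrite side_length_EFin; last exact: measurable_itv.
    rewrite setIidl.
      rewrite /core_cell lebesgue_measure_itv/= lte_fin ltr_pM2r ?invr_gt0//.
      have -> : 1 - 2 * kappa = c.+1%:R - kappa - (c%:R + kappa).
        by rewrite -natr1; ring.
      case: ltP => h; first by rewrite -EFinB -mulrBl.
      have -> : c.+1%:R - kappa - (c%:R + kappa) = 0.
        by move: h; rewrite -natr1 => h; lra.
      by rewrite mul0r.
    move=> x; rewrite /core_cell /= in_itv/= ler_pdivrMr// ler_pdivlMr// => /andP[h1 h2].
    rewrite /unit_itv/= in_itv/=; apply/andP; split.
      rewrite -(pmulr_lge0 _ p0); apply: le_trans h1.
      by rewrite addr_ge0// ltW.
    by rewrite -(ler_pM2r p0) mul1r; apply: le_trans h2 _; lra.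
  by [].
(* Now [c >= 2 ^ j], and the cell meets [0, 1] at most in the point 1. *)
suff -> : side_length (cell (R := R) j c) = 0 by rewrite mulr0 side_length_ge0.
apply: EFin_inj; rewrite side_length_EFin; last exact: measurable_cell.
apply/eqP; rewrite eq_le measure_ge0 andbT.
apply: (@le_trans _ _ (lebesgue_measure ([set 1 : R]))); last first.
  by rewrite lebesgue_measure_set1.
apply: le_measure; rewrite ?inE//.
  apply: measurableI; [exact: measurable_cell|exact: measurable_unit_itv].
move=> x [/cellP/andP[h1 _]]; rewrite /unit_itv/= in_itv/= => /andP[_ x1].
apply/eqP; rewrite eq_le x1 -(ler_pM2l p0) mulr1; apply: le_trans h1.
by rewrite ler_nat.
Qed.

Lemma vol_core m kappa b : 0 < kappa -> 2 * kappa <= 1 ->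
  (1 - 2 * kappa) ^+ m * vol (dbox (R := R) m b) <= vol (core m kappa b).
Proof.
move=> k0 k1; rewrite dboxE coreE !(@vol_cylinder _ _ m) ?size_mkseq//;
  try by apply: msides_mkseq => i; first [exact: measurable_cell|exact: measurable_itv].
rewrite -[m in _ ^+ m]card_ord -prodr_const !big_mkord -big_split/=.
apply: ler_prod => i _; rewrite /side !nth_mkseq//; apply/andP; split.
  by rewrite mulr_ge0 ?side_length_ge0//; lra.
exact: side_length_core.
Qed.

Lemma prod_norm_le p (F : nat -> R) j (M : R) : (j < p)%N -> 0 <= M ->
  `|F j| <= M -> (forall i, (i < p)%N -> i != j -> `|F i| <= 1) ->
  `|\prod_(i < p) F i| <= M.
Proof.
move=> jp M0 Fj F1; rewrite (bigD1 (Ordinal jp))//= normrM -[leRHS]mulr1.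
apply: ler_pM => //; rewrite normr_prod; apply: prodr_ile1 => i ij.
by rewrite normr_ge0 F1.
Qed.

(** No smallness is asked of [partial m], which is [u] on the core. Along the earlier coordinates
    the slopes are of order [|u|] over the width of the bump, hence small if the box is large
    compared with [u]. *)
Lemma box_bump m kappa b (u : X) : 0 < kappa -> 2 * kappa <= 1 ->
  exists h : Gamma X,
  [/\ forall k t, ~ dbox m b t -> jet k h t = 0,
      forall t, `|h t| <= `|u|,
      forall j t, (j < m)%N -> `|jet j.+1 h t| <= 2 / (kappa / (2 ^ b.1)%:R) * `|u| &
      forall t, core m kappa b t -> h t = \val (t m) *: u /\ jet m.+1 h t = u].
Proof.
move=> k0 k1; have p0 := pow2_gt0 (R := R) b.1.
pose c i := nth 0%N b.2 i.
pose A i : R := (c i)%:R / (2 ^ b.1)%:R.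
pose B i : R := (c i).+1%:R / (2 ^ b.1)%:R.
pose w : R := kappa / (2 ^ b.1)%:R.
have w0 : 0 < w by rewrite divr_gt0.
have AB i : A i + 2 * w <= B i.
  by rewrite /A /B /w mulrA -mulrDl ler_pM2r ?invr_gt0// -(@natr1 R (c i)) lerD2l.
have BC i x := bump_cases x w0 (AB i).
(* The last of the [m.+1] factors, of index [m], is the identity: it contributes the coordinate t_m,
   with derivative 1. *)
pose phi i := if (i < m)%N then bump (A i) (B i) w else id.
pose dphi i := if (i < m)%N then dbump (A i) (B i) w else cst 1.
have qphi i : quadratic_diff (phi i) (dphi i).
  rewrite /phi /dphi; case: ifP => _; first exact: quadratic_bump.
  by exists 0 => // x y; rewrite /= mulr1 subrr normr0 mul0r.
have [h hE] := @gamma_tensor _ _ m.+1 phi dphi u qphi.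
have phi1 i (t : T) : `|phi i (\val (t i))| <= 1.
  rewrite /phi; case: ifP => im; first by case: (BC i (\val (t i))).
  by have /andP[? ?] := unit_itvP (t i); rewrite ger0_norm.
exists h; split.
- move=> k t /existsNP[i /not_implyP[im nc]].
  have out : \val (t i) <= A i \/ B i <= \val (t i).
    have [|xa] := leP (\val (t i)) (A i); first by left.
    have [|xb] := leP (B i) (\val (t i)); first by right.
    by exfalso; apply: nc; rewrite /cell /= in_itv/= (ltW xa).
  have [/(_ out) [z1 z2] _ _ _] := BC i (\val (t i)).
  have im1 : (i < m.+1)%N by exact: ltnW.
  rewrite hE; case: k => [|k].
    by rewrite (bigD1 (Ordinal im1))//= {1}/phi im z1 mul0r scale0r.
  case: ifP => // km; rewrite (bigD1 (Ordinal im1))//=.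
  by case: ifP => _; rewrite {1}/phi {1}/dphi im ?z1 ?z2 mul0r scale0r.
- move=> t; rewrite -[h t]/(jet 0 h t) hE normrZ ler_piMl//.
  by apply: (@prod_norm_le _ (fun i => phi i (\val (t i))) 0%N).
- move=> j t jm; rewrite hE (ltnW jm : (j < m.+1)%N) normrZ ler_wpM2r//.
  apply: (@prod_norm_le _ (fun i => (if i == j then dphi i else phi i) (\val (t i))) j).
  + exact: ltnW.
  + by rewrite divr_ge0// ltW.
  + by rewrite eqxx /dphi jm; case: (BC j (\val (t j))).
  + by move=> i im ij; rewrite (negbTE ij).
- move=> t ct.
  have one i : (i < m)%N -> phi i (\val (t i)) = 1.
    move=> im; rewrite /phi im; case: (BC i (\val (t i))) => _ + _ _; apply.
    have := ct i im; rewrite /core_cell /= in_itv/= => /andP[h1 h2].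
    by rewrite /A /B /w -mulrDl -mulrBl h1.
  split.
    rewrite -[h t]/(jet 0 h t) hE big_ord_recr/= big1 => [|i _]; last exact: one.
    by rewrite mul1r /phi ltnn.
  rewrite hE ltnSn big_ord_recr/= eqxx big1 => [|i _].
    by rewrite mul1r /dphi ltnn /= scale1r.
  by rewrite ltn_eqF//; exact: one.
Qed.

(** The supports are disjoint, so the bounds are maxima over the boxes and not sums. The induction
    also carries the vanishing outside all boxes. *)
Lemma gamma_bumps m kappa (l : seq (nat * seq nat)) (u : nat * seq nat -> X) :
  0 < kappa -> 2 * kappa <= 1 ->
  pairwise (fun b b' => `[< dbox (R := R) m b `&` dbox m b' = set0 >]) l ->
  exists h : Gamma X,
  [/\ forall M, 0 <= M -> {in l, forall b, `|u b| <= M} -> forall t, `|h t| <= M,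
      forall M, 0 <= M -> {in l, forall b, 2 / (kappa / (2 ^ b.1)%:R) * `|u b| <= M} ->
        forall j t, (j < m)%N -> `|jet j.+1 h t| <= M &
      forall b t, b \in l -> core m kappa b t ->
        h t = \val (t m) *: u b /\ jet m.+1 h t = u b].
Proof.
move=> k0 k1; suff H : pairwise (fun b b' => `[< dbox (R := R) m b `&` dbox m b' = set0 >]) l ->
  exists h : Gamma X,
  [/\ forall M, 0 <= M -> {in l, forall b, `|u b| <= M} -> forall t, `|h t| <= M,
      forall M, 0 <= M -> {in l, forall b, 2 / (kappa / (2 ^ b.1)%:R) * `|u b| <= M} ->
        forall j t, (j < m)%N -> `|jet j.+1 h t| <= M,
      forall b t, b \in l -> core m kappa b t ->
        h t = \val (t m) *: u b /\ jet m.+1 h t = u b &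
      forall t, (forall b, b \in l -> ~ dbox m b t) -> forall k, jet k h t = 0].
  by move=> /H[h [h1 h2 h3 _]]; exists h.
elim: l => [_|b l IH /= /andP[/allP dl pl]].
  have [||j t|h hE] := @mkGamma R X (cst 0) (fun=> cst 0).
  - exact: cst_continuous.
  - by move=> j; exact: cst_continuous.
  - move=> e e0; exists 1 => // s _; rewrite scaler0 !subr0 normr0.
    by rewrite mulr_ge0// ltW.
  exists h; split => //.
  - by move=> M M0 _ t; rewrite -[h t]/(jet 0 h t) hE /= normr0.
  - by move=> M M0 _ j t _; rewrite hE normr0.
  - by move=> t _ k; rewrite hE; case: k.
have [f [f1 f2 f3 f0]] := IH pl.
have [g [g0 g1 g2 g3]] := box_bump m b (u b) k0 k1.
have [h hE] := gamma_lin 1 g f.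
have fz t : dbox m b t -> forall k, jet k f t = 0.
  move=> bt; apply: f0 => b' b'l b't.
  by have /asboolP/seteqP[/(_ t) dj _] := dl _ b'l; exact: dj.
exists h; split.
- move=> M M0 uM t; rewrite -[h t]/(jet 0 h t) hE scale1r.
  have [bt|nbt] := pselect (dbox m b t).
    rewrite fz// addr0; apply: le_trans (g1 t) _; apply: uM; exact: mem_head.
  rewrite g0// add0r; apply: f1 => // x xl; apply: uM; by rewrite inE xl orbT.
- move=> M M0 uM j t jm; rewrite hE scale1r.
  have [bt|nbt] := pselect (dbox m b t).
    rewrite fz// addr0; apply: le_trans (g2 _ _ jm) _; apply: uM; exact: mem_head.
  rewrite g0// add0r; apply: f2 => // x xl; apply: uM; by rewrite inE xl orbT.
- move=> x t; rewrite inE => /predU1P[->|xl] ct.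
    have bt := core_sub k0 ct.
    rewrite -[h t]/(jet 0 h t) !hE !fz// scaler0 !addr0; exact: g3.
  have xt := core_sub k0 ct.
  have nbt : ~ dbox m b t.
    by move=> bt; have /asboolP/seteqP[/(_ t) dj _] := dl _ xl; exact: dj.
  rewrite -[h t]/(jet 0 h t) !hE !scale1r !g0// !add0r; exact: f3.
- move=> t nt k; rewrite hE g0 ?f0 ?scaler0 ?addr0// => [x xl|].
    by apply: nt; rewrite inE xl orbT.
  by apply: nt; exact: mem_head.
Qed.

End box_bumps.

(** * Category *)

Section category.
Context {S : topologicalType}.
Implicit Types A B : set S.

Lemma meager_sub A B : A `<=` B -> meager B -> meager A.
Proof. by move=> AB [F [F0 BF]]; exists F; split => //; exact: subset_trans BF. Qed.

Lemma meager_bigcup (A : nat -> set S) : (forall n, meager (A n)) -> meager (\bigcup_n A n).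
Proof.
move=> mA; have [F FP] := choice mA.
exists (fun p => if unpickle p is Some (n, k) then F n k else set0); split.
  move=> p; case: unpickle => [[n k]|]; first exact: (FP n).1.
  by rewrite closure0 interior0.
move=> x [n _ Ax]; have [k _ Fx] := (FP n).2 _ Ax.
by exists (pickle (n, k)) => //; rewrite pickleK.
Qed.

Lemma meagerU A B : meager A -> meager B -> meager (A `|` B).
Proof.
move=> mA mB; have := @meager_bigcup (fun n => if n is 0%N then A else B).
move=> h; apply: meager_sub (h _); last by case.
by move=> x [Ax|Bx]; [exists 0%N|exists 1%N].
Qed.

Lemma residualI A B : residual A -> residual B -> residual (A `&` B).
Proof. by rewrite /residual setCI; exact: meagerU. Qed.

Lemma residual_bigcap (A : nat -> set S) : (forall n, residual (A n)) ->
  residual (\bigcap_n A n).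
Proof. by move=> rA; rewrite /residual setC_bigcap; exact: meager_bigcup. Qed.

(** A closed set minus its interior is closed and has empty interior. *)
Lemma residual_boundary A : closed A -> residual (~` (A `\` A^°)).
Proof.
move=> cA; rewrite /residual setCK; exists (fun=> A `\` A^°); split; last by move=> x ?; exists 0%N.
move=> _; have cB : closed (A `\` A^°).
  by rewrite setDE; apply: closedI => //; rewrite closedC; exact: open_interior.
rewrite -(closure_id _).1//; apply/seteqP; split => // x xB.
have [_] := interior_subset xB; apply.
by move: xB; apply: filterS => y [].
Qed.

Lemma nbhs_app2 (x : S) (P Q U : set S) : nbhs x P -> nbhs x Q ->
  (forall y, P y -> Q y -> U y) -> nbhs x U.
Proof. by move=> xP xQ PQU; apply: filterS (filterI xP xQ) => y [/PQU]; exact. Qed.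

Lemma nbhs_all (x : S) (U : set S) : (forall y, U y) -> nbhs x U.
Proof. by move=> h; apply: filterS filterT => y _; exact: h. Qed.

End category.

(** * Continuity in measure of the preimages of Borel sets *)

Section stable_preimages.
Context {R : realType} {X : normedModType R}.
Local Notation T := (cube R).
Local Notation Gamma := (Gamma X).
Implicit Types (A : set X) (g h : Gamma).

Definition pre g A : set T := [set t | A (g t)].

(** Continuity along [S] only: [g] is compared with those nearby [h] that lie in [S]. *)
Definition stable_on (S : set Gamma) A := forall g, S g -> forall e : R, 0 < e ->
  \forall h \near g, S h -> vol (pre g A `\` pre h A) <= e /\ vol (pre h A `\` pre g A) <= e.

Definition stable A := exists2 S : set Gamma, residual S & stable_on S A.

Lemma stable_on_sub (S S' : set Gamma) A : S' `<=` S -> stable_on S A -> stable_on S' A.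
Proof.
move=> sS sA g /sS gS e e0; have := sA g gS e e0; apply: filterS => h hP /sS; exact: hP.
Qed.

Lemma measurable_pre g A : borel A -> measurable (pre g A).
Proof. by apply: measurable_preimage_borel; exact: gamma_continuous. Qed.

Lemma borel_open (U : set X) : open U -> borel U.
Proof. by move=> oU; apply: sub_sigma_algebra. Qed.

Lemma borelC A : borel A -> borel (~` A).
Proof. by rewrite -setTD; exact: (@sigma_algebraCD _ setT [set U : set X | open U]). Qed.

Lemma borel_closed (U : set X) : closed U -> borel U.
Proof.
by move=> cU; rewrite -[U]setCK; apply: borelC; apply: borel_open; exact: closed_openC.
Qed.

Lemma borel_bigcup (F : nat -> set X) : (forall n, borel (F n)) -> borel (\bigcup_n F n).
Proof. exact: (@sigma_algebra_bigcup _ setT [set U : set X | open U]). Qed.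

Lemma borel_bigcap (F : nat -> set X) : (forall n, borel (F n)) -> borel (\bigcap_n F n).
Proof.
move=> bF; rewrite -[X in borel X]setCK setC_bigcap; apply: borelC; apply: borel_bigcup => n.
exact: borelC.
Qed.

Lemma borelU A B : borel A -> borel B -> borel (A `|` B).
Proof.
move=> bA bB; have -> : A `|` B = \bigcup_n (if n is 0%N then A else B).
  apply/seteqP; split=> [x [Ax|Bx]|x [[|n] _]]; [by exists 0%N|by exists 1%N|by left|by right].
by apply: borel_bigcup => -[].
Qed.

Lemma borelI A B : borel A -> borel B -> borel (A `&` B).
Proof.
by move=> bA bB; rewrite -[X in borel X]setCK setCI; apply: borelC; apply: borelU; exact: borelC.
Qed.

Lemma small_inv (e : R) : 0 < e -> exists n, n.+1%:R^-1 < e.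
Proof.
move=> e0; have [J /(_ J (leqnn J)) Je] := pow2_small e0.
exists (2 ^ J)%N; apply: le_lt_trans Je.
by rewrite lef_pV2 ?posrE ?ltr0n ?expn_gt0// ler_nat.
Qed.

(** The closed sets [B n] of points whose ball of radius 1/(n+1) lies in [A] exhaust [A]. Up to a
    small volume the preimage under [g] comes from finitely many of them, and there a map uniformly
    close to [g] still has its values in [A]. *)
Lemma pre_open_lsc A g (e : R) : open A -> 0 < e ->
  \forall h \near g, vol (pre g A `\` pre h A) <= e.
Proof.
move=> oA e0.
pose B n : set X := [set x | forall y, `|y - x| < n.+1%:R^-1 -> A y].
have cB n : closed (B n).
  rewrite -openC openE => x /existsNP[y /not_implyP[yx nA]].
  apply/nbhs_ballP; exists (n.+1%:R^-1 - `|y - x|); first by rewrite /= subr_gt0.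
  move=> z; rewrite -ball_normE /= ltrBrDl => xz /(_ y); apply/not_implyP; split => //.
  apply: le_lt_trans xz; have := ler_normD (y - x) (x - z).
  by rewrite addrA subrK.
have AB : A = \bigcup_n B n.
  apply/seteqP; split=> [x Ax|x [n _ Bx]]; last first.
    by apply: Bx; rewrite subrr normr0.
  have /nbhs_ballP[d /= d0 dA] : nbhs x A by exact: open_nbhs_nbhs.
  have [n nd] := small_inv d0; exists n => // y yx; apply: dA.
  by rewrite -ball_normE /= distrC; exact: lt_trans yx nd.
have [K vK] := @vol_tail R (fun n => pre g (B n)) e (fun n => measurable_pre g (borel_closed (cB n))) e0.
apply/nbhs_gammaP; exists 1%N, (K.+1%:R^-1 / 2); first by rewrite divr_gt0// invr_gt0.
move=> h gh; apply: le_trans (ltW vK); apply: le_vol => t [At nh]; split.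
  by move: At; rewrite /pre /= AB => -[n _ ?]; exists n.
move=> [n /= nK Bt]; apply: nh; apply: Bt; apply: le_lt_trans (gh 0%N isT t) _.
have : K.+1%:R^-1 <= n.+1%:R^-1 :> R by rewrite lef_pV2 ?posrE// ler_nat ltnW.
have : 0 < K.+1%:R^-1 :> R by rewrite invr_gt0.
by move: (K.+1%:R^-1) (n.+1%:R^-1) => x y; lra.
Qed.

(** The volume of the preimage is lower semicontinuous in [g], so its sublevel sets at rational
    levels are closed. Off their boundaries it is also upper semicontinuous, and then smallness of
    one difference of preimages gives that of the other. *)
Lemma open_stable A : open A -> stable A.
Proof.
move=> oA; have mA g := measurable_pre g (borel_open oA).
pose C (k n : nat) : set Gamma := [set g | vol (pre g A) <= k%:R / n.+1%:R].
have cC k n : closed (C k n).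
  rewrite -openC openE => g /negP; rewrite -ltNge => gC.
  have e0 : 0 < (vol (pre g A) - k%:R / n.+1%:R) / 2 by rewrite divr_gt0// subr_gt0.
  have := pre_open_lsc g oA e0; apply: filterS => h hg; apply/negP; rewrite -ltNge.
  have := vol_split (mA g) (mA h).
  have : vol (pre g A `&` pre h A) <= vol (pre h A) by apply: le_vol; exact: subIsetr.
  by move: gC hg; set r := k%:R / n.+1%:R; lra.
exists (\bigcap_k \bigcap_n ~` (C k n `\` (C k n)^°)).
  by apply: residual_bigcap => k; apply: residual_bigcap => n; exact: residual_boundary.
move=> g gS e e0; have e2 : 0 < e / 2 by rewrite divr_gt0.
have [n ne] := small_inv e2.
(* The next level k / (n + 1) above the volume exceeds it by at most [e / 2]. *)
pose k := (Num.trunc (vol (pre g A) * n.+1%:R)).+1.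
have n0 : 0 < n.+1%:R :> R by [].
have gC : C k n g.
  by rewrite /C /= ler_pdivlMr//; exact: ltW (truncnS_gt _).
have kv : k%:R / n.+1%:R <= vol (pre g A) + e / 2.
  rewrite /k -(@natr1 R (Num.trunc _)) mulrDl mul1r; apply: lerD; last exact: ltW.
  by rewrite ler_pdivrMr// truncn_le mulr_ge0// vol_ge0.
have gC' : (C k n)^° g.
  by apply: contrapT => ngC; have /= h := gS k Logic.I n Logic.I; exact: h.
have gN : nbhs g (C k n) by exact: gC'.
apply: (nbhs_app2 gN (pre_open_lsc g oA e2)) => h hC hg _.
split; first by lra.
have s1 := vol_split (mA h) (mA g); have s2 := vol_split (mA g) (mA h).
rewrite setIC in s1; move: hC kv; rewrite /C /=; set r := k%:R / n.+1%:R.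
by move=> hC kv; lra.
Qed.

Lemma stableC A : stable A -> stable (~` A).
Proof.
move=> [S rS sA]; exists S => // g gS e e0; have := sA g gS e e0.
apply: filterS => h hP /hP[h1 h2].
have E f f' : pre f (~` A) `\` pre f' (~` A) = pre f' A `\` pre f A.
  by apply/seteqP; split=> [t [nf /contrapT f't]|t [f't nf]]; split => //; apply.
by rewrite !E.
Qed.

(** Finite unions are continuous in measure on [S0]. Off the boundaries of the closed sets [C n k],
    a tail that is small at [g] is small near [g], as in the proof that a pointwise limit of
    continuous functions is continuous at residually many points. *)
Lemma stable_bigcup (A : nat -> set X) : (forall n, borel (A n)) ->
  (forall n, stable (A n)) -> stable (\bigcup_n A n).
Proof.
move=> bA sA.
have {sA}[S0 rS0 sA] : exists2 S0 : set Gamma, residual S0 & forall n, stable_on S0 (A n).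
  have [S SP] : {S : nat -> set Gamma & forall n, residual (S n) /\ stable_on (S n) (A n)}.
    apply: (@choice nat (set Gamma) (fun n S => residual S /\ stable_on S (A n))) => n.
    by have [S] := sA n; exists S.
  exists (\bigcap_n S n) => [|n]; first by apply: residual_bigcap => n; exact: (SP n).1.
  by apply: (stable_on_sub _ (SP n).2) => g gS; exact: gS.
pose B n := \bigcup_(k < n) A k.
pose AA := \bigcup_n A n.
have mAn g n : measurable (pre g (A n)) by exact: measurable_pre.
have BA n : B n `<=` AA by move=> x [k _ Ax]; exists k.
have sB n : stable_on S0 (B n).
  elim: n => [|n IH] g gS e e0.
    apply: nbhs_all => h _; rewrite /B II0 bigcup_set0 /pre.
    rewrite (_ : [set t | _] = set0)// set0D vol0; split; exact: ltW.
  have e2 : 0 < e / 2 by rewrite divr_gt0.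
  apply: (nbhs_app2 (IH g gS _ e2) (sA n g gS _ e2)) => h h1 h2 hS.
  have [a1 a2] := h1 hS; have [b1 b2] := h2 hS.
  have E f f' : vol (pre f (B n.+1) `\` pre f' (B n.+1)) <=
      vol (pre f (B n) `\` pre f' (B n)) + vol (pre f (A n) `\` pre f' (A n)).
    apply: le_trans (volU_le _ _); apply: le_vol => t [].
    by rewrite /pre /= /B bigcup_ltnS => -[Bt|At] /not_orP[nB nA]; [left|right].
  by split; apply: le_trans (E _ _) _; lra.
have tail g (e : R) : 0 < e -> exists n, vol (pre g AA `\` pre g (B n)) <= e.
  move=> e0; have [K vK] := @vol_tail R (fun n => pre g (A n)) e (mAn g) e0.
  exists K; apply: le_trans (ltW vK); apply: le_vol => t [[n _ At] nB].
  by split; [exists n|move=> [k kK Ak]; apply: nB; exists k].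
pose C n k := closure (S0 `&` [set g | vol (pre g AA `\` pre g (B n)) <= k.+1%:R^-1]).
exists (S0 `&` \bigcap_n \bigcap_k ~` (C n k `\` (C n k)^°)).
  apply: residualI => //; apply: residual_bigcap => n; apply: residual_bigcap => k.
  by apply: residual_boundary; exact: closed_closure.
move=> g [gS gC] e e0; have e2 : 0 < e / 2 by rewrite divr_gt0.
have [k ke] := small_inv e2.
have k0 : 0 < k.+1%:R^-1 :> R by rewrite invr_gt0.
have [n gn] := tail g _ k0.
have gC' : (C n k)^° g.
  apply: contrapT => ngC; have /= h := gC n Logic.I k Logic.I; apply: h.
  by split => //; exact: subset_closure.
(* Points of [S0] gained by the closure still have a small tail: [h] is compared with a nearby [f]
   through a finite union [B p] that nearly exhausts the preimage under [h]. *)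
have CP h : S0 h -> C n k h -> vol (pre h AA `\` pre h (B n)) <= k.+1%:R^-1.
  move=> hS hC; apply/ler_addgt0Pr => d d0.
  have d3 : 0 < d / 3 by rewrite divr_gt0.
  have [p hp] := tail h _ d3.
  have [f [[fS fn] [h1 h2]]] := hC _ (nbhs_app2 (sB p h hS _ d3) (sB n h hS _ d3) (fun=> @conj _ _)).
  have [f1 _] := h1 fS; have [_ f2] := h2 fS.
  move: fn => /= fn.
  apply: (@le_trans _ _ (vol (((pre h AA `\` pre h (B p)) `|` (pre h (B p) `\` pre f (B p)))
     `|` ((pre f AA `\` pre f (B n)) `|` (pre f (B n) `\` pre h (B n)))))).
    apply: le_vol => t [At nB].
    have [hBp|] := pselect (pre h (B p) t); last by left; left.
    have [fBp|] := pselect (pre f (B p) t); last by left; right.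
    have [fBn|nfBn] := pselect (pre f (B n) t); first by right; right.
    by right; left; split => //; exact: BA fBp.
  have v1 := volU_le ((pre h AA `\` pre h (B p)) `|` (pre h (B p) `\` pre f (B p)))
    ((pre f AA `\` pre f (B n)) `|` (pre f (B n) `\` pre h (B n))).
  have v2 := volU_le (pre h AA `\` pre h (B p)) (pre h (B p) `\` pre f (B p)).
  have v3 := volU_le (pre f AA `\` pre f (B n)) (pre f (B n) `\` pre h (B n)).
  by move: fn hp f1 f2 v1 v2 v3; set r := k.+1%:R^-1; clear; lra.
have gN : nbhs g ((C n k)) by exact: gC'.
apply: (nbhs_app2 gN (sB n g gS _ e2)) => h hC hB [hS _].
have [h1 h2] := hB hS; have h3 := CP h hS hC.
have E f f' : vol (pre f AA `\` pre f' AA) <=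
    vol (pre f AA `\` pre f (B n)) + vol (pre f (B n) `\` pre f' (B n)).
  apply: le_trans (volU_le _ _); apply: le_vol => t [ft nf't].
  have [fB|] := pselect (pre f (B n) t); last by left.
  by right; split => // /BA.
by split; apply: le_trans (E _ _) _; move: gn ke h1 h2 h3; rewrite /=; set r := k.+1%:R^-1; clear; lra.
Qed.

Lemma borel_stable A : borel A -> stable A.
Proof.
move=> bA; suff [] : borel A /\ stable A by [].
move: A bA; apply: smallest_sub.
  split=> [|A [bA sA]|F bsF].
  - split; [by apply: borel_open; exact: open0|by apply: open_stable; exact: open0].
  - by rewrite setTD; split; [exact: borelC|exact: stableC].
  - split; first by apply: borel_bigcup => n; exact: (bsF n).1.
    by apply: stable_bigcup => n; [exact: (bsF n).1|exact: (bsF n).2].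
by move=> U oU; split; [exact: borel_open|exact: open_stable].
Qed.

Lemma Gamma_eq g h : (forall t, g t = h t) -> g = h.
Proof.
case: g => g g1 g2 g3; case: h => h h1 h2 h3 /= /funext gh; subst h.
by congr MkGamma; exact: Prop_irrelevance.
Qed.

(* If a residual set misses an open set U, then U is meager; the images of U
   under the dilations about a point of U cover the space. *)
Lemma residual_dense (S : set Gamma) g (U : set Gamma) :
  ~ residual (set0 : set Gamma) -> residual S -> nbhs g U -> exists2 h, S h & U h.
Proof.
move=> n0 [F [F0 SF]] gU; apply: contrapT => /forall2NP nS; apply: n0.
have UF : U `<=` \bigcup_n F n.
  by move=> h Uh; apply: SF => Sh; have [] := nS h.
have lin c (f : Gamma) := cid (gamma_lin c g f).
(* For fixed [f] the points [phi k f] converge to [g], so they enter [U]. Each [phi k] is an affine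
   homeomorphism, so preimages of nowhere dense sets are nowhere dense. *)
pose phi k (f : Gamma) := sval (lin k.+1%:R^-1 f).
have phiE k f i t : jet i (phi k f) t = jet i g t + k.+1%:R^-1 *: jet i f t.
  exact: (svalP (lin k.+1%:R^-1 f)).
have nd k n : interior (closure (phi k @^-1` F n)) = set0.
  apply/seteqP; split => // f /nbhs_gammaP[m [e e0 mF]].
  have k0 : 0 < k.+1%:R :> R by [].
  have : interior (closure (F n)) (phi k f); last by rewrite F0.
  apply/nbhs_gammaP; exists m, (e / k.+1%:R); first by rewrite divr_gt0.
  move=> f' ff'.
  (* [q'] is (k + 1)(f' - g), the point that [phi k] sends to [f']. *)
  have [q qE] := gamma_lin (-1) f' g; have [q' q'E] := gamma_lin (k.+1%:R - 1) q q.
  have qJ i t : jet i q' t = k.+1%:R *: (jet i f' t - jet i g t).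
    by rewrite q'E !qE scaleN1r -[X in X + _]scale1r -scalerDl addrC subrK.
  have pq : phi k q' = f'.
    apply: Gamma_eq => t; have := phiE k q' 0%N t; rewrite qJ scalerA mulVf ?gt_eqF// scale1r.
    by rewrite addrC subrK.
  have qcl : closure (phi k @^-1` F n) q'.
    apply: mF => i im t; rewrite qJ.
    have -> : k.+1%:R *: (jet i f' t - jet i g t) - jet i f t =
        k.+1%:R *: (jet i f' t - jet i (phi k f) t).
      rewrite phiE opprD addrA [in RHS]scalerBr scalerA mulfV ?gt_eqF//.
      by rewrite scale1r.
    rewrite normrZ gtr0_norm// mulrC -ler_pdivlMr//; exact: ff'.
  rewrite -pq => V /nbhs_gammaP[i [d d0 iV]].
  have := qcl (jet_close i d q'); case.
    by apply/nbhs_gammaP; exists i, d.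
  move=> r [Fr qr]; exists (phi k r); split => //; apply: iV => j ji t.
  rewrite !phiE opprD addrACA subrr add0r -scalerBr normrZ ger0_norm ?invr_ge0//.
  apply: le_trans (qr j ji t); rewrite ler_piMl// invf_le1// ler1n.
  by [].
rewrite /residual setC0; apply: (@meager_sub _ _ (\bigcup_k \bigcup_n (phi k @^-1` F n))).
  move=> f _; have /nbhs_gammaP[m [e e0 mU]] := gU.
  have [M MP] : exists M : R, forall i t, (i < m)%N -> `|jet i f t| <= M.
    elim: (m) => [|p [M hM]]; first by exists 0.
    have [M' hM'] := cube_bounded (@jet_continuous _ _ p f).
    exists (Num.max M M') => i t; rewrite ltnS leq_eqVlt => /predU1P[->|ip].
      by rewrite le_max hM' orbT.
    by rewrite le_max hM.
  have M1 : 0 < `|M| + 1 by rewrite ltr_wpDl.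
  have [k ke] : exists k, k.+1%:R^-1 < e / (`|M| + 1) by apply: small_inv; rewrite divr_gt0.
  have : U (phi k f).
    apply: mU => i im t; rewrite phiE addrAC subrr add0r normrZ ger0_norm ?invr_ge0//.
    have h1 : `|jet i f t| <= `|M| + 1.
      by apply: le_trans (MP i t im) _; have := ler_norm M; lra.
    have k1 : 0 <= k.+1%:R^-1 :> R by rewrite invr_ge0.
    apply: (@le_trans _ _ (e / (`|M| + 1) * (`|M| + 1))).
      by apply: ler_pM => //; exact: ltW.
    by rewrite divfK// gt_eqF.
  by move/UF => [n _ Fn]; exists k => //; exists n.
apply: meager_bigcup => k; exists (fun n => phi k @^-1` F n); split; last by [].
exact: nd.
Qed.

End stable_preimages.

(** * The bad points of a Lipschitz map *)

Lemma subrACA (V : zmodType) (a b c d : V) : a - b - (c - d) = a - c - (b - d).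
Proof. by rewrite opprD addrACA -opprD. Qed.

(** * Mean value estimates along coordinate lines *)

Section curves.
Context {R : realType} {X : normedModType R}.
Local Notation I := (set_type (unit_itv R)).
Local Notation T := (cube R).

Lemma dfwith_twice (t : T) j (a b : I) : dfwith (dfwith t j a) j b = dfwith t j b.
Proof.
apply: functional_extensionality_dep => i; have [->|ij] := eqVneq i j.
  by rewrite !dfwithin.
by rewrite !dfwithout// eq_sym.
Qed.

Lemma dfwith_id (t : T) j : dfwith t j (t j) = t.
Proof.
apply: functional_extensionality_dep => i; have [->|ij] := eqVneq i j.
  by rewrite dfwithin.
by rewrite dfwithout// eq_sym.
Qed.

Lemma line_partial (g : Gamma X) (t : T) j (r z : R) : 0 <= r <= 1 -> 0 < z ->
  exists2 d, 0 < d & forall s, 0 <= s <= 1 -> `|s - r| < d ->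
    `|g (dfwith t j (clip s)) - g (dfwith t j (clip r)) -
      (s - r) *: partial j g (dfwith t j (clip r))| <= z * `|s - r|.
Proof.
move=> r01 z0; have [d d0 dg] := Gamma_has_partial g j (dfwith t j (clip r)) z0.
exists d => // s s01 sr; have := dg (clip s).
by rewrite dfwithin dfwith_twice !clipK//; exact.
Qed.

(** This is [line_bound] without exceptional set, for the curve minus the straight motion of
    velocity [v]. *)
Lemma partial_mvt (g : Gamma X) (t : T) j (a b z : R) (v : X) :
  0 <= a -> a <= b -> b <= 1 -> 0 <= z ->
  (forall r, a <= r <= b -> `|partial j g (dfwith t j (clip r)) - v| <= z) ->
  `|g (dfwith t j (clip b)) - g (dfwith t j (clip a)) - (b - a) *: v| <= z * (b - a).
Proof.
move=> a0 ab b1 z0 hv.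
have I01 r : a <= r <= b -> 0 <= r <= 1.
  by move=> /andP[ar rb]; rewrite (le_trans a0 ar) (le_trans rb b1).
pose F r := g (dfwith t j (clip r)) - r *: v.
have loc r y : a <= r <= b -> 0 < y -> exists2 d, 0 < d &
    forall s, a <= s <= b -> `|s - r| < d -> `|F s - F r| <= (z + y) * `|s - r|.
  move=> rab y0; have [d d0 dP] := line_partial g t j (I01 _ rab) y0.
  exists d => // s sab sr; have := dP s (I01 _ sab) sr.
  set p := partial _ _ _ => hp.
  have -> : F s - F r = (g (dfwith t j (clip s)) - g (dfwith t j (clip r)) - (s - r) *: p)
      + (s - r) *: (p - v).
    by rewrite scalerBr addrA subrK /F subrACA -scalerBl.
  apply: le_trans (ler_normD _ _) _; rewrite mulrDl addrC; apply: lerD => //.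
  by rewrite normrZ mulrC ler_wpM2r// hv.
have := line_bound ab z0 z0 measurable0 loc (fun r y rab _ => loc r y rab).
rewrite set0I measure0 /= mulr0 addr0; apply: le_trans.
by rewrite /F [X in _ <= `|X|]subrACA -scalerBl.
Qed.

(** Coordinates are moved from [t0] to [t] one at a time, and each move is a mean value estimate
    against the partial derivative at [t0], which continuity keeps within [z] on a small box. *)
Lemma gamma_diff (g : Gamma X) m (t0 : T) (z : R) : 0 < z ->
  (forall s t, (forall i, (i < m)%N -> s i = t i) -> g s = g t) ->
  exists J, forall j, (J <= j)%N -> forall t, dbox m (dbox_at m j t0) t ->
  `|g t - g t0 - \sum_(i < m) (\val (t i) - \val (t0 i)) *: partial i g t0|
    <= m%:R * (z * (2 ^ j)%:R^-1).
Proof.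
move=> z0 gm.
have [n [e e0 nP]] : exists n, exists2 e : R, 0 < e & forall i, (i < m)%N ->
    forall s, cube_close n e t0 s -> `|partial i g s - partial i g t0| <= z.
  elim: {gm}m => [|m [n [e e0 nP]]]; first by exists 0%N, 1.
  have : nbhs t0 [set s | `|partial m g s - partial m g t0| < z].
    have /cvgrPdist_lt/(_ z z0) := @gamma_partial_continuous _ _ g m t0.
    by apply: filterS => s; rewrite distrC.
  move=> /nbhs_cubeP[n' [e' e'0 n'P]].
  exists (maxn n n'), (Num.min e e'); first by rewrite lt_min e0.
  move=> i; rewrite ltnS leq_eqVlt => /predU1P[->|im] s sc.
    apply: ltW; apply: n'P => k kn'; have := sc k.
    by rewrite leq_max kn' orbT lt_min => /(_ isT)/andP[].
  apply: nP => // k kn; have := sc k.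
  by rewrite leq_max kn lt_min => /(_ isT)/andP[].
have [J JP] := pow2_small e0; exists J => j /JP je t bt.
have close i : (i < m)%N -> `|\val (t i) - \val (t0 i)| < (2 ^ j)%:R^-1.
  exact: (dbox_close bt (@dbox_atP _ m j t0)).
pose P i := mix (fun k => k < i)%N t t0.
have -> : g t = g (P m) by apply: gm => i im; rewrite /P /mix im.
have : forall p, (p <= m)%N -> `|g (P p) - g t0 -
    \sum_(i < p) (\val (t i) - \val (t0 i)) *: partial i g t0| <= p%:R * (z * (2 ^ j)%:R^-1).
  elim=> [_|p IH pm].
    have -> : P 0%N = t0 by apply: functional_extensionality_dep => i.
    by rewrite big_ord0 !subr0 subrr normr0 mul0r.
  have stepP : P p.+1 = dfwith (P p) p (t p).
    apply: functional_extensionality_dep => i; rewrite /P /mix.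
    have [->|ip] := eqVneq i p; first by rewrite dfwithin ltnSn.
    by rewrite dfwithout 1?eq_sym// ltnS leq_eqVlt (negbTE ip).
  have Pp : P p p = t0 p by rewrite /P /mix ltnn.
  have hv (r : I) : `|\val r - \val (t0 p)| <= `|\val (t p) - \val (t0 p)| ->
      `|partial p g (dfwith (P p) p r) - partial p g t0| <= z.
    move=> rp; apply: nP => // i _; have [->|ip] := eqVneq i p.
      by rewrite dfwithin; apply: le_lt_trans rp _; exact: lt_trans (close _ pm) je.
    rewrite dfwithout 1?eq_sym// /P /mix; case: ifP => ip'.
      by apply: lt_trans je; apply: close; exact: leq_trans (ltnW pm).
    by rewrite subrr normr0.
  have stepB : `|g (P p.+1) - g (P p) -
      (\val (t p) - \val (t0 p)) *: partial p g t0| <= z * (2 ^ j)%:R^-1.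
    have {1}-> : P p = dfwith (P p) p (t0 p) by rewrite -Pp dfwith_id.
    rewrite stepP -[t p]clip_val -[t0 p]clip_val.
    have /andP[a0 a1] := unit_itvP (t p); have /andP[b0 b1] := unit_itvP (t0 p).
    have cl := ltW (close _ pm).
    have [le|/ltW le] := leP (\val (t0 p)) (\val (t p)).
      rewrite !clip_val; have := @partial_mvt g (P p) p _ _ z (partial p g t0) b0 le a1 (ltW z0).
      rewrite !clip_val => h; apply: le_trans (h _) _.
        move=> r /andP[r0 r1]; apply: hv; rewrite clipK ?(le_trans b0 r0) ?(le_trans r1 a1)//.
        by rewrite !ger0_norm ?subr_ge0// lerD2r.
      by rewrite ler_pM2l//; move: cl; rewrite ger0_norm ?subr_ge0.
    rewrite !clip_val; have := @partial_mvt g (P p) p _ _ z (partial p g t0) a0 le b1 (ltW z0).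
    rewrite !clip_val => h.
    rewrite -normrN opprB opprB -[_ *: _]opprK -scaleNr opprB addrC.
    apply: le_trans (h _) _.
      move=> r /andP[r0 r1]; apply: hv; rewrite clipK ?(le_trans a0 r0) ?(le_trans r1 b1)//.
      by rewrite !ler0_norm ?subr_le0// lerN2 lerD2r.
    by rewrite ler_pM2l//; move: cl; rewrite ler0_norm ?subr_le0// opprB.
  rewrite big_ord_recr/=.
  have -> : g (P p.+1) - g t0 - (\sum_(i < p) (\val (t i) - \val (t0 i)) *: partial i g t0 +
      (\val (t p) - \val (t0 p)) *: partial p g t0) =
    (g (P p) - g t0 - \sum_(i < p) (\val (t i) - \val (t0 i)) *: partial i g t0) +
    (g (P p.+1) - g (P p) - (\val (t p) - \val (t0 p)) *: partial p g t0).
    by rewrite [RHS]addrACA -opprD; congr (_ - _); rewrite [RHS]addrC addrA subrK.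
  apply: le_trans (ler_normD _ _) _; rewrite -(@natr1 R p) mulrDl mul1r.
  by apply: lerD => //; exact: IH (ltnW pm).
by move=> h; exact: h.
Qed.

End curves.

(** * The bad set: Borel measurability, and what its points satisfy *)

Section bad_points.
Context {R : realType} {X Y : normedModType R} (G : set X) (f : X -> Y) (eps : R).

(* In the definition of regularity f'(x,v) may be replaced by the difference
   quotient at x itself, so the condition makes sense without derivatives. *)
Definition regular_at_scale (v : X) (k m : nat) : set X :=
  [set x | forall (r : R) (u : X), 0 < r < m.+1%:R^-1 -> `|u| <= 1 ->
    G (x + (r *: u + r *: v)) -> G (x + r *: u) -> G (x + r *: v) -> G x ->
    `|f (x + (r *: u + r *: v)) - f (x + r *: u) - (f (x + r *: v) - f x)|
      <= r * k.+1%:R^-1].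

(** The bound |f'(x,v)| <= eps |v| in a form that mentions no derivative. Here and above, membership
    in [G] is a hypothesis, so that the complement is open. *)
Definition flat_at_scale (v : X) (k m : nat) : set X :=
  [set x | forall r : R, `|r| < m.+1%:R^-1 -> G (x + r *: v) -> G x ->
    `|f (x + r *: v) - f x| <= (eps * `|v| + k.+1%:R^-1) * `|r|].

Definition steep_at_scale (m : nat) : set X :=
  [set x | exists u : X, [/\ `|u| < m.+1%:R^-1, G (x + u), G x &
    4 * eps * `|u| < `|f (x + u) - f x| ]].

Definition bad_points (d : nat -> X) : set X :=
  G `&` \bigcap_i \bigcap_k \bigcup_m regular_at_scale (d i) k m `&`
  \bigcap_i \bigcap_k \bigcup_m flat_at_scale (d i) k m `&`
  \bigcap_m steep_at_scale m.

Context (C : R) (oG : open G) (C0 : 0 < C)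
  (lipf : forall x y, G x -> G y -> `|f x - f y| <= C * `|x - y|).

Lemma lip_near x (e : R) : G x -> 0 < e ->
  \forall y \near x, G y /\ `|f y - f x| < e.
Proof.
move=> Gx e0; have /nbhs_ballP[d /= d0 dG] : nbhs x G by exact: open_nbhs_nbhs.
apply/nbhs_ballP; exists (Num.min d (e / C)); first by rewrite /= lt_min d0 divr_gt0.
move=> y; rewrite -ball_normE /= lt_min => /andP[yd ye].
have Gy : G y by apply: dG; rewrite -ball_normE.
split => //; apply: le_lt_trans (lipf Gy Gx) _.
by rewrite distrC mulrC -ltr_pdivlMr.
Qed.

(** The conditions on bad points all reduce to sets of this form, those on first-order increments by
    taking zero shifts. *)
Lemma open_difference (a b c : X) (rho : R) : open [set x |
  [/\ G (x + a), G (x + b), G (x + c), G x &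
      rho < `|f (x + a) - f (x + b) - (f (x + c) - f x)|]].
Proof.
rewrite openE => x [Ga Gb Gc Gx]; set w := `|_| => hw.
have e0 : 0 < (w - rho) / 4 by rewrite divr_gt0// subr_gt0.
have sh z : G (x + z) -> \forall y \near x, G (y + z) /\
    `|f (y + z) - f (x + z)| < (w - rho) / 4.
  move=> Gz; have /nbhs_ballP[d /= d0 dP] := lip_near Gz e0.
  apply/nbhs_ballP; exists d => // y yx; apply: dP; move: yx.
  by rewrite -!ball_normE /= opprD addrACA subrr addr0.
have ha := sh _ Ga; have hb := sh _ Gb; have hc := sh _ Gc.
have h0 := lip_near Gx e0.
apply: (nbhs_app2 (nbhs_app2 ha hb (fun y => @conj _ _))
  (nbhs_app2 hc h0 (fun y => @conj _ _))).
move=> y [[ya fa] [yb fb]] [[yc fc] [y0 f0]]; split => //.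
have : w <= `|f (y + a) - f (y + b) - (f (y + c) - f y)| +
    (`|f (y + a) - f (x + a)| + `|f (y + b) - f (x + b)| +
     (`|f (y + c) - f (x + c)| + `|f y - f x|)).
  rewrite /w -[X in `|X| <= _](subKr (f (y + a) - f (y + b) - (f (y + c) - f y))).
  apply: le_trans (ler_normB _ _) _; rewrite lerD2l subrACA.
  apply: le_trans (ler_normB _ _) _; apply: lerD; rewrite subrACA; exact: ler_normB.
lra.
Qed.

Lemma borel_bad_points d : borel (bad_points d).
Proof.
have bR v k m : borel (regular_at_scale v k m).
  apply: borel_closed; rewrite -[X in closed X]setCK; apply: open_closedC.
  have -> : ~` regular_at_scale v k m = \bigcup_(p in [set p : R * X |
      0 < p.1 < m.+1%:R^-1 /\ `|p.2| <= 1]) [set x |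
      [/\ G (x + (p.1 *: p.2 + p.1 *: v)), G (x + p.1 *: p.2), G (x + p.1 *: v), G x &
       p.1 * k.+1%:R^-1 < `|f (x + (p.1 *: p.2 + p.1 *: v)) - f (x + p.1 *: p.2) -
         (f (x + p.1 *: v) - f x)|]].
    apply/seteqP; split=> [x|x [[r u] /= [r0 u1] [G1 G2 G3 G4 h]] xr]; last first.
      by have := xr r u r0 u1 G1 G2 G3 G4; rewrite leNgt h.
    move=> /existsNP[r /existsNP[u /not_implyP[r0 /not_implyP[u1 /not_implyP[G1
      /not_implyP[G2 /not_implyP[G3 /not_implyP[G4 h]]]]]]]].
    by exists (r, u) => //=; split => //; rewrite ltNge; exact/negP.
  by apply: bigcup_open => p _; exact: open_difference.
have bF v k m : borel (flat_at_scale v k m).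
  apply: borel_closed; rewrite -[X in closed X]setCK; apply: open_closedC.
  have -> : ~` flat_at_scale v k m = \bigcup_(r in [set r : R | `|r| < m.+1%:R^-1])
      [set x | [/\ G (x + r *: v), G (x + 0), G (x + 0), G x &
       (eps * `|v| + k.+1%:R^-1) * `|r| < `|f (x + r *: v) - f (x + 0) - (f (x + 0) - f x)|]].
    apply/seteqP; split=> [x|x [r r0 [G1 G2 G3 G4]]].
      move=> /existsNP[r /not_implyP[r0 /not_implyP[G1 /not_implyP[G2 h]]]].
      by exists r => //; rewrite /= addr0 subrr subr0; split => //; rewrite ltNge; exact/negP.
    by rewrite addr0 subrr subr0 => h xr; have := xr r r0 G1 G4; rewrite leNgt h.
  by apply: bigcup_open => p _; exact: open_difference.
have bS m : borel (steep_at_scale m).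
  apply: borel_open.
  have -> : steep_at_scale m = \bigcup_(u in [set u : X | `|u| < m.+1%:R^-1])
      [set x | [/\ G (x + u), G (x + 0), G (x + 0), G x &
       4 * eps * `|u| < `|f (x + u) - f (x + 0) - (f (x + 0) - f x)|]].
    apply/seteqP; split=> [x [u [u0 G1 G2 h]]|x [u u0]].
      by exists u => //; rewrite /= addr0 subrr subr0.
    by rewrite /= addr0 subrr subr0 => -[G1 _ _ G2 h]; exists u.
  by apply: bigcup_open => p _; exact: open_difference.
rewrite /bad_points; apply: borelI; last by apply: borel_bigcap.
apply: borelI; last by do 2 (apply: borel_bigcap => ?); exact: borel_bigcup.
apply: borelI; first exact: borel_open.
by do 2 (apply: borel_bigcap => ?); exact: borel_bigcup.
Qed.

Context (d : nat -> X) (dense_d : forall (x : X) (e : R), 0 < e -> exists i, `|d i - x| < e).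

Section at_bad_point.
Context (x : X) (bx : bad_points d x).

Let Gx : G x. Proof. by case: bx => -[[]]. Qed.

Let radius : exists2 rho : R, 0 < rho & forall y, `|y - x| < rho -> G y.
Proof.
have /nbhs_ballP[r /= r0 rG] : nbhs x G by exact: open_nbhs_nbhs.
by exists r => // y yx; apply: rG; rewrite -ball_normE /= distrC.
Qed.

(** The expression is the second difference of [f] at [x], symmetric in [u] and [w]. *)
Definition uniformly_regular (W : set X) := forall L e : R, 0 < L -> 0 < e ->
  exists2 del : R, 0 < del & forall r u w, 0 < r < del -> `|u| <= L -> W w ->
    `|f (x + r *: u + r *: w) - f (x + r *: u) - (f (x + r *: w) - f x)| <= e * r.

Lemma lip_at y z a : G y -> G z -> `|y - z| <= a -> `|f y - f z| <= C * a.
Proof. by move=> Gy Gz yz; apply: le_trans (lipf Gy Gz) _; rewrite ler_pM2l. Qed.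

(** Two of the four values move, each by at most [C * q]. *)
Lemma secant_lip (a b b' : X) (q : R) : G (x + a + b) -> G (x + a + b') ->
  G (x + b) -> G (x + b') -> `|b - b'| <= q ->
  `|f (x + a + b) - f (x + a) - (f (x + b) - f x)| <=
  `|f (x + a + b') - f (x + a) - (f (x + b') - f x)| + 2 * C * q.
Proof.
move=> G1 G2 G3 G4 bq.
have h1 : `|f (x + a + b) - f (x + a + b')| <= C * q.
  by apply: lip_at => //; rewrite opprD addrACA subrr add0r.
have h2 : `|f (x + b) - f (x + b')| <= C * q.
  by apply: lip_at => //; rewrite opprD addrACA subrr add0r.
have -> : f (x + a + b) - f (x + a) - (f (x + b) - f x) =
    (f (x + a + b') - f (x + a) - (f (x + b') - f x)) +
    ((f (x + a + b) - f (x + a + b')) - (f (x + b) - f (x + b'))).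
  rewrite [LHS]subrACA [X in _ = X + _]subrACA [X in _ = _ + X]subrACA.
  by rewrite [RHS]addrC [RHS]addrA subrK.
apply: le_trans (ler_normD _ _) _; rewrite lerD2l.
by apply: le_trans (ler_normB _ _) _; lra.
Qed.

(** Bad points are regular for [|u| <= 1] and for directions of the sequence. Rescaling by [L]
    removes the first restriction; replacing [L^-1 *: v] by a nearby [d i], at Lipschitz cost,
    removes the second. *)
Lemma uniformly_regular1 v : uniformly_regular [set v].
Proof.
move=> L e L0 e0; have [rho rho0 rhoG] := radius.
(* The change of direction will cost [e * r / 4] and regularity [e * r / 2]. *)
pose s := e / (8 * C * L).
have s0 : 0 < s by rewrite divr_gt0// !mulr_gt0.
have [i di] := dense_d (L^-1 *: v) s0.
have e1 : 0 < e / (2 * L) by rewrite divr_gt0// mulr_gt0.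
have [k ke] := small_inv e1.
have [[[_ /(_ i Logic.I k Logic.I)[m _ mP]] _] _] := bx.
pose B := L + `|v| + L * `|d i| + 1.
have B0 : 0 < B.
  by rewrite /B; have := normr_ge0 v; have := mulr_ge0 (ltW L0) (normr_ge0 (d i)); lra.
have m0 : 0 < m.+1%:R^-1 :> R by rewrite invr_gt0.
exists (Num.min (m.+1%:R^-1 / L) (rho / B)); first by rewrite lt_min !divr_gt0.
move=> r u w0 /andP[r0]; rewrite lt_min => /andP[rm rr] uL ->.
have rB : r * B < rho by rewrite -ltr_pdivlMr.
have inG (y : X) : `|y| <= r * B -> G (x + y).
  by move=> yB; apply: rhoG; rewrite addrC addKr; exact: le_lt_trans rB.
have nu : `|r *: u| <= r * L by rewrite normrZ gtr0_norm// ler_pM2l.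
have nv : `|r *: v| = r * `|v| by rewrite normrZ gtr0_norm.
pose v' := (L * r) *: d i.
have nv' : `|v'| = r * (L * `|d i|).
  by rewrite normrZ gtr0_norm ?mulr_gt0// [L * r]mulrC mulrA.
have vv : `|r *: v - v'| <= r * (e / (8 * C)).
  have -> : r *: v - v' = (L * r) *: (L^-1 *: v - d i).
    rewrite scalerBr scalerA; congr (_ *: _ - _).
    by rewrite mulrAC mulfV ?mul1r// gt_eqF.
  rewrite normrZ gtr0_norm ?mulr_gt0// distrC [L * r]mulrC -mulrA ler_pM2l//.
  rewrite -ler_pdivlMl//; apply: le_trans (ltW di) _.
  suff -> : L^-1 * (e / (8 * C)) = s by []. rewrite /s; field; by rewrite !gt_eqF.
have rL : 0 <= r * L by rewrite mulr_ge0// ltW.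
have rv : 0 <= r * `|v| by rewrite mulr_ge0// ltW.
have rd : 0 <= r * (L * `|d i|) by rewrite !mulr_ge0// ltW.
have BE : r * B = r * L + r * `|v| + r * (L * `|d i|) + r by rewrite /B; ring.
have G1 : G (x + r *: u + r *: v).
  by rewrite -addrA; apply: inG; apply: le_trans (ler_normD _ _) _; rewrite nv; lra.
have G2 : G (x + r *: u + v').
  by rewrite -addrA; apply: inG; apply: le_trans (ler_normD _ _) _; rewrite nv'; lra.
have G3 : G (x + r *: v) by apply: inG; rewrite nv; lra.
have G4 : G (x + v') by apply: inG; rewrite nv'; lra.
have G5 : G (x + r *: u) by apply: inG; lra.
apply: le_trans (secant_lip G1 G2 G3 G4 vv) _.
have ru : r *: u = (L * r) *: (L^-1 *: u).
  by rewrite scalerA mulrAC mulfV ?mul1r// gt_eqF.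
have h : `|f (x + r *: u + v') - f (x + r *: u) - (f (x + v') - f x)| <=
    L * r * k.+1%:R^-1.
  rewrite -[x + r *: u + v']addrA ru; apply: mP => //; rewrite -?ru ?addrA//.
    by rewrite mulr_gt0//= mulrC -ltr_pdivlMr.
  by rewrite normrZ gtr0_norm ?invr_gt0// ler_pdivrMl// mulr1.
have k2 : L * r * k.+1%:R^-1 <= e * r / 2.
  have -> : e * r / 2 = L * r * (e / (2 * L)) by field; rewrite gt_eqF.
  by rewrite ler_pM2l ?mulr_gt0// ltW.
have -> : 2 * C * (r * (e / (8 * C))) = e * r / 4 by field; rewrite gt_eqF.
have er : 0 < e * r by rewrite mulr_gt0.
by apply: le_trans (lerD (le_trans h k2) (lexx _)) _; lra.
Qed.

(** Compactness of [-1, 1]: passing to a nearby multiple of [v] costs little by the Lipschitz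
    condition. *)
Lemma uniformly_regular_segment v :
  uniformly_regular [set a *: v | a in `[-1, 1]].
Proof.
move=> L e L0 e0; have [rho rho0 rhoG] := radius.
have /compact_near_coveringP cc := @segment_compact R (-1) 1.
have e2 : 0 < e / 2 by rewrite divr_gt0.
have := @cc nat \oo (fun n a => forall (r : R) u, 0 < r < n.+1%:R^-1 -> `|u| <= L ->
    `|f (x + r *: u + r *: (a *: v)) - f (x + r *: u) - (f (x + r *: (a *: v)) - f x)|
      <= e * r) _.
case.
  move=> a _; have [del del0 delP] := uniformly_regular1 (a *: v) L0 e2.
  pose q := e / (4 * C * (`|v| + 1)).
  have v1 : 0 < `|v| + 1 by rewrite ltr_wpDl.
  have q0 : 0 < q by rewrite divr_gt0// !mulr_gt0.
  pose B := L + (`|a| + q) * `|v| + 1.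
  have B0 : 0 < B.
    rewrite /B; have : 0 <= (`|a| + q) * `|v| by rewrite mulr_ge0// addr_ge0// ltW.
    by lra.
  have [n0 n0P] := small_inv (e := Num.min del (rho / B)) ltac:(by rewrite lt_min del0 divr_gt0).
  exists ([set b | `|b - a| < q], [set n | (n0 <= n)%N]) => /=.
    split; last by exists n0.
    by apply/nbhs_ballP; exists q => // b; rewrite /ball/= distrC.
  move=> [b n] /= [ba nn] r u /andP[r0 rn] uL.
  have : r < Num.min del (rho / B).
    apply: lt_le_trans rn _; apply: le_trans (ltW n0P).
    by rewrite lef_pV2 ?posrE// ler_nat.
  rewrite lt_min ltr_pdivlMr// => /andP[rdel rB].
  have inG (y : X) : `|y| <= r * B -> G (x + y).
    by move=> yB; apply: rhoG; rewrite addrC addKr; exact: le_lt_trans rB.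
  have nu : `|r *: u| <= r * L by rewrite normrZ gtr0_norm// ler_pM2l.
  have nc c : `|c - a| < q -> `|r *: (c *: v)| <= r * ((`|a| + q) * `|v|).
    move=> ca; rewrite !normrZ gtr0_norm// ler_pM2l// ler_wpM2r//.
    have := ler_normD (c - a) a; rewrite subrK => /le_trans; apply.
    by rewrite addrC lerD2l ltW.
  have na := nc a; rewrite subrr normr0 in na; have {}na := na q0.
  have nb := nc b ba.
  have rL : 0 <= r * L by rewrite mulr_ge0// ltW.
  have rq : 0 <= r * ((`|a| + q) * `|v|) by exact: le_trans na.
  have BE : r * B = r * L + r * ((`|a| + q) * `|v|) + r by rewrite /B; ring.
  have vv : `|r *: (b *: v) - r *: (a *: v)| <= r * (e / (4 * C)).
    rewrite -scalerBr -scalerBl !normrZ gtr0_norm// ler_pM2l//.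
    apply: (@le_trans _ _ (q * (`|v| + 1))).
      by apply: ler_pM => //; [exact: ltW|rewrite lerDl].
    suff -> : q * (`|v| + 1) = e / (4 * C) by [].
    by rewrite /q; field; rewrite !gt_eqF.
  apply: le_trans (secant_lip _ _ _ _ vv) _.
  - by rewrite -addrA; apply: inG; apply: le_trans (ler_normD _ _) _; lra.
  - by rewrite -addrA; apply: inG; apply: le_trans (ler_normD _ _) _; lra.
  - by apply: inG; lra.
  - by apply: inG; lra.
  have := delP r u (a *: v); rewrite r0 rdel => /(_ isT uL erefl) h.
  have -> : e * r = e / 2 * r + 2 * C * (r * (e / (4 * C))) by field; rewrite gt_eqF.
  by rewrite lerD2r.
move=> n _ nP; exists n.+1%:R^-1; first by rewrite invr_gt0.
by move=> r u w0 r0 uL [a a1 <-]; exact: (nP n (leqnn n) a a1).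
Qed.

(** If D(u, w) is the second difference, D(u, w + w') = D(u + w', w) - D(w', w) + D(u, w'). The
    bound on [W'] keeps the shift u + w' in a fixed ball. *)
Lemma uniformly_regularD (W W' : set X) (B : R) : uniformly_regular W ->
  uniformly_regular W' -> (forall w, W' w -> `|w| <= B) ->
  uniformly_regular [set w + w' | w in W & w' in W'].
Proof.
move=> rW rW' WB L e L0 e0.
have e3 : 0 < e / 3 by rewrite divr_gt0.
have L1 : 0 < L + `|B| by rewrite ltr_wpDr.
have [a a0 aP] := rW _ _ L1 e3; have [b b0 bP] := rW' _ _ L0 e3.
exists (Num.min a b); first by rewrite lt_min a0.
move=> r u w0 /andP[r0]; rewrite lt_min => /andP[ra rb] uL [w Ww [w' Ww' <-]].
have nw' : `|w'| <= `|B| by apply: le_trans (WB _ Ww') (ler_norm B).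
have h1 := aP r (u + w') w; rewrite r0 ra in h1.
have {}h1 := h1 isT (le_trans (ler_normD _ _) (lerD uL nw')) Ww.
have h2 := aP r w' w; rewrite r0 ra in h2.
have {}h2 := h2 isT (le_trans nw' _) Ww.
have {}h2 := h2 ltac:(by rewrite lerDr ltW).
have h3 := bP r u w'; rewrite r0 rb in h3; have {}h3 := h3 isT uL Ww'.
have -> : f (x + r *: u + r *: (w + w')) - f (x + r *: u) - (f (x + r *: (w + w')) - f x) =
  (f (x + r *: (u + w') + r *: w) - f (x + r *: (u + w')) - (f (x + r *: w) - f x)) -
  (f (x + r *: w' + r *: w) - f (x + r *: w') - (f (x + r *: w) - f x)) +
  (f (x + r *: u + r *: w') - f (x + r *: u) - (f (x + r *: w') - f x)).
  have -> : x + r *: u + r *: (w + w') = x + r *: (u + w') + r *: w.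
    by rewrite !scalerDr !addrA addrAC.
  have -> : x + r *: (w + w') = x + r *: w' + r *: w by rewrite scalerDr addrA addrAC.
  have -> : x + r *: (u + w') = x + r *: u + r *: w' by rewrite scalerDr addrA.
  rewrite [X in _ = X + _]subrACA subrr subr0 [RHS]addrACA -opprD.
  by congr (_ - _); rewrite addrA subrK.
apply: le_trans (ler_normD _ _) _.
apply: le_trans (lerD (ler_normB _ _) h3) _.
have -> : e * r = e / 3 * r + e / 3 * r + e / 3 * r by field.
by rewrite lerD2r lerD.
Qed.

(** On a box of size [r] the linear part of [g t - x] is [r] times such a combination of partial
    derivatives. *)
Lemma uniformly_regular_span n (v : nat -> X) :
  uniformly_regular [set \sum_(i < n) a i *: v i | a in
    [set a : nat -> R | forall i, -1 <= a i <= 1]].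
Proof.
elim: n => [|n IH].
  move=> L e L0 e0; have [del del0 delP] := uniformly_regular1 0 L0 e0.
  by exists del => // r u w r0 uL [a _]; rewrite big_ord0 => <-; exact: delP.
have h := uniformly_regularD IH (uniformly_regular_segment (v n)) (B := `|v n|).
move=> L e L0 e0; case: (h _ L e L0 e0).
  move=> _ [a a1 <-]; rewrite normrZ ler_piMl//.
  by move: a1; rewrite /= in_itv/= ler_norml.
move=> del del0 delP; exists del => // r u w r0 uL [a a1 <-].
apply: delP => //; exists (\sum_(i < n) a i *: v i); first by exists a.
exists (a n *: v n); last by rewrite big_ord_recr.
by exists (a n) => //; rewrite /= in_itv/=; exact: a1.
Qed.

Lemma flat_all v (e : R) : 0 < e -> exists2 del : R, 0 < del & forall r, `|r| < del ->
  `|f (x + r *: v) - f x| <= (eps * `|v| + e) * `|r|.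
Proof.
move=> e0; have [rho rho0 rhoG] := radius.
(* The error in the direction enters once through [C] and once through [eps]; together this uses
   [e / 2]. *)
pose s := e / (2 * (C + `|eps|)).
have Ce : 0 < C + `|eps| by rewrite ltr_wpDr.
have s0 : 0 < s by rewrite divr_gt0// mulr_gt0.
have [i di] := dense_d v s0.
have e2 : 0 < e / 2 by rewrite divr_gt0.
have [k ke] := small_inv e2.
have [[_ /(_ i Logic.I k Logic.I)[m _ mP]] _] := bx.
have B0 : 0 < `|v| + `|d i| + 1 by rewrite ltr_wpDl// addr_ge0.
have m0 : 0 < m.+1%:R^-1 :> R by rewrite invr_gt0.
exists (Num.min m.+1%:R^-1 (rho / (`|v| + `|d i| + 1))).
  by rewrite lt_min m0 divr_gt0.
move=> r; rewrite lt_min ltr_pdivlMr// => /andP[rm rr].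
have inG (y : X) : `|y| <= `|v| + `|d i| + 1 -> G (x + r *: y).
  move=> yB; apply: rhoG; rewrite addrC addKr normrZ; apply: le_lt_trans rr.
  by rewrite ler_wpM2l.
have v0 := normr_ge0 v; have d0 := normr_ge0 (d i).
have Gv : G (x + r *: v) by apply: inG; lra.
have Gd : G (x + r *: d i) by apply: inG; lra.
have h1 := mP r rm Gd Gx.
have h2 : `|f (x + r *: v) - f (x + r *: d i)| <= C * (`|r| * s).
  apply: lip_at => //; rewrite opprD addrACA subrr add0r -scalerBr normrZ.
  by rewrite ler_wpM2l// distrC ltW.
have h3 : eps * `|d i| <= eps * `|v| + `|eps| * s.
  rewrite -lerBlDl -mulrBr; apply: le_trans (ler_norm _) _; rewrite normrM ler_wpM2l//.
  by apply: le_trans (ler_dist_dist _ _) _; exact: ltW.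
have := ler_normD (f (x + r *: v) - f (x + r *: d i)) (f (x + r *: d i) - f x).
rewrite addrA subrK => /le_trans; apply.
apply: le_trans (lerD h2 h1) _.
rewrite mulrCA [`|r| * _]mulrC -mulrDl ler_wpM2r//.
have : (C + `|eps|) * s = e / 2 by rewrite /s; field; rewrite gt_eqF.
by move: ke; set q := k.+1%:R^-1; lra.
Qed.

Lemma steep_all (e : R) : 0 < e -> exists u, [/\ `|u| < e, G (x + u) &
  4 * eps * `|u| < `|f (x + u) - f x|].
Proof.
move=> e0; have [m me] := small_inv e0; have [_ /(_ m Logic.I)[u [um Gu _ h]]] := bx.
by exists u; split => //; exact: lt_trans um me.
Qed.

End at_bad_point.
End bad_points.

(** * Boxes on which the increment along a fixed vector is large *)

Section steep_boxes.
Context {R : realType} {X Y : normedModType R} (G : set X) (f : X -> Y) (eps C : R).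
Context (oG : open G) (C0 : 0 < C) (eps0 : 0 < eps)
  (lipf : forall x y, G x -> G y -> `|f x - f y| <= C * `|x - y|).
Context (d : nat -> X) (dense_d : forall (x : X) (e : R), 0 < e -> exists i, `|d i - x| < e).
Local Notation I := (set_type (unit_itv R)).
Local Notation T := (cube R).
Local Notation N := (bad_points G f eps d).

Lemma dyadic_scale (y : R) J : 0 < y -> y <= (2 ^ J)%:R^-1 ->
  exists2 j, (J <= j)%N & y <= (2 ^ j)%:R^-1 < 2 * y.
Proof.
move=> y0 yJ.
have ex : exists j, (2 ^ j)%:R^-1 < y.
  by have [j /(_ j (leqnn j)) jy] := pow2_small y0; exists j.
case: (ex_minnP ex) => -[|j] jy jmin.
  exfalso; move: jy; rewrite ltNge; apply/negP; rewrite negbK; apply: le_trans yJ _.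
  by rewrite lef_pV2 ?posrE ?pow2_gt0// ler_nat leq_pexp2l.
have hj : y <= (2 ^ j)%:R^-1 by rewrite leNgt; apply/negP => /jmin; rewrite ltnn.
exists j; last first.
  by rewrite hj /=; move: jy; rewrite expnS natrM invfM -ltr_pdivlMl ?invr_gt0// invrK.
rewrite leqNgt; apply/negP => jJ.
have : (2 ^ J)%:R^-1 <= (2 ^ j.+1)%:R^-1 :> R.
  by rewrite lef_pV2 ?posrE ?pow2_gt0// ler_nat leq_pexp2l.
by move=> /(le_trans yJ); rewrite leNgt jy.
Qed.

(** The ball of radius [2 * |u|] has room for a perturbed line from [g t] to [g t + u]; the factor 3
    is what remains of 4 after the transport from the bad point to [g t]. *)
Definition steep_box (g : T -> X) m (K : R) (b : nat * seq nat) (u : X) :=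
  [/\ 0 < `|u|, K * `|u| <= (2 ^ b.1)%:R^-1,
      forall t z, dbox m b t -> `|z - g t| <= 2 * `|u| -> G z &
      forall t, dbox m b t -> 3 * eps * `|u| <= `|f (g t + u) - f (g t)|].

Lemma steep_box_exists (g : Gamma X) m (t0 : T) (K : R) J : 1 <= K ->
  (forall s t, (forall i, (i < m)%N -> s i = t i) -> g s = g t) -> N (g t0) ->
  exists2 j, (J <= j)%N & exists u, steep_box g m K (dbox_at m j t0) u.
Proof.
move=> K1 gm bx; set x := g t0 in bx.
have K0 : 0 < K by lra.
have Gx : G x by case: bx => -[[]].
have /nbhs_ballP[rho /= rho0 rhoG] : nbhs x G by exact: open_nbhs_nbhs.
pose v i := partial i g t0.
(* Regularity at this rate, and the nonlinearity of [g] measured by [s] below, cost at most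
   [eps * |u| / 2] each, because the box has size less than [2 * K * |u|]. *)
have e0 : 0 < eps / (4 * K) by rewrite divr_gt0// mulr_gt0.
have [del del0 delP] := uniformly_regular_span oG C0 lipf dense_d bx m v ltr01 e0.
pose s := eps / (8 * K * C * m.+1%:R).
have s0 : 0 < s by rewrite divr_gt0// !mulr_gt0.
have [J1 J1P] := gamma_diff t0 s0 gm.
pose B := \sum_(i < m) `|v i| + m%:R * s + 4.
have sv0 : 0 <= \sum_(i < m) `|v i| by apply: sumr_ge0.
have ms0 : 0 <= m%:R * s by rewrite mulr_ge0// ltW.
have B0 : 0 < B by rewrite /B; lra.
have [J2 J2P] : exists J2, forall j, (J2 <= j)%N -> (2 ^ j)%:R^-1 < Num.min del (rho / B).
  by apply: pow2_small; rewrite lt_min del0 divr_gt0.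
pose J3 := maxn J (maxn J1 J2).
(* The vector comes first and determines the size of the box; it is taken so small that [J3 <= j]
   follows. *)
have [u [us Gu hu]] := @steep_all _ _ _ _ _ _ _ _ bx ((2 ^ J3)%:R^-1 / K)
  ltac:(by rewrite divr_gt0// invr_gt0 pow2_gt0).
have u0 : 0 < `|u|.
  rewrite normr_gt0; apply/eqP => uz; move: hu.
  by rewrite uz normr0 mulr0 addr0 subrr normr0 ltxx.
have Ku : K * `|u| <= (2 ^ J3)%:R^-1 by rewrite mulrC -ler_pdivlMr// ltW.
have [j jJ3 /andP[Kj jK]] := dyadic_scale (mulr_gt0 K0 u0) Ku.
have [jJ jJ1 jJ2] : [/\ (J <= j)%N, (J1 <= j)%N & (J2 <= j)%N].
  by move: jJ3; rewrite !geq_max => /andP[-> /andP[-> ->]].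
exists j => //; exists u.
set l : R := (2 ^ j)%:R^-1 in Kj jK.
have l0 : 0 < l by rewrite invr_gt0 pow2_gt0.
have ul : `|u| <= l by apply: le_trans Kj; rewrite ler_pMl.
have := J2P _ jJ2; rewrite lt_min -/l ltr_pdivlMr// => /andP[ldel lB].
have main (t : T) : dbox m (dbox_at m j t0) t ->
  `|g t - x| <= l * (\sum_(i < m) `|v i| + m%:R * s) /\
  3 * eps * `|u| <= `|f (g t + u) - f (g t)|.
  move=> bt; have := J1P _ jJ1 _ bt; rewrite -/x -/l => dt.
  pose a i : R := if (i < m)%N then (\val (t i) - \val (t0 i)) * (2 ^ j)%:R else 0.
  have a1 i : -1 <= a i <= 1.
    rewrite -ler_norml /a; case: ifP => im; last by rewrite normr0.
    rewrite normrM [`|_%:R|]gtr0_norm ?pow2_gt0// -ler_pdivlMr ?pow2_gt0// mul1r.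
    exact: ltW (dbox_close bt (@dbox_atP _ m j t0) im).
  pose w0 := \sum_(i < m) a i *: v i.
  have lw0 : l *: w0 = \sum_(i < m) (\val (t i) - \val (t0 i)) *: partial i g t0.
    rewrite scaler_sumr; apply: eq_bigr => i _; rewrite scalerA /a ltn_ord.
    by rewrite mulrC -mulrA mulfV ?mulr1// gt_eqF// pow2_gt0.
  rewrite -lw0 in dt.
  have nw0 : `|w0| <= \sum_(i < m) `|v i|.
    apply: le_trans (ler_norm_sum _ _ _) _; apply: ler_sum => i _.
    by rewrite normrZ ler_piMl// ler_norml.
  have nl : `|l *: w0| <= l * \sum_(i < m) `|v i| by rewrite normrZ gtr0_norm// ler_pM2l.
  have dt' : `|g t - x - l *: w0| <= l * (m%:R * s) by rewrite mulrCA mulrC in dt *; rewrite mulrA [l * _]mulrC.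
  have gx : `|g t - x| <= l * (\sum_(i < m) `|v i| + m%:R * s).
    have := ler_normD (g t - x - l *: w0) (l *: w0); rewrite subrK mulrDr => /le_trans; apply.
    by rewrite addrC lerD.
  split => //.
  have lBE : l * B = l * \sum_(i < m) `|v i| + l * (m%:R * s) + 4 * l by rewrite /B; ring.
  rewrite mulrDr in gx.
  have ls0 : 0 <= l * \sum_(i < m) `|v i| by rewrite mulr_ge0// ltW.
  have lm0 : 0 <= l * (m%:R * s) by rewrite mulr_ge0// ltW.
  have inG y : `|y| <= l * B -> G (x + y).
    move=> yB; apply: rhoG; rewrite -ball_normE /= opprD addNKr normrN.
    exact: le_lt_trans lB.
  (* Regularity at the scale [l] of the box: [u] is [l] times a vector of norm at most 1, and [w0]
     has coefficients in [-1, 1]. *)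
  have := delP l (l^-1 *: u) w0; rewrite l0 ldel => /(_ isT).
  rewrite scalerA mulfV ?gt_eqF// scale1r normrZ gtr0_norm ?invr_gt0//.
  rewrite ler_pdivrMl// mulr1 => /(_ ul) h.
  have {}h := h ltac:(by exists a).
  have gE : x + (g t - x) = g t by rewrite addrC subrK.
  have guE : x + u + (g t - x) = g t + u by rewrite addrAC gE.
  have := @secant_lip _ _ _ G f _ C0 lipf x u (g t - x) (l *: w0) (l * (m%:R * s)).
  rewrite guE gE => h2.
  have {h2} : `|f (g t + u) - f (x + u) - (f (g t) - f x)| <= eps * `|u|.
    have uB : `|u| <= l * B by lra.
    apply: le_trans (h2 _ _ _ _ dt') _.
    - by rewrite -guE -addrA; apply: inG; apply: le_trans (ler_normD _ _) _; lra.
    - by rewrite -addrA; apply: inG; apply: le_trans (ler_normD _ _) _; lra.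
    - by rewrite -gE; apply: inG; lra.
    - by apply: inG; lra.
    apply: le_trans (lerD h (lexx _)) _.
    have m1 : m%:R * s <= eps / (8 * K * C).
      have -> : eps / (8 * K * C) = m.+1%:R * s.
        by rewrite /s; field; rewrite !gt_eqF.
      by rewrite ler_pM2r// ler_nat.
    have h3 : 2 * C * (l * (m%:R * s)) <= 2 * C * (l * (eps / (8 * K * C))).
      by rewrite ler_pM2l ?mulr_gt0// ler_pM2l.
    apply: le_trans (lerD (lexx _) h3) _.
    have -> : eps / (4 * K) * l + 2 * C * (l * (eps / (8 * K * C))) = l * (eps / (2 * K)).
      by field; rewrite !gt_eqF.
    have -> : eps * `|u| = 2 * (K * `|u|) * (eps / (2 * K)) by field; rewrite gt_eqF.
    by rewrite ler_pM2r ?divr_gt0 ?mulr_gt0// ltW.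
  (* By symmetry of the second difference, the bound now compares the increments along [u] at [g t]
     and at [x]. *)
  rewrite subrACA => h3.
  have := ler_normB (f (g t + u) - f (g t)) (f (g t + u) - f (g t) - (f (x + u) - f x)).
  rewrite subKr => h4.
  by move: hu h3 h4; lra.
split => //.
- move=> t z bt zu; apply: rhoG; rewrite -ball_normE /= distrC.
  have [gx _] := main t bt.
  have := ler_normD (z - g t) (g t - x); rewrite addrA subrK => /le_lt_trans; apply.
  apply: le_lt_trans lB; rewrite /B [leRHS]mulrDr addrC; apply: lerD => //.
  by apply: le_trans zu _; lra.
- by move=> t /main[].
Qed.

Lemma measurable_curve (c : R -> X) (A : set X) : continuous c -> borel A ->
  measurable (c @^-1` A).
Proof.
move=> cc; move: A; apply: smallest_sub.
  split=> [|A mA|F mF].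
  - by rewrite preimage_set0.
  - by rewrite setTD preimage_setC; exact: measurableC.
  - by rewrite preimage_bigcup; exact: bigcupT_measurable.
by move=> U oU; apply: open_measurable; move/continuousP : cc; exact.
Qed.

(** Good in the sense that [flat_all] bounds the increments of [f] at points of the bad set. *)
Definition good_times (g : T -> X) (t : T) q : set R :=
  [set r | N (g (dfwith t q (clip r)))].

Lemma measurable_good_times (g : Gamma X) t q : measurable (good_times g t q).
Proof.
apply: (@measurable_curve (fun r => g (dfwith t q (clip r)))); last exact: borel_bad_points lipf _.
move=> r; apply: (@continuous_comp _ _ _ clip (fun s => g (dfwith t q s))).
  exact: clip_continuous.
apply: (@continuous_comp _ _ _ (dfwith t q : I -> T) g).
  exact: (@dfwith_continuous nat (fun=> I) t q).
exact: (gamma_continuous (g := g)).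
Qed.

(** [line_bound] applies with the rate [2 * eps * |u|] at good times and the Lipschitz rate
    [2 * C * |u|] at the others. The ends miss [y] and [y + u] by at most [rho], which costs
    [eps * |u| / 4] each. *)
Lemma line_bad (g : Gamma X) (t : T) q (y u : X) (rho : R) :
  0 < `|u| -> rho <= `|u| -> rho <= eps / (4 * C) * `|u| ->
  (forall r, 0 <= r <= 1 -> `|partial q g (dfwith t q (clip r)) - u| <= rho) ->
  (forall r, 0 <= r <= 1 -> `|g (dfwith t q (clip r)) - (y + r *: u)| <= rho) ->
  (forall z, `|z - y| <= 2 * `|u| -> G z) ->
  3 * eps * `|u| <= `|f (y + u) - f y| ->
  eps / (4 * C) <= side_length (~` good_times g t q).
Proof.
move=> u0 rho1 rho2 dg gg inG fu.
pose c r := g (dfwith t q (clip r)); pose p r := partial q g (dfwith t q (clip r)).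
have np r : 0 <= r <= 1 -> `|p r| <= 2 * `|u|.
  move=> r01; have := ler_normD (p r - u) u; rewrite subrK => /le_trans; apply.
  by have := dg r r01; rewrite -/(p r); lra.
have Gc r : 0 <= r <= 1 -> G (c r).
  move=> r01; apply: inG; have /andP[r0 r1] := r01.
  have := ler_normD (c r - (y + r *: u)) (r *: u).
  rewrite opprD addrA subrK => /le_trans; apply.
  have : `|r *: u| <= `|u| by rewrite normrZ ger0_norm// ler_piMl.
  by have := gg r r01; rewrite opprD addrA -/(c r); lra.
have Ceu : 0 <= 2 * C * `|u| by rewrite !mulr_ge0// ltW.
have teu : 0 <= 2 * eps * `|u| by rewrite !mulr_ge0// ltW.
have mA : measurable (~` good_times g t q) by apply: measurableC; exact: measurable_good_times.
have zC z : 0 < z -> 0 < z / C by move=> z0; rewrite divr_gt0.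
have bC r z : 0 <= r <= 1 -> 0 < z -> exists2 e, 0 < e & forall s, 0 <= s <= 1 ->
    `|s - r| < e -> `|f (c s) - f (c r)| <= (2 * C * `|u| + z) * `|s - r|.
  move=> r01 z0; have [e e0 eP] := line_partial g t q r01 (zC _ z0).
  exists e => // s s01 sr; have := eP s s01 sr; rewrite -/(c s) -/(c r) -/(p r) => h.
  apply: le_trans (lipf (Gc _ s01) (Gc _ r01)) _.
  have -> : (2 * C * `|u| + z) * `|s - r| = C * ((z / C * `|s - r|) + 2 * `|u| * `|s - r|).
    by field; rewrite gt_eqF.
  rewrite ler_pM2l//; have := ler_normD (c s - c r - (s - r) *: p r) ((s - r) *: p r).
  rewrite subrK => /le_trans; apply; apply: lerD => //.
  by rewrite normrZ mulrC ler_wpM2r// np.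
have bth r z : 0 <= r <= 1 -> ~ (~` good_times g t q) r -> 0 < z ->
    exists2 e, 0 < e & forall s, 0 <= s <= 1 ->
    `|s - r| < e -> `|f (c s) - f (c r)| <= (2 * eps * `|u| + z) * `|s - r|.
  move=> r01 /contrapT gr z0.
  have z2 : 0 < z / 2 by rewrite divr_gt0.
  have [e e0 eP] := line_partial g t q r01 (zC _ z2).
  have [e' e'0 e'P] := flat_all oG C0 lipf dense_d gr (p r) z2.
  have /nbhs_ballP[e'' /= e''0 e''P] : nbhs (c r) G.
    by apply: open_nbhs_nbhs; split => //; exact: Gc.
  have p1 : 0 < `|p r| + 1 by rewrite ltr_wpDl.
  exists (Num.min e (Num.min e' (e'' / (`|p r| + 1)))).
    by rewrite !lt_min e0 e'0 divr_gt0.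
  move=> s s01; rewrite !lt_min ltr_pdivlMr// => /and3P[se se' se''].
  have h1 := eP s s01 se; have h2 := e'P _ se'.
  rewrite -/(c r) -/(c s) -/(p r) in h1 h2.
  have Gm : G (c r + (s - r) *: p r).
    apply: e''P; rewrite -ball_normE /= opprD addNKr normrN normrZ.
    by apply: le_lt_trans se''; rewrite ler_wpM2l// lerDl.
  have h3 : `|f (c s) - f (c r + (s - r) *: p r)| <= C * (z / 2 / C * `|s - r|).
    by apply: (lip_at C0 lipf) => //; [exact: Gc|rewrite opprD addrA].
  have := ler_normD (f (c s) - f (c r + (s - r) *: p r)) (f (c r + (s - r) *: p r) - f (c r)).
  rewrite addrA subrK => /le_trans; apply.
  apply: le_trans (lerD h3 h2) _.
  have -> : C * (z / 2 / C * `|s - r|) = z / 2 * `|s - r| by field; rewrite gt_eqF.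
  rewrite -mulrDl ler_wpM2r//.
  have : eps * `|p r| <= eps * (2 * `|u|) by rewrite ler_pM2l// np.
  by lra.
have h := line_bound ler01 teu Ceu mA bC bth.
have f1 : `|f (c 1) - f (y + u)| <= C * rho.
  apply: (lip_at C0 lipf); first by apply: Gc; rewrite ler01 lexx.
    by apply: inG; rewrite addrC addKr; lra.
  by have := gg 1; rewrite scale1r; apply; rewrite ler01 lexx.
have f0 : `|f (c 0) - f y| <= C * rho.
  apply: (lip_at C0 lipf); first by apply: Gc; rewrite ler01 lexx.
    by apply: inG; rewrite subrr normr0; lra.
  by have := gg 0; rewrite scale0r addr0; apply; rewrite ler01 lexx.
have Cr : C * rho <= eps / 4 * `|u|.
  have -> : eps / 4 * `|u| = C * (eps / (4 * C) * `|u|) by field; rewrite gt_eqF.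
  by rewrite ler_pM2l.
have lower : 5 / 2 * (eps * `|u|) <= `|f (c 1) - f (c 0)|.
  have : `|f (y + u) - f y| <= `|f (c 1) - f (c 0)| + (`|f (c 1) - f (y + u)| + `|f (c 0) - f y|).
    rewrite -[X in `|X| <= _](subKr (f (c 1) - f (c 0))).
    apply: le_trans (ler_normB _ _) _; rewrite lerD2l subrACA; exact: ler_normB.
  by move: fu f1 f0 Cr; lra.
move: h; rewrite subr0 mulr1 -[fine _]/(side_length (~` good_times g t q)) => h.
have := le_trans lower h; set sl := side_length _ => h1.
have : `|u| * eps <= `|u| * (sl * (4 * C)) by lra.
by rewrite ler_pM2l// ler_pdivrMr// mulr_gt0.
Qed.

End steep_boxes.

(** * Bad points form a null set *)

Section bad_points_null.
Context {R : realType} {X Y : normedModType R} (G : set X) (f : X -> Y) (eps C : R).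
Context (oG : open G) (C0 : 0 < C) (eps0 : 0 < eps)
  (lipf : forall x y, G x -> G y -> `|f x - f y| <= C * `|x - y|).
Context (d : nat -> X) (dense_d : forall (x : X) (e : R), 0 < e -> exists i, `|d i - x| < e).
Local Notation I := (set_type (unit_itv R)).
Local Notation T := (cube R).
Local Notation N := (bad_points G f eps d).

Lemma bernoulli_le (x : R) m : 0 <= x <= 1 -> 1 - m%:R * x <= (1 - x) ^+ m.
Proof.
move=> /andP[x0 x1]; elim: m => [|m IH]; first by rewrite mul0r subr0 expr0.
rewrite exprS; apply: le_trans (ler_wpM2l _ IH); last by rewrite subr_ge0.
have : 0 <= m%:R * (x * x) by rewrite !mulr_ge0.
by rewrite -(@natr1 R m); lra.
Qed.

(** A line along coordinate [m] through a point of the core stays in the core, and [g1] is constant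
    on it; so [line_bad] applies to [gh] on each such line, and Fubini in that coordinate collects
    the lines. *)
Lemma vol_bad_box (g1 gh : Gamma X) m (kappa K rho : R) b u :
  0 < kappa -> 2 * kappa <= 1 ->
  (forall s t, (forall i, (i < m)%N -> s i = t i) -> g1 s = g1 t) ->
  steep_box G f eps g1 m K b u -> rho <= `|u| -> rho <= eps / (4 * C) * `|u| ->
  (forall t, core m kappa b t -> `|gh t - (g1 t + \val (t m) *: u)| <= rho) ->
  (forall t, core m kappa b t -> `|partial m gh t - u| <= rho) ->
  eps / (4 * C) * ((1 - 2 * kappa) ^+ m * vol (dbox m b)) <= vol (dbox m b `\` pre gh N).
Proof.
move=> k0 k1 gm [u0 _ inG hu] rho1 rho2 h0 h1.
have c0 : 0 < eps / (4 * C) by rewrite divr_gt0// mulr_gt0.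
have mD : measurable (dbox (R := R) m b `\` pre gh N).
  apply: measurableD; first exact: measurable_dbox.
  by apply: measurable_pre; exact: borel_bad_points lipf _.
apply: (@le_trans _ _ (eps / (4 * C) * vol (core m kappa b))).
  by rewrite ler_pM2l//; exact: vol_core.
apply: (@vol_section_ge _ (fun i => i != m) _ _ _ (ltW c0) mD (measurable_core _ _ _)).
move=> t ct; have bt := core_sub k0 ct.
have mE (s : T) : mix (fun i => i != m) t s = dfwith t m (s m).
  apply: functional_extensionality_dep => i; rewrite /mix.
  by have [->|im] := eqVneq i m; rewrite ?dfwithin// dfwithout// eq_sym.
have cdf (r : I) : core m kappa b (dfwith t m r).
  by move=> i im; rewrite dfwithout ?gtn_eqF//; exact: ct.
have bad : eps / (4 * C) <= side_length (~` good_times G f eps d gh t m).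
  apply: (@line_bad _ _ _ _ _ _ _ oG C0 eps0 lipf _ dense_d gh t m (g1 t) u rho) => //.
  - by move=> r _; exact: h1.
  - move=> r r01; have := h0 _ (cdf (clip r)); rewrite dfwithin clipK//.
    rewrite (gm (dfwith t m (clip r)) t)// => i im.
    by rewrite dfwithout// gtn_eqF.
  - by move=> z; exact: inG.
  - exact: hu.
apply: le_trans bad _.
rewrite -(@vol_slab _ m); last by apply: measurableC; exact: measurable_good_times lipf _ _ _ _.
apply: le_vol => s sb; rewrite /preimage /= mE; split.
  by apply: (core_sub k0); exact: cdf.
by move=> ns; apply: sb; rewrite /good_times /= clip_val.
Qed.

Lemma pairwise_disj_subset (A : Type) (F F' : A -> set T) (l : seq A) :
  (forall a, F' a `<=` F a) -> pairwise (fun a b => `[< F a `&` F b = set0 >]) l ->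
  pairwise (fun a b => `[< F' a `&` F' b = set0 >]) l.
Proof.
move=> FF; apply: sub_pairwise => a b /asboolP ab; apply/asboolP.
by apply/seteqP; split => // t [/FF ta /FF tb]; rewrite -ab.
Qed.

(** Since the boxes are finitely many, one tolerance serves all of them. *)
Lemma steep_margin (g : T -> X) m K (l : seq (nat * seq nat)) u (e : R) : 0 < e ->
  {in l, forall b, steep_box G f eps g m K b (u b)} ->
  exists2 rho : R, 0 < rho <= e & {in l, forall b, rho <= `|u b| /\ rho <= eps / (4 * C) * `|u b|}.
Proof.
move=> e0; elim: l => [_|b l IH sl]; first by exists e => //; rewrite e0 lexx.
have [|rho /andP[rho0 rhoe] rhoP] := IH.
  by move=> x xl; apply: sl; rewrite inE xl orbT.
have [u0 _ _ _] := sl b (mem_head _ _).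
have c0 : 0 < eps / (4 * C) by rewrite divr_gt0// mulr_gt0.
exists (Num.min rho (Num.min `|u b| (eps / (4 * C) * `|u b|))).
  by rewrite !lt_min rho0 u0 mulr_gt0//= ge_min rhoe.
move=> x; rewrite inE => /predU1P[->|/rhoP[h1 h2]].
  by rewrite !ge_min !lexx /= !orbT.
by rewrite !ge_min h1 h2.
Qed.

Lemma vol_bad_zero (S : set (Gamma X)) (g0 : Gamma X) :
  ~ residual (set0 : set (Gamma X)) -> residual S -> stable_on S N -> S g0 ->
  vol (pre g0 N) = 0.
Proof.
move=> n0 rS sS Sg0; apply/eqP; rewrite eq_le vol_ge0 andbT leNgt; apply/negP.
set M := pre g0 N; set a := vol M => a0.
have bN : borel N by exact: borel_bad_points lipf _.
have mM : measurable M by exact: measurable_pre.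
pose c := eps / (4 * C).
have c0 : 0 < c by rewrite divr_gt0// mulr_gt0.
have ca0 : 0 < c * a by rewrite mulr_gt0.
(* [a / 4] leaves more than [a / 2] of [M] inside [Q]; [c * a / 32] makes the admissible error
   [2 * eta] smaller than the loss [c * a / 8]. *)
pose eta := Num.min (a / 4) (c * a / 32).
have eta0 : 0 < eta by rewrite lt_min !divr_gt0.
have eta1 : eta <= a / 4 by rewrite ge_min lexx.
have eta2 : eta <= c * a / 32 by rewrite ge_min lexx orbT.
have [mQ [Q [oQ cQ vQM vMQ]]] := cube_approx mM eta0.
have /nbhs_gammaP[n [e e0 st]] := sS g0 Sg0 eta eta0.
(* Freezing, the bumps and the final move into [S] may each change the first [n] jets by [e / 3]. *)
have e3 : 0 < e / 3 by rewrite divr_gt0.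
have [m0 tail] := gamma_tail g0 n e3.
pose m := maxn mQ (maxn n m0).
have [mmQ mn mm0] : [/\ (mQ <= m)%N, (n <= m)%N & (m0 <= m)%N].
  by rewrite /m !leq_max !leqnn /= !orbT.
have cQm : mcyl m Q.
  by move=> s t E; apply: cQ => i im; apply: E; exact: leq_trans mmQ.
have mQQ : measurable Q by exact: open_measurable_cube.
(* Freezing changes where the surface meets [N]; by Fubini some tail [tau] keeps a section of volume
   more than [a / 2]. *)
have [tau vtau] : exists tau, a / 2 < vol (mix (fun i => m <= i)%N tau @^-1` (M `&` Q)).
  apply: vol_section_gt; first exact: measurableI.
  by have := vol_split mM mQQ; rewrite -/a; lra.
have mixE t : mix (fun i => m <= i)%N tau t = mix (fun i => i < m)%N t tau.
  by apply: functional_extensionality_dep => i; rewrite /mix leqNgt; case: (i < m)%N.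
have [g1 g1E] := gamma_freeze g0 m tau.
have g1t t : g1 t = g0 (mix (fun i => i < m)%N t tau) := g1E 0%N t.
have gm s t : (forall i, (i < m)%N -> s i = t i) -> g1 s = g1 t.
  move=> E; rewrite !g1t; congr (g0 _); apply: functional_extensionality_dep => i.
  by rewrite /mix; case: ifP => // /E.
(* By Bernoulli's inequality the cores then keep at least half of the volume of their boxes. *)
pose kappa : R := (4 * m.+1%:R)^-1.
have m1 : 1 <= m.+1%:R :> R by rewrite ler1n.
have k0 : 0 < kappa by rewrite invr_gt0 mulr_gt0.
have k4 : kappa * (4 * m.+1%:R) = 1 by rewrite mulVf// gt_eqF// mulr_gt0.
have k1 : 2 * kappa <= 1.
  have : kappa * 4 <= kappa * (4 * m.+1%:R) by rewrite ler_pM2l// ler_pMr.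
  by lra.
have half : 2^-1 <= (1 - 2 * kappa) ^+ m.
  apply: le_trans (bernoulli_le m _); last by apply/andP; split; lra.
  have : m%:R * kappa <= 4^-1.
    have : kappa * (4 * m%:R) <= kappa * (4 * m.+1%:R).
      by rewrite ler_pM2l// ler_pM2l// ler_nat.
    by rewrite k4; lra.
  by lra.
(* The term [6 / (kappa * e)] brings the slopes of the bumps below [e / 3], the term [3 / e] their
   heights. *)
pose K : R := 1 + 6 / (kappa * e) + 3 / e.
have K1 : 0 < 6 / (kappa * e) by rewrite divr_gt0// mulr_gt0.
have K2 : 0 < 3 / e by rewrite divr_gt0.
have K3 : 1 <= K by rewrite /K; lra.
pose good b := dbox m b `<=` Q /\ exists u, steep_box G f eps g1 m K b u.
pose F p : set T := if unpickle p is Some b then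
  (if `[< good b >] then dbox m b else set0) else set0.
have mF p : measurable (F p).
  by rewrite /F; case: (unpickle p) => // b; case: ifP => // _; exact: measurable_dbox.
have HF : mix (fun i => m <= i)%N tau @^-1` (M `&` Q) `<=` \bigcup_p F p.
  move=> t []; rewrite mixE => Mt Qt.
  have {}Qt : Q t by apply: cQm Qt => i im; rewrite /mix im.
  have [J JP] := open_dbox oQ cQm Qt.
  have Nt : N (g1 t) by rewrite g1t.
  have [j Jj [u su]] := @steep_box_exists _ _ _ _ _ _ _ oG C0 eps0 lipf _ dense_d g1 m t K J K3 gm Nt.
  exists (pickle (dbox_at m j t)) => //; rewrite /F pickleK ifT; first exact: dbox_atP.
  by apply/asboolP; split; [exact: JP|exists u].
have a4 : 0 < a / 4 by rewrite divr_gt0.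
(* The perturbation must be a finite sum; finitely many good boxes still cover more than [a / 4]. *)
have [P vP] := vol_tail mF a4.
pose l := [seq b <- pmap unpickle (iota 0 P) | `[< good b >]].
have [l' [ll' cl dl]] := dbox_disjoint_sub (R := R) m l.
have good_l b : b \in l' -> good b by move=> /ll'; rewrite mem_filter => /andP[/asboolP].
pose W := [set t | exists2 b, b \in l' & dbox (R := R) m b t].
have vW : a / 4 < vol W.
  have FW : \bigcup_(p < P) F p `<=` W.
    move=> t [p /= pP]; rewrite /F; case E: (unpickle p) => [b|//].
    case: ifP => // gb bt; apply: cl; exists b => //.
    rewrite mem_filter gb mem_pmap; apply/mapP; exists p => //.
    by rewrite mem_iota.
  have h1 := le_vol HF; have h2 := le_vol FW.
  have h3 := volU_le (\bigcup_p F p `\` \bigcup_(p < P) F p) (\bigcup_(p < P) F p).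
  have h4 : vol (\bigcup_p F p) <=
      vol ((\bigcup_p F p `\` \bigcup_(p < P) F p) `|` \bigcup_(p < P) F p).
    apply: le_vol => t Ft; have [?|?] := pselect ((\bigcup_(p < P) F p) t); last by left.
    by right.
  lra.
have [u su] : {u : nat * seq nat -> X & forall b, b \in l' -> steep_box G f eps g1 m K b (u b)}.
  apply: (@choice _ _ (fun b v => b \in l' -> steep_box G f eps g1 m K b v)) => b.
  have [/good_l[_ [v sv]]|nb] := boolP (b \in l'); first by exists v.
  by exists 0.
have [h [h1 h2 h3]] := gamma_bumps u k0 k1 dl.
have scale b : b \in l' -> K * `|u b| * (2 ^ b.1)%:R <= 1.
  by move=> bl; have [_ hk _ _] := su b bl; rewrite -ler_pdivlMr ?pow2_gt0// mul1r.
have hs k t : (k < n)%N -> `|jet k h t| <= e / 3.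
  case: k => [_|j jn].
    apply: h1; first exact: ltW.
    move=> b bl; have := scale b bl.
    have p1 : 1 <= (2 ^ b.1)%:R :> R by rewrite ler1n expn_gt0.
    have [u0 _ _ _] := su b bl.
    have : 3 / e * `|u b| <= K * `|u b| * (2 ^ b.1)%:R.
      apply: (@le_trans _ _ (K * `|u b|)); first by rewrite ler_pM2r// /K; lra.
      by rewrite ler_peMr// mulr_ge0// ltW//; lra.
    move=> /le_trans /[apply].
    by rewrite mulrAC ler_pdivrMr// mul1r; lra.
  apply: h2; [exact: ltW| |exact: leq_trans (ltnW jn) mn].
  move=> b bl; have := scale b bl.
  have p0 := pow2_gt0 (R := R) b.1.
  have [u0 _ _ _] := su b bl.
  have : 6 / (kappa * e) * `|u b| * (2 ^ b.1)%:R <= K * `|u b| * (2 ^ b.1)%:R.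
    by rewrite !ler_pM2r// /K; lra.
  move=> /le_trans /[apply] h6.
  have -> : 2 / (kappa / (2 ^ b.1)%:R) * `|u b| =
      e / 3 * (6 / (kappa * e) * `|u b| * (2 ^ b.1)%:R).
    by field; rewrite !gt_eqF.
  by rewrite ler_piMr// ltW.
have [rho /andP[rho0 rhoe] rhoP] := steep_margin e3 su.
have [g2 g2E] := gamma_lin 1 g1 h.
(* The bound [m.+2] includes [jet m.+1], that is [partial m], whereas closeness to [g0] concerns
   only the jets below [n <= m]. *)
have g2N : nbhs g2 (jet_close m.+2 rho g2).
  by apply/nbhs_gammaP; exists m.+2, rho.
have [gh Sgh ghP] := residual_dense n0 rS g2N.
have [vMg _] : vol (M `\` pre gh N) <= eta /\ vol (pre gh N `\` M) <= eta.
  apply: (st gh _ Sgh) => k kn t.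
  have b1 := ghP k (leq_trans kn (leq_trans mn (leqW (leqnSn m)))) t.
  have b2 := hs k t kn.
  have b3 : `|jet k g1 t - jet k g0 t| <= e / 3.
    have -> : jet k g1 t = jet k g0 (mix (fun i => i < m)%N t tau).
      rewrite g1E; case: k kn {b1 b2} => // j jn.
      by rewrite (leq_trans (ltnW jn) mn).
    exact: tail.
  rewrite g2E scale1r in b1.
  have := ler_normD (jet k gh t - (jet k g1 t + jet k h t))
    (jet k h t + (jet k g1 t - jet k g0 t)).
  have := ler_normD (jet k h t) (jet k g1 t - jet k g0 t).
  have -> : jet k gh t - (jet k g1 t + jet k h t) + (jet k h t + (jet k g1 t - jet k g0 t)) =
      jet k gh t - jet k g0 t.
    by rewrite [jet k h t + (_ - _)]addrA [X in _ + (X - _)]addrC addrA subrK.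
  by move: b1 b2 b3 rhoe; lra.
have lower b : b \in l' -> c / 2 * vol (dbox (R := R) m b) <= vol (dbox m b `\` pre gh N).
  move=> bl; have [r1 r2] := rhoP b bl.
  apply: le_trans (@vol_bad_box g1 gh m kappa K rho b (u b) k0 k1 gm (su b bl) r1 r2 _ _).
  - rewrite -/c -mulrA ler_pM2l// ler_wpM2r// vol_ge0//.
  - move=> t ct; have [E _] := h3 b t bl ct.
    have := ghP 0%N isT t; rewrite g2E scale1r.
    by rewrite -[jet 0 h t]/(h t) E.
  - move=> t ct; have [_ E] := h3 b t bl ct.
    have := ghP m.+1 (ltnSn _) t; rewrite g2E scale1r E.
    by rewrite g1E ltnn add0r.
have mD b : measurable (dbox (R := R) m b `\` pre gh N).
  by apply: measurableD; [exact: measurable_dbox|exact: measurable_pre].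
have dl' := pairwise_disj_subset (fun b => @subDsetl _ (dbox (R := R) m b) (pre gh N)) dl.
have v1 := vol_bigU mD dl'.
have v2 := vol_bigU (measurable_dbox (R := R) m) dl.
have v3 : c / 2 * vol W <= vol [set t | exists2 b, b \in l' & (dbox m b `\` pre gh N) t].
  rewrite v1 v2 mulr_sumr big_seq_cond [leRHS]big_seq_cond.
  by apply: ler_sum => b; rewrite andbT; exact: lower.
(* The boxes lie in [Q], so a point of theirs outside the new preimage was either outside [M]
   already or has left it. *)
have v4 : vol [set t | exists2 b, b \in l' & (dbox m b `\` pre gh N) t] <=
    vol ((Q `\` M) `|` (M `\` pre gh N)).
  apply: le_vol => t [b bl [bt nt]]; have [bQ _] := good_l b bl.
  by have [?|?] := pselect (M t); [right|left]; split => //; exact: bQ.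
have v5 := volU_le (Q `\` M) (M `\` pre gh N).
have v6 : c / 2 * (a / 4) < c / 2 * vol W by rewrite ltr_pM2l// divr_gt0.
have : c / 2 * (a / 4) < 2 * eta by lra.
by rewrite ltNge; apply/negP; rewrite negbK; lra.
Qed.

Lemma borel_Gamma_null_bad_points : borel_Gamma_null N.
Proof.
have bN : borel N by exact: borel_bad_points lipf _.
split=> //; have [r0|n0] := pselect (residual (set0 : set (Gamma X))).
  by exists set0.
have [S rS sS] := borel_stable bN.
exists S => // g Sg; rewrite volE.
by congr EFin; exact: vol_bad_zero n0 rS sS Sg.
Qed.

End bad_points_null.

(** * Reduction to bad points *)

Section reduction.
Context {R : realType} {X Y : normedModType R}.

Lemma countable_sequence (U : Type) (A : set U) (x0 : U) : countable A -> A x0 ->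
  exists s : nat -> U, (forall n, A (s n)) /\ forall x, A x -> exists n, s n = x.
Proof.
move=> /countable_injP[i injA] Ax0.
have ex n : exists x, A x /\ forall y, A y -> i y = n -> y = x.
  have [[y [Ay iy]]|ny] := pselect (exists y, A y /\ i y = n).
    by exists y; split => // z Az iz; apply: injA; rewrite ?inE// iz.
  (* Integers that code no element of [A] are sent to [x0]. *)
  by exists x0; split => // z Az iz; exfalso; apply: ny; exists z.
have [s sP] := choice ex; exists s; split=> [n|x Ax]; first exact: (sP n).1.
by exists (i x); rewrite -((sP (i x)).2 x Ax erefl).
Qed.

Lemma separable_sequence : separable X -> exists d : nat -> X,
  forall (x : X) (e : R), 0 < e -> exists i, `|d i - x| < e.
Proof.
move=> [D cD dD]; have meet (x : X) (e : R) : 0 < e -> exists2 y, D y & `|y - x| < e.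
  move=> e0; have [||y [yx Dy]] := dD (ball x e).
  - by exists x; exact: ballxx.
  - exact: ball_open.
  by exists y => //; move: yx; rewrite -ball_normE /= distrC.
have [x0 Dx0 _] := meet 0 1 ltr01.
have [d [_ dP]] := countable_sequence cD Dx0; exists d => x e e0.
by have [y /dP[n <-] yx] := meet x e e0; exists n.
Qed.

Lemma Gamma_null_bigcup (F : nat -> set X) : (forall n, Gamma_null (F n)) ->
  Gamma_null (\bigcup_n F n).
Proof.
move=> nF; have [N NP] := choice (fun n => let: ex_intro2 N n0 FN := nF n in
  ex_intro (fun N => borel_Gamma_null N /\ F n `<=` N) N (conj n0 FN)).
exists (\bigcup_n N n); last by apply: subset_bigcup => n _; exact: (NP n).2.
split; first by apply: borel_bigcup => n; exact: (NP n).1.1.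
have [S SP] : {S : nat -> set (Gamma X) & forall n, residual (S n) /\
    forall g, S n g -> cube_measure [set t | N n (g t)] = 0%E}.
  apply: (@choice nat (set (Gamma X)) (fun n S => residual S /\
    forall g, S g -> cube_measure [set t | N n (g t)] = 0%E)) => n.
  by have [[_ [S rS S0]] _] := NP n; exists S.
exists (\bigcap_n S n); first by apply: residual_bigcap => n; exact: (SP n).1.
move=> g Sg; apply/eqP; rewrite eq_le cube_measure_ge0 andbT.
have -> : [set t | (\bigcup_n N n) (g t)] = \bigcup_n [set t | N n (g t)] by [].
apply: le_trans (@cube_measure_sigma_subadditive R _) _.
by rewrite eseries0// => n _ _; apply: (SP n).2; exact: Sg.
Qed.

Lemma linear_morph (A : X -> Y) : linear A ->
  [/\ A 0 = 0, (forall u v, A (u + v) = A u + A v), (forall u v, A (u - v) = A u - A v) &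
      forall a u, A (a *: u) = a *: A u].
Proof.
move=> linA; pose A' : {linear X -> Y} := HB.pack A (GRing.isLinear.Build R X Y *:%R A linA).
have A0 : A 0 = 0 by exact: (linear0 A').
split=> // [u v|u v|a u]; [exact: (linearD A')|exact: (linearB A')|].
by have := linA a u 0; rewrite !addr0 A0 addr0.
Qed.

(** [differentiable] speaks of a chosen differential, so it is enough to exhibit one continuous
    linear map with the right expansion. *)
Lemma differentiable_intro (f : X -> Y) (x : X) (A : X -> Y) : bounded_linear A ->
  (forall e : R, 0 < e -> exists2 r, 0 < r &
    forall u, `|u| < r -> `|f (x + u) - f x - A u| <= e * `|u|) ->
  differentiable f x.
Proof.
move=> [linA [M AM]] fA.
pose A' : {linear X -> Y} := HB.pack A (GRing.isLinear.Build R X Y *:%R A linA).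
have [A0 _ AB _] := linear_morph linA.
have cA : continuous A'.
  move=> z; apply/cvgrPdist_le => e e0.
  have M1 : 0 < `|M| + 1 by rewrite ltr_wpDl.
  apply/nbhs_ballP; exists (e / (`|M| + 1)); first by rewrite /= divr_gt0.
  move=> y; rewrite -ball_normE /= -AB => /ltW yz; apply: le_trans (AM _) _.
  apply: (@le_trans _ _ ((`|M| + 1) * `|z - y|)); last by rewrite mulrC -ler_pdivlMr.
  by rewrite ler_wpM2r//; have := ler_norm M; lra.
have H : f = (cst (f x) + A' \o center x) +o_x (center x).
  apply/eqaddoP => e e0; have [r r0 rP] := fA e e0.
  apply/nbhs_ballP; exists r => //= y; rewrite -ball_normE /= => yr.
  have := rP (y - x); rewrite distrC => /(_ yr).
  by rewrite [x + _]addrC subrK -addrA -opprD.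
apply/diffP => /=.
apply: (@getPex _ (fun (df : {linear X -> Y}) => continuous df /\
    forall y, f y = f (lim (nbhs x)) + df (y - lim (nbhs x))
                    +o_(y \near x) (y - lim (nbhs x)))).
exists A'; split=> //; apply: eqaddoEx => z; rewrite lim_id//.
by have := congr1 (@^~ z) H; exact.
Qed.

Lemma op_norm_le (A : X -> Y) v : bounded_linear A -> `|A v| <= op_norm A * `|v|.
Proof.
move=> [linA [M AM]].
have [A0 _ _ AZ] := linear_morph linA.
have [->|v0] := eqVneq v 0; first by rewrite A0 !normr0 mulr0.
have nv : 0 < `|v| by rewrite normr_gt0.
rewrite -ler_pdivrMr//.
have -> : `|A v| / `|v| = `|A (`|v|^-1 *: v)|.
  by rewrite AZ normrZ gtr0_norm ?invr_gt0// mulrC.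
apply: ub_le_sup; last first.
  by exists (`|v|^-1 *: v) => //=; rewrite normrZ gtr0_norm ?invr_gt0// mulVf// gt_eqF.
exists `|M| => _ [u /= u1 <-]; apply: le_trans (AM u) _.
apply: (@le_trans _ _ (`|M| * `|u|)); last by rewrite ler_piMr.
by rewrite ler_wpM2r// ler_norm.
Qed.

Lemma regular_pointP (f : X -> Y) (x v : X) : regular_point f x -> derivable f x v ->
  forall e : R, 0 < e -> exists2 r : R, 0 < r & forall (t : R) u, `|t| < r -> `|u| <= 1 ->
    `|f (x + t *: u + t *: v) - f (x + t *: u) - t *: 'D_v f x| <= e * `|t|.
Proof.
move=> regx dv e e0; have /nbhs_ballP[r /= r0 rP] := regx v dv e e0.
exists r => // t u tr u1; have [->|t0] := eqVneq t 0.
  by rewrite !scale0r !addr0 !subrr !normr0 mulr0.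
have nt : 0 < `|t| by rewrite normr_gt0.
have := rP t; rewrite /ball /= sub0r normrN => /(_ tr t0 u u1) /ltW h.
have -> : f (x + t *: u + t *: v) - f (x + t *: u) - t *: 'D_v f x =
    t *: (t^-1 *: (f (x + t *: u + t *: v) - f (x + t *: u)) - 'D_v f x).
  by rewrite scalerBr scalerA mulfV// scale1r.
by rewrite normrZ mulrC ler_pM2r.
Qed.

(** A linear map has no second differences, so regularity passes to f - B. Replacing the derivative
    by [B] in the Fréchet expansion costs one [eps], which leaves 4 of the 5. *)
Lemma bad_points_intro (G : set X) (f : X -> Y) (A B : X -> Y) (eps : R) (d : nat -> X) x :
  0 < eps -> open G -> G x -> regular_point f x -> (forall v, derivable f x v) ->
  bounded_linear B -> (forall v, `|'D_v f x - B v| <= eps * `|v|) ->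
  (forall r, 0 < r -> exists2 u, `|u| < r & 5 * eps * `|u| < `|f (x + u) - f x - 'D_u f x|) ->
  bad_points G (fun y => f y - B y) eps d x.
Proof.
move=> eps0 oG Gx regx dx [linB _] hB steep.
have [_ BD _ BZ] := linear_morph linB.
have incr u : f (x + u) - B (x + u) - (f x - B x) = f (x + u) - f x - B u.
  by rewrite BD subrACA [B x + _]addrC addrK.
split; first split; first split => //.
- move=> i _ k _.
  have e0 : 0 < k.+1%:R^-1 / 2 :> R by rewrite divr_gt0// invr_gt0.
  have [r r0 rP] := regular_pointP regx (dx (d i)) e0.
  have [m mr] := small_inv r0; exists m => // t u /andP[t0 tm] u1 _ _ _ _.
  have tr : `|t| < r by rewrite gtr0_norm//; exact: lt_trans mr.
  have h1 := rP t u tr u1; have h2 := rP t 0 tr ltac:(by rewrite normr0).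
  rewrite scaler0 addr0 gtr0_norm// in h1 h2.
  rewrite !BD.
  have -> : f (x + (t *: u + t *: d i)) - (B x + (B (t *: u) + B (t *: d i))) -
      (f (x + t *: u) - (B x + B (t *: u))) -
      (f (x + t *: d i) - (B x + B (t *: d i)) - (f x - B x)) =
    (f (x + t *: u + t *: d i) - f (x + t *: u) - t *: 'D_(d i) f x) -
    (f (x + t *: d i) - f x - t *: 'D_(d i) f x).
    have b1 : B x + (B (t *: u) + B (t *: d i)) - (B x + B (t *: u)) = B (t *: d i).
      by rewrite addrA [X in X - _]addrC addrK.
    have b2 : B x + B (t *: d i) - B x = B (t *: d i) by rewrite [X in X - _]addrC addrK.
    rewrite [RHS]subrACA subrr subr0 [x + (_ + _)]addrA.
    rewrite [X in X - _ = _]subrACA [X in _ - X = _]subrACA b1 b2.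
    by rewrite subrACA subrr subr0.
  apply: le_trans (ler_normB _ _) _; apply: le_trans (lerD h1 h2) _.
  by rewrite -mulrDl -splitr mulrC.
- move=> i _ k _.
  have e0 : 0 < k.+1%:R^-1 :> R by rewrite invr_gt0.
  have [r r0 rP] := regular_pointP regx (dx (d i)) e0.
  have [m mr] := small_inv r0; exists m => // t tm _ _.
  have := rP t 0 (lt_trans tm mr) ltac:(by rewrite normr0).
  rewrite scaler0 addr0 incr BZ => h.
  have := ler_normD (f (x + t *: d i) - f x - t *: 'D_(d i) f x)
    (t *: ('D_(d i) f x - B (d i))).
  rewrite scalerBr addrA subrK => /le_trans; apply.
  rewrite mulrDl addrC; apply: lerD => //.
  by rewrite -scalerBr normrZ mulrC ler_wpM2r// hB.
- move=> m _; have /nbhs_ballP[r /= r0 rG] : nbhs x G by exact: open_nbhs_nbhs.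
  have [|u] := steep (Num.min r m.+1%:R^-1); first by rewrite lt_min r0 invr_gt0 ltr0Sn.
  rewrite lt_min => /andP[ur um] hu; exists u; split => //.
    by apply: rG; rewrite -ball_normE /= opprD addNKr normrN.
  rewrite incr.
  have := ler_normB (f (x + u) - f x - B u) ('D_u f x - B u).
  have -> : f (x + u) - f x - B u - ('D_u f x - B u) = f (x + u) - f x - 'D_u f x.
    by rewrite subrACA subrr subr0.
  by have := hB u; move: hu; lra.
Qed.

End reduction.

Theorem theorem3p10 (R : realType) (X Y : completeNormedModType R)
    (G : set X) (L : set (X -> Y)) (f : X -> Y) :
  separable X ->
  open G ->
  operator_subspace L ->
  norm_separable L ->
  [lipschitz f x | x in G] ->
  Gamma_null [set x | [/\ G x,
                          regular_point f x,
                          gateaux_differentiable f x /\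
                            L (gateaux_derivative f x) &
                          ~ differentiable f x]].
Proof.
move=> /separable_sequence[d dense_d] oG [Lbd L0 Lcl] [D cD [DL Ddense]].
move=> /pinfty_ex_gt0[C C0 lipC].
have lipf x y : G x -> G y -> `|f x - f y| <= C * `|x - y|.
  by move=> Gx Gy; exact: (lipC (x, y)).
have [T0 DT0 _] := Ddense 0 1 L0 ltr01.
have [B [DB BP]] := countable_sequence cD DT0.
pose eps (k : nat) : R := k.+1%:R^-1.
have eps0 k : 0 < eps k by rewrite invr_gt0.
have null p k : Gamma_null (bad_points G (fun y => f y - B p y) (eps k) d).
  have [linB [M BM]] := Lbd _ (DL _ (DB p)).
  have [_ _ BB _] := linear_morph linB.
  have C'0 : 0 < C + `|M| by rewrite ltr_wpDr.
  exists (bad_points G (fun y => f y - B p y) (eps k) d) => //.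
  apply: (@borel_Gamma_null_bad_points _ _ _ G _ _ _ oG C'0 (eps0 k) _ d dense_d).
  move=> x y Gx Gy; rewrite subrACA -BB mulrDl.
  apply: le_trans (ler_normB _ _) _; apply: lerD; first exact: lipf.
  by apply: le_trans (BM _) _; rewrite ler_wpM2r// ler_norm.
have [N nN sub] := Gamma_null_bigcup (fun p => Gamma_null_bigcup (null p)).
exists N => //; apply: subset_trans sub => x [Gx regx [[dx bA] LA] nd].
(* If the Gateaux derivative satisfied the Fréchet expansion, [f] would be differentiable; so the
   expansion fails by a definite ratio [e] at arbitrarily small [u]. *)
have [e e0 steep] : exists2 e : R, 0 < e & forall r, 0 < r -> exists2 u, `|u| < r &
    e * `|u| < `|f (x + u) - f x - 'D_u f x|.
  apply: contrapT => nsteep; apply: nd; apply: (differentiable_intro bA) => e e0.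
  apply: contrapT => nr; apply: nsteep; exists e => // r r0.
  apply: contrapT => nu; apply: nr; exists r => // u ur.
  by rewrite leNgt; apply/negP => hu; apply: nu; exists u.
(* [bad_points_intro] asks for [5 * eps k <= e]; the operator [B p] is then taken within [eps k] of
   the derivative. *)
have [k ke] := small_inv (e := e / 5) ltac:(by rewrite divr_gt0).
have [T DT hT] := Ddense _ _ LA (eps0 k).
have [p Tp] := BP _ DT; exists p => //; exists k => //.
have hB v : `|'D_v f x - B p v| <= eps k * `|v|.
  have bl : bounded_linear (gateaux_derivative f x - T).
    rewrite addrC -scaleN1r; apply: Lbd; apply: Lcl => //; exact: DL.
  rewrite Tp; apply: le_trans (op_norm_le v bl) _.
  by rewrite ler_wpM2r// ltW.
apply: bad_points_intro => //; first exact: (Lbd _ (DL _ (DB p))).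
move=> r r0; have [u ur hu] := steep r r0; exists u => //.
apply: le_lt_trans hu; rewrite ler_wpM2r//.
by rewrite mulrC -ler_pdivlMr// ltW.
Qed.
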